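(* Let $\mathcal V$ be a finite-dimensional real vector space, $F$ a Randers norm on $\mathcal V$ with Zermelo data $(h,W)$, and $S$ a submanifold of $\mathcal V$. Let $v\in TS\setminus\mathbf 0$ and let $u\in T_{\pi(v)}S$ be linearly independent of $v$. Then the flag curvature $K_v(u)$ of $(S,F|_S)$ with flagpole $v$ and flag $u$ is $$\begin{aligned} K_v(u)=&\Big(h(\tfrac{v}{F(v)},\tfrac{v}{F(v)})-h(\tfrac{\tilde u}{|\tilde u|_h},\tfrac{v}{F(v)})^2\Big)K^h(v,u)\\ &+\frac{\big|\tfrac{v}{F(v)}-W^{\top_v}_{S\cap\Sigma}\big|_h^2}{\phi(v)^2F(v)^2h(\tilde u,\tilde u)}\Big(h(\mathrm{I\!I}'(u,u),W)\,h(\mathrm{I\!I}'(v,v),W)-h(\mathrm{I\!I}'(u,v),W)^2\Big)\\ &+\frac{1}{2F(v)^3\phi(v)^2}\big|\tfrac{v}{F(v)}-W^{\top_v}_{S\cap\Sigma}\big|_h^2\Big[h((\bar\nabla_v\mathrm{I\!I}')(v,v),W)-h(\mathrm{I\!I}'(v,v),\mathrm{I\!I}'(v,W^{\top_{\pi(v)}}))\\ &\qquad+\frac{1}{\phi(v)^2F(v)}h(\mathrm{I\!I}'(v,v),W)^2\Big(4\phi(v)-\tfrac52\big|\tfrac{v}{F(v)}-W^{\top_v}_{S\cap\Sigma}\big|_h^2\Big)\\ &\qquad-\frac{4}{\phi(v)}h(\mathrm{I\!I}'(v,v),W)\,h(\mathrm{I\!I}'(v,W^{\top_v}_{S\cap\Sigma}),W)\Big],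 \end{aligned}$$ where $K^h(v,u)$ is the Riemannian sectional curvature of the plane $\mathrm{span}\{v,u\}$ for the metric induced by $h$ on $S$, $\phi(v)=h(v/F(v)-W,v/F(v))$ and $\tilde u=u-\frac{1}{\phi(v)}h(v/F(v)-W,u)\,\frac{v}{F(v)}$.
   Context: Randers norm and Zermelo data: $h$ is a positive definite scalar product on $\mathcal V$, $W\in\mathcal V$ with $h(W,W)<1$, and $F:\mathcal V\to[0,\infty)$ is determined by $F(0)=0$ and $F(v)>0$, $h(\frac{v}{F(v)}-W,\frac{v}{F(v)}-W)=1$ for $v\neq0$. $(\mathcal V,F)$ is a Randers-Minkowski space. $\Sigma=\{v:F(v)=1\}$ is its indicatrix. Set $|x|_h^2=h(x,x)$. Tangent vectors: every tangent space of $\mathcal V$ is identified with $\mathcal V$, so for $v\in TS$ with base point $\pi(v)\in S$, $v$ and $T_{\pi(v)}S$ are regarded in $\mathcal V$ and $F(v)$, $h(v,\cdot)$ make sense; $W$ is regarded as a constant vector field. $T_{v/F(v)}\Sigma$ is regarded as a linear hyperplane of $\mathcal V$. $TS\setminus\mathbf 0$ is the set of nonzero tangent vectors of $S$. $F|_S$ is the restriction of $F$ to $TS$; it is a Finsler metric on $S$. Projections: $W^{\top_p}$ is the $h$-orthogonal projection of $W$ onto $T_pS$; $W^{\top_v}_{S\cap\Sigma}$ is the $h$-orthogonal projection of $W$ onto $T_{\pi(v)}S\cap T_{v/F(v)}\Sigma$. Second fundamental form: $\widetilde\nabla$ is the natural flat connection of $\mathcal V$, $\bar\nabla$ is the Levi-Civita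 connection of the metric induced by $h$ on $S$, $\mathrm{I\!I}'(X,Y)=(\widetilde\nabla_XY)^{\bot}$ ($h$-orthogonal component to $S$), and $(\bar\nabla_X\mathrm{I\!I}')(Y,Z)=(\widetilde\nabla_X(\mathrm{I\!I}'(Y,Z)))^{\bot}-\mathrm{I\!I}'(\bar\nabla_XY,Z)-\mathrm{I\!I}'(Y,\bar\nabla_XZ)$. Flag curvature of $(S,F|_S)$: put $L=(F|_S)^2$ on $TS\setminus\mathbf 0$, $g_v(u,w)=\frac12\frac{\partial^2}{\partial s\partial t}L(v+su+tw)|_{s=t=0}$ and $C_v(u,w,z)=\frac12\frac{\partial}{\partial t}g_{v+tz}(u,w)|_{t=0}$. The Levi-Civita-Chern connection is the unique map $(v,X,Y)\mapsto\nabla^v_XY\in T_{\pi(v)}S$ (depending smoothly on $v\in TS\setminus\mathbf 0$, for each $v$ having the usual additivity, tensoriality in $X$ and Leibniz rule in $Y$ of a linear connection at $\pi(v)$) such that, writing $\nabla^V$ for the affine connection $(\nabla^V_XY)_p=\nabla^{V_p}_XY$ defined by a nowhere zero local vector field $V$, one has $\nabla^V_XY-\nabla^V_YX=[X,Y]$ and $X(g_V(Y,Z))=g_V(\nabla^V_XY,Z)+g_V(Y,\nabla^V_XZ)+2C_V(\nabla^V_XV,Y,Z)$. Let $P_v(X,Y,Z)=\frac{\partial}{\partial t}\nabla^{v+tZ}_XY|_{t=0}$. Its curvature is $R_v(X,Y)Z=R^V(X,Y)Z|_{\pi(v)}-P_v(Y,Z,\nabla^V_XV)+P_v(X,Z,\nabla^V_YV)$,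 where $V$ is any local extension of $v$, $R^V(X,Y)Z=\nabla^V_X\nabla^V_YZ-\nabla^V_Y\nabla^V_XZ-\nabla^V_{[X,Y]}Z$ (the result does not depend on $V$). The flag curvature is $K_v(u)=\dfrac{g_v(R_v(v,u)u,v)}{L(v)g_v(u,u)-g_v(u,v)^2}$ for $u\in T_{\pi(v)}S$ linearly independent of $v$. *)

(* Defs.v *)
From HB Require Import structures.
From mathcomp Require Import all_boot all_order all_algebra.
From mathcomp Require Import all_classical all_reals all_analysis.

Set Implicit Arguments.
Unset Strict Implicit.
Unset Printing Implicit Defensive.

Import Order.TTheory GRing.Theory Num.Theory.
Import numFieldNormedType.Exports.

Local Open Scope classical_set_scope.
Local Open Scope ring_scope.

(* Finite-dimensional real vector spaces on which one may differentiate. The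
   norm only serves to name the topology, which in finite dimension does not
   depend on it; it plays no role in the geometry. *)
#[short(type="normedVectType")]
HB.structure Definition NormedVector (R : numFieldType) :=
  {V of NormedModule R V & Vector R V}.

Section Smooth.
Context {R : realType}.

Section Maps.
Context {V W : normedModType R}.

(* For open U in finite dimension this is the usual class C^k: f is C^(k+1) iff
   it is differentiable and all its directional derivatives are C^k. *)
Fixpoint Ck_on (k : nat) (U : set V) (f : V -> W) : Prop :=
  match k with
  | 0 => forall x, U x -> {for x, continuous f}
  | k'.+1 => (forall x, U x -> differentiable f x) /\
             (forall v, Ck_on k' U (fun x => 'D_v f x))
  end.

Definition smooth_on (U : set V) (f : V -> W) : Prop :=
  forall k, Ck_on k U f.

Definition smooth_near (p : V) (f : V -> W) : Prop :=
  exists U : set V, [/\ open U, U p & smooth_on U f].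

(* Maps defined on a subset S are represented by total functions whose values
   off S are irrelevant; f' is a smooth local extension of f|_S around p. *)
Definition smooth_ext (S : set V) (p : V) (f f' : V -> W) : Prop :=
  smooth_near p f' /\ \forall q \near p, S q -> f q = f' q.

Definition smooth_at (S : set V) (p : V) (f : V -> W) : Prop :=
  exists f', smooth_ext S p f f'.

(* The derivative of f|_S at p in the direction of a vector x tangent to S: it
   is computed from any smooth local extension, the choice being immaterial. *)
Definition dS (S : set V) (f : V -> W) (p x : V) : W :=
  'D_x (xget f (smooth_ext S p f)) p.

End Maps.

Section Submanifold.
Context {V : normedVectType R}.

(* Embedded submanifolds of dimension m, by slice charts: phi, with inverse psi,
   is a diffeomorphism between open sets U and U' of V. *)
Definition submanifold (m : nat) (S : set V) : Prop :=
  forall p, S p ->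
  exists (U U' : set V) (phi psi : V -> V) (E : {vspace V}),
    [/\ [/\ open U, open U' & U p],
        smooth_on U phi /\ smooth_on U' psi,
        forall x, U x -> U' (phi x) /\ psi (phi x) = x,
        forall y, U' y -> U (psi y) /\ phi (psi y) = y &
        \dim E = m /\ forall x, U x -> (S x <-> phi x \in E)].

Definition tangent (S : set V) (p : V) : set V :=
  [set x | exists c : R -> V,
    [/\ smooth_near 0 c, c 0 = p, \forall t \near 0, S (c t) &
        derive1 c 0 = x]].

(* TS minus the zero section, as a subset of V * V *)
Definition slitTS (S : set V) : set (V * V)%type :=
  [set z | [/\ S z.1, tangent S z.1 z.2 & z.2 != 0]].

Definition vfield (S : set V) (p : V) (X : V -> V) : Prop :=
  smooth_at S p X /\ \forall q \near p, S q -> tangent S q (X q).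

(* Tensorial expressions are evaluated on tangent vectors through an arbitrary
   extension of the vectors to local vector fields of S. *)
Definition ext (S : set V) (p x : V) : V -> V :=
  xget (cst x) [set X | vfield S p X /\ X p = x].

(* [X, Y] = D_X Y - D_Y X, with D the flat connection of V *)
Definition lie (S : set V) (X Y : V -> V) (p : V) : V :=
  dS S Y p (X p) - dS S X p (Y p).

End Submanifold.

Section Finsler.
Context {V : normedVectType R}.
Variables (S : set V) (F : V -> R).

(* Since F|_S is a restriction, L(v) depends on v only as a vector of V. *)
Definition Lfun (v : V) : R := F v ^+ 2.

Definition gten (v u w : V) : R :=
  2^-1 * derive1 (fun s : R =>
    derive1 (fun t : R => Lfun (v + s *: u + t *: w)) 0) 0.

Definition Cten (v u w z : V) : R :=
  2^-1 * derive1 (fun t : R => gten (v + t *: z) u w) 0.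

(* nabla p v x Y is the covariant derivative at p of the local vector field Y
   in the direction of the tangent vector x, with respect to the nonzero tangent
   vector v; tensoriality in X is rendered by letting x be a vector. *)
Record anisotropic_connection (nabla : V -> V -> V -> (V -> V) -> V) : Prop := {
  ac_tangent : forall p v x Y, slitTS S (p, v) -> tangent S p x ->
    vfield S p Y -> tangent S p (nabla p v x Y);
  (* only the germ at p of the section Y of TS matters *)
  ac_local : forall p v x Y Y', slitTS S (p, v) -> tangent S p x ->
    vfield S p Y -> vfield S p Y' ->
    (\forall q \near p, S q -> Y q = Y' q) ->
    nabla p v x Y = nabla p v x Y';
  ac_linear : forall p v (a : R) x x' Y, slitTS S (p, v) -> tangent S p x ->
    tangent S p x' -> vfield S p Y ->
    nabla p v (a *: x + x') Y = a *: nabla p v x Y + nabla p v x' Y;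
  ac_add : forall p v x Y Y', slitTS S (p, v) -> tangent S p x ->
    vfield S p Y -> vfield S p Y' ->
    nabla p v x (fun q => Y q + Y' q) = nabla p v x Y + nabla p v x Y';
  ac_leibniz : forall p v x (f : V -> R) Y, slitTS S (p, v) ->
    tangent S p x -> smooth_at S p f -> vfield S p Y ->
    nabla p v x (fun q => f q *: Y q) =
      dS S f p x *: Y p + f p *: nabla p v x Y;
  ac_smooth : forall p v X Y, slitTS S (p, v) ->
    vfield S p X -> vfield S p Y ->
    smooth_at (slitTS S) (p, v) (fun z : V * V => nabla z.1 z.2 (X z.1) Y)
}.

Record chern_connection (nabla : V -> V -> V -> (V -> V) -> V) : Prop := {
  chern_ac : anisotropic_connection nabla;
  chern_torsion_free : forall p A X Y, S p -> A p != 0 ->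
    vfield S p A -> vfield S p X -> vfield S p Y ->
    nabla p (A p) (X p) Y - nabla p (A p) (Y p) X = lie S X Y p;
  chern_compat : forall p A X Y Z, S p -> A p != 0 ->
    vfield S p A -> vfield S p X -> vfield S p Y -> vfield S p Z ->
    dS S (fun q => gten (A q) (Y q) (Z q)) p (X p) =
      gten (A p) (nabla p (A p) (X p) Y) (Z p)
      + gten (A p) (Y p) (nabla p (A p) (X p) Z)
      + 2 * Cten (A p) (nabla p (A p) (X p) A) (Y p) (Z p)
}.

Section Curvature.
Variable nabla : V -> V -> V -> (V -> V) -> V.

Definition Pten (p v x : V) (Y : V -> V) (z : V) : V :=
  derive1 (fun t : R => nabla p (v + t *: z) x Y) 0.

(* A is the local extension of the flagpole: affine_curv is the curvature of the
   affine connection nabla^A, and chern_curv the anisotropic curvature R_(A p),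
   in which the P terms remove the dependence on the extension. *)
Definition affine_curv (A X Y Z : V -> V) (p : V) : V :=
  nabla p (A p) (X p) (fun q => nabla q (A q) (Y q) Z)
  - nabla p (A p) (Y p) (fun q => nabla q (A q) (X q) Z)
  - nabla p (A p) (lie S X Y p) Z.

Definition chern_curv (A X Y Z : V -> V) (p : V) : V :=
  affine_curv A X Y Z p
  - Pten p (A p) (Y p) Z (nabla p (A p) (X p) A)
  + Pten p (A p) (X p) Z (nabla p (A p) (Y p) A).

Definition flag_curvature (p v u : V) : R :=
  gten v (chern_curv (ext S p v) (ext S p v) (ext S p u) (ext S p u) p) v
  / (Lfun v * gten v u u - gten v u v ^+ 2).

End Curvature.
End Finsler.

Section Euclidean.
Context {V : normedVectType R}.
Variable h : {dot V for (idfun : R -> R)}.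

Definition hnorm (x : V) : R := Num.sqrt (h x x).

(* Meant for T a linear subspace: the h-orthogonal projection of w onto T. *)
Definition hproj (T : set V) (w : V) : V :=
  xget 0 [set w' | T w' /\ forall t, T t -> h (w - w') t = 0].

Record randers_norm (W : V) (F : V -> R) : Prop := {
  randers_wind : h W W < 1;
  randers0 : F 0 = 0;
  randers_gt0 : forall v, v != 0 -> 0 < F v;
  randersE : forall v, v != 0 ->
    h ((F v)^-1 *: v - W) ((F v)^-1 *: v - W) = 1
}.

Definition indicatrix (F : V -> R) : set V := [set x | F x = 1].

Variable S : set V.

Record levi_civita (nb : V -> V -> (V -> V) -> V) : Prop := {
  lc_tangent : forall p x Y, S p -> tangent S p x -> vfield S p Y ->
    tangent S p (nb p x Y);
  lc_local : forall p x Y Y', S p -> tangent S p x ->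
    vfield S p Y -> vfield S p Y' ->
    (\forall q \near p, S q -> Y q = Y' q) -> nb p x Y = nb p x Y';
  lc_linear : forall p (a : R) x x' Y, S p -> tangent S p x ->
    tangent S p x' -> vfield S p Y ->
    nb p (a *: x + x') Y = a *: nb p x Y + nb p x' Y;
  lc_add : forall p x Y Y', S p -> tangent S p x ->
    vfield S p Y -> vfield S p Y' ->
    nb p x (fun q => Y q + Y' q) = nb p x Y + nb p x Y';
  lc_leibniz : forall p x (f : V -> R) Y, S p -> tangent S p x ->
    smooth_at S p f -> vfield S p Y ->
    nb p x (fun q => f q *: Y q) = dS S f p x *: Y p + f p *: nb p x Y;
  lc_smooth : forall p X Y, S p -> vfield S p X -> vfield S p Y ->
    smooth_at S p (fun q => nb q (X q) Y);
  lc_torsion_free : forall p X Y, S p -> vfield S p X -> vfield S p Y ->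
    nb p (X p) Y - nb p (Y p) X = lie S X Y p;
  lc_metric : forall p X Y Z, S p ->
    vfield S p X -> vfield S p Y -> vfield S p Z ->
    dS S (fun q => h (Y q) (Z q)) p (X p) =
      h (nb p (X p) Y) (Z p) + h (Y p) (nb p (X p) Z)
}.

Definition normal_part (p w : V) : V := w - hproj (tangent S p) w.

Definition II (X Y : V -> V) (p : V) : V := normal_part p (dS S Y p (X p)).

Definition IIv (p x y : V) : V := II (ext S p x) (ext S p y) p.

Section LeviCivita.
Variable nb : V -> V -> (V -> V) -> V.

Definition nablaII (X Y Z : V -> V) (p : V) : V :=
  normal_part p (dS S (II Y Z) p (X p))
  - II (fun q => nb q (X q) Y) Z p
  - II Y (fun q => nb q (X q) Z) p.

Definition nablaIIv (p x y z : V) : V :=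
  nablaII (ext S p x) (ext S p y) (ext S p z) p.

Definition riem_curv (X Y Z : V -> V) (p : V) : V :=
  nb p (X p) (fun q => nb q (Y q) Z)
  - nb p (Y p) (fun q => nb q (X q) Z)
  - nb p (lie S X Y p) Z.

Definition sectional_curvature (p v u : V) : R :=
  h (riem_curv (ext S p v) (ext S p u) (ext S p u) p) v
  / (h v v * h u u - h v u ^+ 2).

End LeviCivita.
End Euclidean.
End Smooth.

(* Main.v *)
(* Differentiating h(v/F - W, v/F - W) = 1 gives dF(x) = h(v/F - W, x)/phi and
   g_v(x, y) = dF(x)dF(y) + h(hat x, hat y)/phi, where hat is the projection onto
   ker dF along v. Let D be the flat connection, nabla the Chern connection of
   F|_S and Q = D - nabla. Metric compatibility and vanishing torsion determine
   Q(v, v), Q(u, v) and g_v(Q(x, y), v) pointwise: with w the tangential part of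
   W, mu = |v/F - w|_h^2 (a function of the point only) and omega = h(II', W),
     Q(v, v) = II'(v, v) + omega(v, v)/mu (v/F - w),
     Q(u, v) = II'(u, v) + omega(u, v)/mu (v/F - w) + omega(v, v)/(2 F mu) hat u,
     g_v(Q(x, y), v) = - omega(v, v)/(2 F phi mu) h(hat x, hat y).
   Since D is flat, g_v(R_v(v, u)u, v) equals g_v(Q(u, u), Q(v, v)) -
   g_v(Q(u, v), Q(u, v)) minus the derivative, along a geodesic with velocity v
   and for parallel u, of g_v(Q(u, u), v). The first two terms give the sectional
   curvature by the Gauss equation of (S, h), the third one gives nabla II'. The
   norms of the statement enter through v/F - W^top_{S cap Sigma} =
   (phi/mu)(v/F - w), whose square is phi^2/mu. *)

Require Import Defs.
From HB Require Import structures.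
From mathcomp Require Import all_boot all_order all_algebra.
From mathcomp Require Import all_classical all_reals all_analysis.
From mathcomp Require Import ring lra.

Set Implicit Arguments.
Unset Strict Implicit.
Unset Printing Implicit Defensive.

Import Order.TTheory GRing.Theory Num.Theory.
Import numFieldNormedType.Exports.

Local Open Scope classical_set_scope.
Local Open Scope ring_scope.

(** The Chern connection is given only by its axioms. What these determine algebraically at a point
    suffices because the curvature is paired with the flagpole: g_v( . , v) is the one-form
    [legendre v], and C_v vanishes on v. The vector Q(u, u) is never computed. It enters through
    [legendre v], and through its product with Q(v, v), which is g_v-orthogonal to the tangent space
    and therefore sees only the h-normal part II'(u, u). The fields extending v and u are arbitrary;
    no geodesic and no parallel field is constructed. The closed form of g_v(Q(u, u), v) is
    differentiated along some curve of S with velocity v and along the line v + s a in the fibre,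
    where a = nabla_v A for the extension A of v. The difference of the two replaces the derivative
    along a geodesic. This also explains the constant 5/2. The Levi-Civita and Chern derivatives of
    A differ by omega/mu (v/F - w), which contributes 2 omega^2/(mu F) to the bracket, and the norm
    of Q(u, v) takes away half of omega^2/(mu F). Writing II'(v, w) through W^top_{S cap Sigma}
    turns the remaining 3/2 into 4 - 5/2. *)

(** * Finite coordinates and continuity of linear and bilinear maps *)

Section FiniteCoordinates.
Context {R : realType}.

(* A predicate on normedModType, because R and products are not declared as
   instances of normedVectType. *)
Definition fin_coord (V : normedModType R) : Prop :=
  exists (n : nat) (c : 'I_n -> {linear V -> R}) (e : 'I_n -> V),
    (forall i, continuous (c i)) /\ forall x, x = \sum_i c i x *: e i.

Lemma sum_cvg (T : Type) (F : set_system T) (V : normedModType R) n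
    (f : 'I_n -> T -> V) (a : 'I_n -> V) :
  Filter F -> (forall i, f i x @[x --> F] --> a i) ->
  (\sum_i f i x) @[x --> F] --> \sum_i a i.
Proof.
by move=> FF fa; apply: cvg_big => [|i _]; [exact: add_continuous | exact: fa].
Qed.

(** The norm of [V] is abstract, so continuity of the coordinates comes from compactness: the norm
    of [L x] has a positive minimum on the unit sphere of row vectors, and this bounds the
    coordinates of a vector by its norm. *)
Lemma fin_coord_vect (V : normedVectType R) : fin_coord V.
Proof.
pose n := \dim {: V}; pose b := vbasis {: V}.
pose L (x : 'rV[R]_n) : V := \sum_i x 0 i *: b`_i.
have Lc : continuous L.
  move=> x; apply: (@sum_cvg _ (nbhs x) _ n (fun i (x : 'rV[R]_n) => x 0 i *: b`_i)
    _ (nbhs_filter x)) => i.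
  by apply: (@cvgZr_tmp _ _ _ (nbhs x) (nbhs_filter x)); exact: coord_continuous.
have L0 x : L x = 0 -> x = 0.
  move=> Lx; apply/rowP => i; rewrite mxE.
  have /freeP := basis_free (vbasisP {: V}).
  by move=> /(_ (fun i => x 0 i) Lx i).
have LZ a x : L (a *: x) = a *: L x.
  by rewrite /L scaler_sumr; apply: eq_bigr => i _; rewrite mxE scalerA.
have LE x : L (\row_i coord b i x) = x.
  rewrite [RHS](coord_vbasis (memvf x)); apply: eq_bigr => i _.
  by rewrite mxE.
have [k k0 Lk] : exists2 k : R, 0 < k & forall x, k * `|x| <= `|L x|.
  have Lb (x0 : 'rV[R]_n) : `|x0| = 1 ->
      exists2 k : R, 0 < k & forall x, k * `|x| <= `|L x|.
    move=> x01; pose A := [set x : 'rV[R]_n | `|x| = 1].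
    have Ac : compact A.
      apply: bounded_closed_compact.
        by exists 1; split=> // r r1 x /= ->; exact: ltW.
      apply: (@preimage_closed _ _ (fun x : 'rV[R]_n => `|x|) [set 1]).
      - by move=> x _; exact: norm_continuous.
      - exact: closed_eq.
    have [||c /[!inE] cA cm] := @EVT_min_rV R n (fun x => `|L x|) A _ Ac.
    - by exists x0.
    - apply/continuous_subspaceT => x.
      by apply: continuous_comp; [exact: Lc | exact: norm_continuous].
    exists `|L c|.
      rewrite normr_gt0; apply/eqP => /L0 c0.
      by move: cA; rewrite /A /= c0 normr0 => /eqP; rewrite eq_sym oner_eq0.
    move=> x; have [->|x0'] := eqVneq x 0; first by rewrite normr0 mulr0.
    have nx : 0 < `|x| by rewrite normr_gt0.
    have := cm (`|x|^-1 *: x); rewrite inE /A /= => /(_ _).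
    rewrite LZ !normrZ normfV normr_id mulVf ?gt_eqF// => /(_ erefl).
    by rewrite ler_pdivlMl// mulrC.
  have [[x x0]|] := pselect (exists x : 'rV[R]_n, x != 0).
    apply: (Lb (`|x|^-1 *: x)).
    by rewrite normrZ normfV normr_id mulVf// normr_eq0.
  (* In dimension zero the unit sphere is empty and any positive constant works. *)
  move=> N; exists 1 => // x; suff -> : x = 0.
    by rewrite (_ : L 0 = 0) ?normr0 ?mulr0// -(scale0r 0) LZ scale0r.
  by apply/eqP/negPn/negP => x0; apply: N; exists x.
exists n, (coord b), (fun i => b`_i); split; last first.
  by move=> x; exact: coord_vbasis (memvf x).
move=> i; apply/linear_bounded_continuous/linear_boundedP.
near=> r => x.
have := Lk (\row_j coord b j x); rewrite LE -ler_pdivlMl// => H.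
have ci : `|coord b i x| <= `|\row_j coord b j x|.
  rewrite [leRHS]mx_normrE.
  by apply: le_trans (le_bigmax _ _ (0, i)); rewrite mxE.
apply: (le_trans ci); apply: (le_trans H); apply: ler_wpM2r => //.
Unshelve. all: by end_near.
Qed.

Lemma fin_coord_R : fin_coord R.
Proof.
exists 1, (fun=> (idfun : {linear R -> R})), (fun=> 1); split.
  by move=> _ x; exact: cvg_id.
by move=> x; rewrite big_ord1 /= /GRing.scale /= mulr1.
Qed.

Lemma fin_coord_prod (U V : normedModType R) :
  fin_coord U -> fin_coord V -> fin_coord (U * V)%type.
Proof.
move=> [n [c [e [cc ce]]]] [m [d [f [dc df]]]].
exists (n + m)%N,
  (fun i : 'I_(n + m) => match fintype.split i with
    | inl j => c j \o fst : {linear (U * V)%type -> R}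
    | inr j => d j \o snd : {linear (U * V)%type -> R} end),
  (fun i : 'I_(n + m) =>
     match fintype.split i with inl j => (e j, 0) | inr j => (0, f j) end).
split=> [i|x].
  case: (fintype.split i) => j x; apply: continuous_comp.
  - exact: cvg_fst.
  - exact: cc.
  - exact: cvg_snd.
  - exact: dc.
rewrite big_split_ord /=.
under eq_bigr => i _ do rewrite (unsplitK (inl i)) /=.
under [X in _ + X]eq_bigr => i _ do rewrite (unsplitK (inr i)) /=.
have suml (k : nat) (g : 'I_k -> U) : (\sum_i g i, 0) = \sum_i (g i, 0 : V).
  apply: (big_morph (fun x => (x, 0 : V))) => // a b.
  by congr pair; rewrite addr0.
have sumr (k : nat) (g : 'I_k -> V) : (0, \sum_i g i) = \sum_i (0 : U, g i).
  apply: (big_morph (fun x => (0 : U, x))) => // a b.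
  by congr pair; rewrite addr0.
have xE : x = (x.1, 0) + (0, x.2).
  by case: x => x y; congr pair; rewrite /= ?addr0 ?add0r.
rewrite [LHS]xE {1}(ce x.1) {1}(df x.2) suml sumr /=.
congr (_ + _); apply: eq_bigr => i _.
- by congr pair; rewrite scaler0.
- by congr pair; rewrite scaler0.
Qed.

Lemma lin_continuous (V W : normedModType R) (f : {linear V -> W}) :
  fin_coord V -> continuous f.
Proof.
move=> [n [c [e [cc ce]]]] x.
rewrite (_ : (f : V -> W) = fun x => \sum_i c i x *: f (e i)); last first.
  apply/funext => y; rewrite {1}(ce y) linear_sum.
  by apply: eq_bigr => i _; rewrite linearZ.
apply: (@sum_cvg _ _ _ n (fun i x => c i x *: f (e i))) => i.
by apply: cvgZr_tmp; exact: cc.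
Qed.

Lemma bilin_continuous (U V W : normedModType R) (f : {bilinear U -> V -> W}) :
  fin_coord U -> fin_coord V -> continuous (fun p => f p.1 p.2).
Proof.
move=> [n [c [e [cc ce]]]] fV x.
rewrite (_ : (fun p => f p.1 p.2) = fun p => \sum_i c i p.1 *: f (e i) p.2); last first.
  apply/funext => y; rewrite {1}(ce y.1).
  rewrite (big_morph (f^~ y.2) (linearDl f _) (linear0l f _)).
  by apply: eq_bigr => i _; rewrite linearZl_LR.
apply: (@sum_cvg _ _ _ n (fun i p => c i p.1 *: f (e i) p.2)) => i.
apply: cvgZ.
  by apply: (@continuous_comp _ _ _ fst); [exact: cvg_fst | exact: cc].
apply: (@continuous_comp _ _ _ snd); first exact: cvg_snd.
exact: lin_continuous.
Qed.

End FiniteCoordinates.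

(** Once scaling is registered as bilinear, one product rule serves [*:], multiplication of reals
    and [h]. *)
Lemma scale_is_bilinear (R : realType) (V : lmodType R) :
  bilinear_for *:%R *:%R (@GRing.scale R V).
Proof.
split=> [v a x y /=|a b x y /=]; first by rewrite scalerDl scalerA.
by rewrite scalerDr !scalerA mulrC.
Qed.

HB.instance Definition _ (R : realType) (V : lmodType R) :=
  bilinear_isBilinear.Build R R V V *:%R *:%R (@GRing.scale R V)
    (scale_is_bilinear V).

(** * Rules for directional derivatives *)

Section DerivativeRules.
Context {R : realType}.
Implicit Types U V W : normedModType R.

Lemma near_eq_differentiable V W (f g : V -> W) (x : V) :
  (\forall y \near x, f y = g y) -> differentiable f x -> differentiable g x.
Proof.
move=> fg df; have fgx : f x = g x by exact: nbhs_singleton fg.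
have fg0 : \forall y \near 0, f (y + x) = g (y + x).
  by have := fg; rewrite (near_shift 0) subr0.
have gE : g \o shift x = cst (g x) + 'd f x +o_ (0 : V) id.
  apply/eqaddoP => e e0; have := diff_locally df => /eqaddoP/(_ e e0).
  apply: filter_app; near=> y.
  change (`|f (y + x) - (f x + 'd f x y)| <= e * `|y| ->
    `|g (y + x) - (g x + 'd f x y)| <= e * `|y|).
  by have -> : g (y + x) = f (y + x) by [apply/esym; near: y]; rewrite fgx.
have dg := diff_unique (diff_continuous df) gE.
apply/diff_locallyP; split; first by rewrite dg; exact: diff_continuous.
by rewrite dg.
Unshelve. all: by end_near.
Qed.

Lemma derive_comp U V W (f : U -> V) (g : V -> W) (x v : U) :
  differentiable f x -> differentiable g (f x) ->
  'D_v (g \o f) x = 'D_('D_v f x) g (f x).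
Proof.
move=> df dg; rewrite !deriveE//; last exact: differentiable_comp.
by rewrite diff_comp.
Qed.

Lemma differentiable_bil U V W (B : {bilinear U -> V -> W}) (E : normedModType R)
    (f : E -> U) (g : E -> V) (x : E) :
  continuous (fun p => B p.1 p.2) ->
  differentiable f x -> differentiable g x ->
  differentiable (fun y => B (f y) (g y)) x.
Proof.
move=> cB df dg.
apply: (@differentiable_comp _ _ _ _ (fun y => (f y, g y)) (fun p => B p.1 p.2)).
  exact: differentiable_pair.
exact: differentiable_bilin.
Qed.

Lemma derive_bil U V W (B : {bilinear U -> V -> W}) (E : normedModType R)
    (f : E -> U) (g : E -> V) (x v : E) :
  continuous (fun p => B p.1 p.2) ->
  differentiable f x -> differentiable g x ->
  'D_v (fun y => B (f y) (g y)) x = B (f x) ('D_v g x) + B ('D_v f x) (g x).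
Proof.
move=> cB df dg; rewrite deriveE; last exact: differentiable_bil.
rewrite (@diff_comp _ _ _ _ (fun y => (f y, g y)) (fun p => B p.1 p.2)) /=.
- by rewrite diff_bilin// diff_pair//= !deriveE.
- exact: differentiable_pair.
- exact: differentiable_bilin.
Qed.

Lemma deriveDv V W (f : V -> W) (x u v : V) : differentiable f x ->
  'D_(u + v) f x = 'D_u f x + 'D_v f x.
Proof. by move=> df; rewrite !deriveE// linearD. Qed.

Lemma deriveZv V W (f : V -> W) (x u : V) (a : R) : differentiable f x ->
  'D_(a *: u) f x = a *: 'D_u f x.
Proof. by move=> df; rewrite !deriveE// linearZ. Qed.

Lemma deriveNv V W (f : V -> W) (x u : V) : differentiable f x ->
  'D_(- u) f x = - 'D_u f x.
Proof. by move=> df; rewrite !deriveE// linearN. Qed.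

Lemma derive_lin V W (f : {linear V -> W}) (x v : V) : continuous f ->
  'D_v f x = f v.
Proof.
by move=> cf; rewrite deriveE ?diff_lin//; exact: linear_differentiable.
Qed.

End DerivativeRules.

(** * Smooth maps *)

Section CkClosure.
Context {R : realType}.
Implicit Types U V W E : normedModType R.

Lemma Ck_on_eq V W k (D : set V) (f g : V -> W) : open D ->
  (forall x, D x -> f x = g x) -> Ck_on k D f -> Ck_on k D g.
Proof.
move=> oD; elim: k f g => [|k IH] f g fg /=.
  move=> cf x Dx; have fgx : \forall y \near x, f y = g y.
    by apply: filterS (open_nbhs_nbhs (conj oD Dx)) => y; exact: fg.
  rewrite /prop_for /continuous_at -(fg x Dx).
  by apply: cvg_trans (cf x Dx); apply: near_eq_cvg.
move=> [df Df]; have fgx x : D x -> \forall y \near x, f y = g y.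
  by move=> Dx; apply: filterS (open_nbhs_nbhs (conj oD Dx)) => y; exact: fg.
split=> [x Dx|v].
  by apply: near_eq_differentiable (df x Dx); exact: fgx.
apply: IH (Df v) => x Dx; apply: near_eq_derive; exact: fgx.
Qed.

Lemma Ck_on_subset V W k (D D' : set V) (f : V -> W) :
  D' `<=` D -> Ck_on k D f -> Ck_on k D' f.
Proof.
move=> D'D; elim: k f => [|k IH] f /=; first by move=> cf x /D'D/cf.
by move=> [df Df]; split=> [x /D'D/df//|v]; exact: IH.
Qed.

Lemma Ck_onW V W k (D : set V) (f : V -> W) : Ck_on k.+1 D f -> Ck_on k D f.
Proof.
elim: k f => [|k IH] f.
  by move=> [df _] x Dx; exact: differentiable_continuous (df x Dx).
by move=> [df Df]; split=> // v; exact: IH.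
Qed.

Lemma Ck_on_cst V W k (D : set V) (a : W) : Ck_on k D (cst a : V -> W).
Proof.
elim: k a => [|k IH] a /=; first by move=> x _; exact: cvg_cst.
split=> [x _|v]; first exact: differentiable_cst.
rewrite (_ : (fun x => 'D_v (cst a) x) = cst 0) //.
by apply/funext => x; exact: derive_cst.
Qed.

Lemma Ck_on_lin V W k (D : set V) (f : {linear V -> W}) :
  continuous f -> Ck_on k D f.
Proof.
move=> cf; case: k => [|k]; first by move=> x _; exact: cf.
split=> [x _|v]; first exact: linear_differentiable.
rewrite (_ : (fun x => _) = cst (f v)); first exact: Ck_on_cst.
by apply/funext => x; exact: derive_lin.
Qed.

Lemma Ck_onD V W k (D : set V) (f g : V -> W) : open D ->
  Ck_on k D f -> Ck_on k D g -> Ck_on k D (fun x => f x + g x).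
Proof.
move=> oD; elim: k f g => [|k IH] f g.
  by move=> cf cg x Dx; exact: cvgD (cf x Dx) (cg x Dx).
move=> [df Df] [dg Dg]; split=> [x Dx|v].
  by apply: differentiableD; [exact: df|exact: dg].
apply: (Ck_on_eq oD) (IH _ _ (Df v) (Dg v)) => x Dx.
by rewrite (_ : (fun x => f x + g x) = f + g)// deriveD//;
  apply: diff_derivable; [exact: df|exact: dg].
Qed.

Lemma Ck_on_sum V W k (D : set V) n (f : 'I_n -> V -> W) : open D ->
  (forall i, Ck_on k D (f i)) -> Ck_on k D (fun x => \sum_i f i x).
Proof.
move=> oD; elim: n f => [|n IH] f Hf.
  apply: (Ck_on_eq oD) (@Ck_on_cst _ _ k D 0) => x _.
  by rewrite big_ord0.
apply: (@Ck_on_eq _ _ _ _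
  (fun x => \sum_(i < n) f (widen_ord (leqnSn n) i) x + f ord_max x)) => //.
  by move=> x _; rewrite big_ord_recr.
by apply: Ck_onD => //; apply: IH.
Qed.

Lemma Ck_on_bil E U V W (B : {bilinear U -> V -> W}) k (D : set E)
    (f : E -> U) (g : E -> V) :
  open D -> continuous (fun p => B p.1 p.2) ->
  Ck_on k D f -> Ck_on k D g -> Ck_on k D (fun x => B (f x) (g x)).
Proof.
move=> oD cB; elim: k f g => [|k IH] f g.
  move=> cf cg x Dx; apply: (@continuous_comp _ _ _
    (fun x => (f x, g x)) (fun p => B p.1 p.2)).
    exact: cvg_pair (cf x Dx) (cg x Dx).
  exact: cB.
move=> fk gk; have [df Df] := fk; have [dg Dg] := gk; split=> [x Dx|v].
  by apply: differentiable_bil => //; [exact: df|exact: dg].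
have fk' := Ck_onW fk; have gk' := Ck_onW gk.
apply: (Ck_on_eq oD) (Ck_onD oD (IH _ _ fk' (Dg v)) (IH _ _ (Df v) gk')) => x Dx.
by rewrite derive_bil//; [exact: df|exact: dg].
Qed.

Lemma scale_continuous2 V : continuous (fun p : R * V => p.1 *: p.2).
Proof. by move=> p; apply: cvgZ; [exact: cvg_fst | exact: cvg_snd]. Qed.

Lemma Ck_on_lin_comp U V W k (D : set U) (f : U -> V) (g : {linear V -> W}) :
  open D -> continuous g -> Ck_on k D f -> Ck_on k D (g \o f).
Proof.
move=> oD cg; elim: k f => [|k IH] f.
  by move=> cf x Dx; apply: continuous_comp; [exact: cf | exact: cg].
move=> [df Df]; split=> [x Dx|v].
  by apply: differentiable_comp; [exact: df | exact: linear_differentiable].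
apply: (Ck_on_eq oD) (IH _ (Df v)) => x Dx.
by rewrite derive_comp ?derive_lin//; [exact: df | exact: linear_differentiable].
Qed.

(** [Ck_on] differentiates in fixed directions, while the chain rule differentiates [g] in the
    direction ['D_v f x], which moves with [x]. Expanding this direction in coordinates leaves
    products of coordinates with ['D_(e i) g] composed with [f], which the induction covers. *)
Lemma Ck_on_comp U V W k (D : set U) (D' : set V) (f : U -> V) (g : V -> W) :
  fin_coord V -> open D -> (forall x, D x -> D' (f x)) ->
  Ck_on k D f -> Ck_on k D' g -> Ck_on k D (g \o f).
Proof.
move=> fV oD DD'; elim: k g => [|k IH] g.
  move=> cf cg x Dx; apply: continuous_comp; first exact: cf.
  by apply: cg; exact: DD'.
move=> fk gk; have [df Df] := fk; have [dg Dg] := gk; split=> [x Dx|v].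
  by apply: differentiable_comp; [exact: df|exact/dg/DD'].
have fk' := Ck_onW fk.
have [n [c [e [cc ce]]]] := fV.
apply: (@Ck_on_eq _ _ _ _
  (fun x => \sum_i c i ('D_v f x) *: (('D_(e i) g) \o f) x)) => //.
  move=> x Dx; rewrite derive_comp; [|exact: df|exact/dg/DD'].
  have dgx := dg _ (DD' _ Dx).
  rewrite [in RHS](ce ('D_v f x)) [RHS]deriveE// linear_sum.
  by apply: eq_bigr => i _; rewrite linearZ /= -deriveE.
apply: Ck_on_sum => // i.
apply: (Ck_on_bil (B := *:%R)) => //.
- exact: scale_continuous2.
- exact: (Ck_on_lin_comp oD (cc i) (Df v)).
- exact: IH fk' (Dg _).
Qed.

(** The derivative is a constant times a product of two copies of the function itself, so the
    induction closes. *)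
Lemma Ck_on_inv k : Ck_on k [set x : R | x != 0] (fun x : R => x^-1).
Proof.
have oD : open [set x : R | x != 0] by exact: open_neq.
elim: k => [|k IH]; first by move=> x x0; exact: inv_continuous.
split=> [x x0|v]; first exact: differentiable_Rinv.
apply: (@Ck_on_eq _ _ _ _ (fun x : R => - v * (x^-1 * x^-1))) => //.
  move=> x x0; rewrite deriveE; last exact: differentiable_Rinv.
  rewrite diff_Rinv// /GRing.scale /=.
  by rewrite -expr2 exprVn mulrC mulNr mulrN mulrC.
apply: (Ck_on_bil (B := *%R)) => //.
- by move=> ?; exact: mul_continuous.
- exact: Ck_on_cst.
- apply: (Ck_on_bil (B := *%R)) => //.
  by move=> ?; exact: mul_continuous.
Qed.

Lemma Ck_on_sqrt k : Ck_on k [set x : R | 0 < x] (@Num.sqrt R).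
Proof.
have oD : open [set x : R | 0 < x] by exact: open_gt.
elim: k => [|k IH]; first by move=> x x0; exact: sqrt_continuous.
split=> [x x0|v].
  by apply/derivable1_diffP; have [] := is_derive1_sqrt x0.
apply: (@Ck_on_eq _ _ _ _ (fun x : R => (v / 2) * (Num.sqrt x)^-1)) => //.
  move=> x x0; have [dx Dx] := is_derive1_sqrt x0.
  rewrite -[in RHS](mulr1 v) -[v * 1]/(v *: 1) deriveZv ?Dx; last first.
    by apply/derivable1_diffP.
  by rewrite /GRing.scale /= invfM mulrA.
apply: (Ck_on_bil (B := *%R)) => //.
- by move=> ?; exact: mul_continuous.
- exact: Ck_on_cst.
- apply: (Ck_on_comp fin_coord_R oD _ IH (Ck_on_inv k)) => x /= x0.
  by rewrite gt_eqF ?sqrtr_gt0.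
Qed.

End CkClosure.

Section SmoothNear.
Context {R : realType}.
Implicit Types U V W E : normedModType R.

Lemma smooth_nearW V W (p : V) (f : V -> W) :
  smooth_near p f -> \forall q \near p, smooth_near q f.
Proof.
move=> [D [oD Dp Df]]; apply: filterS (open_nbhs_nbhs (conj oD Dp)) => q Dq.
by exists D.
Qed.

Lemma smooth_near_differentiable V W (p : V) (f : V -> W) :
  smooth_near p f -> differentiable f p.
Proof. by move=> [D [oD Dp Df]]; have [+ _] := Df 1%N; exact. Qed.

Lemma smooth_near_derive V W (p v : V) (f : V -> W) :
  smooth_near p f -> smooth_near p ('D_v f).
Proof.
by move=> [D [oD Dp Df]]; exists D; split=> // k; have [_] := Df k.+1; exact.
Qed.

Lemma smooth_near_eq V W (p : V) (f g : V -> W) :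
  (\forall q \near p, f q = g q) -> smooth_near p f -> smooth_near p g.
Proof.
move=> fg [D [oD Dp Df]].
have : nbhs p (D `&` [set q | f q = g q]).
  by apply: filterI fg; exact: open_nbhs_nbhs.
rewrite nbhsE => -[D' [oD' D'p] D'D]; exists D'; split=> // k.
apply: (Ck_on_eq oD' _ (Ck_on_subset _ (Df k))) => x /D'D [] //.
Qed.

Lemma smooth_near_cst V W (p : V) (a : W) : smooth_near p (cst a : V -> W).
Proof. by exists setT; split=> // [|k]; [exact: openT | exact: Ck_on_cst]. Qed.

Lemma smooth_near_lin V W (p : V) (f : {linear V -> W}) :
  continuous f -> smooth_near p f.
Proof. by exists setT; split=> // [|k]; [exact: openT | exact: Ck_on_lin]. Qed.

Lemma smooth_near_id V (p : V) : smooth_near p (fun x : V => x).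
Proof. by apply: (@smooth_near_lin _ _ p idfun) => x; exact: cvg_id. Qed.

Lemma smooth_nearI V W W' (p : V) (f : V -> W) (g : V -> W') :
  smooth_near p f -> smooth_near p g ->
  exists D, [/\ open D, D p, smooth_on D f & smooth_on D g].
Proof.
move=> [D [oD Dp Df]] [D' [oD' D'p Df']]; exists (D `&` D'); split=> //.
- exact: openI.
- by move=> k; apply: Ck_on_subset (Df k) => x [].
- by move=> k; apply: Ck_on_subset (Df' k) => x [].
Qed.

Lemma smooth_nearD V W (p : V) (f g : V -> W) :
  smooth_near p f -> smooth_near p g -> smooth_near p (fun x => f x + g x).
Proof.
move=> sf sg; have [D [oD Dp Df Dg]] := smooth_nearI sf sg.
by exists D; split=> // k; exact: Ck_onD.
Qed.

Lemma smooth_near_bil E U V W (B : {bilinear U -> V -> W}) (p : E)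
    (f : E -> U) (g : E -> V) : continuous (fun p => B p.1 p.2) ->
  smooth_near p f -> smooth_near p g -> smooth_near p (fun x => B (f x) (g x)).
Proof.
move=> cB sf sg; have [D [oD Dp Df Dg]] := smooth_nearI sf sg.
by exists D; split=> // k; exact: Ck_on_bil.
Qed.

Lemma smooth_nearZ V W (p : V) (a : V -> R) (f : V -> W) :
  smooth_near p a -> smooth_near p f -> smooth_near p (fun x => a x *: f x).
Proof. by apply: (smooth_near_bil (B := *:%R)); exact: scale_continuous2. Qed.

Lemma smooth_nearM V (p : V) (a b : V -> R) :
  smooth_near p a -> smooth_near p b -> smooth_near p (fun x => a x * b x).
Proof. by apply: (smooth_near_bil (B := *%R)) => ?; exact: mul_continuous. Qed.

Lemma smooth_nearN V W (p : V) (f : V -> W) :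
  smooth_near p f -> smooth_near p (fun x => - f x).
Proof.
move=> sf; apply: (@smooth_near_eq _ _ _ (fun x => cst (-1 : R) x *: f x)).
  by apply: nearW => x; rewrite scaleN1r.
by apply: smooth_nearZ => //; exact: smooth_near_cst.
Qed.

Lemma smooth_nearB V W (p : V) (f g : V -> W) :
  smooth_near p f -> smooth_near p g -> smooth_near p (fun x => f x - g x).
Proof. by move=> sf sg; apply: smooth_nearD => //; exact: smooth_nearN. Qed.

Lemma smooth_near_comp U V W (p : U) (f : U -> V) (g : V -> W) :
  fin_coord V -> smooth_near p f -> smooth_near (f p) g ->
  smooth_near p (g \o f).
Proof.
move=> fV [D [oD Dp Df]] [D' [oD' D'p Dg]].
have oDD : open (D `&` f @^-1` D').
  rewrite openE => q [Dq D'q]; apply: filterI; first exact: open_nbhs_nbhs.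
  by apply: (Df 0%N q Dq); exact: open_nbhs_nbhs.
exists (D `&` f @^-1` D'); split=> // k.
apply: (Ck_on_comp fV oDD _ _ (Dg k)) => [x []//|].
by apply: Ck_on_subset (Df k) => x [].
Qed.

Lemma smooth_near_inv (x : R) : x != 0 -> smooth_near x (@GRing.inv R).
Proof.
move=> x0; exists [set x : R | x != 0]; split=> // k; exact: Ck_on_inv.
Qed.

Lemma smooth_near_Rsqrt (x : R) : 0 < x -> smooth_near x (@Num.sqrt R).
Proof.
move=> x0; exists [set x : R | 0 < x]; split=> // k; exact: Ck_on_sqrt.
Qed.

Lemma smooth_nearV V (p : V) (f : V -> R) :
  f p != 0 -> smooth_near p f -> smooth_near p (fun x => (f x)^-1).
Proof.
move=> fp sf.
have := smooth_near_comp (f := f) fin_coord_R sf (smooth_near_inv fp); exact.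
Qed.

Lemma smooth_near_sqrt V (p : V) (f : V -> R) :
  0 < f p -> smooth_near p f -> smooth_near p (fun x => Num.sqrt (f x)).
Proof.
move=> fp sf.
have := smooth_near_comp (f := f) fin_coord_R sf (smooth_near_Rsqrt fp); exact.
Qed.

Lemma smooth_near_pair U V W (p : U) (f : U -> V) (g : U -> W) :
  smooth_near p f -> smooth_near p g -> smooth_near p (fun x => (f x, g x)).
Proof.
move=> sf sg.
have [D [oD Dp Df Dg]] := smooth_nearI sf sg; exists D; split=> // k.
elim: k f g Df Dg {sf sg} => [|k IH] f g Df Dg.
  by move=> x Dx; apply: cvg_pair; [exact: (Df 0%N) | exact: (Dg 0%N)].
have df x : D x -> differentiable f x by have [+ _] := Df 1%N; exact.
have dg x : D x -> differentiable g x by have [+ _] := Dg 1%N; exact.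
split=> [x Dx|v]; first by apply: differentiable_pair; [exact: df | exact: dg].
apply: (Ck_on_eq oD) (IH ('D_v f) ('D_v g) _ _).
- move=> x Dx; rewrite [RHS]deriveE; last first.
    by apply: differentiable_pair; [exact: df | exact: dg].
  by rewrite diff_pair ?deriveE//; do ?[exact: df | exact: dg].
- by move=> j; have [_] := Df j.+1; exact.
- by move=> j; have [_] := Dg j.+1; exact.
Qed.

(** As in [Ck_on_comp], the moving direction is expanded in coordinates to reduce to derivatives in
    fixed directions. *)
Lemma smooth_near_deriveP V W (p : V) (f : V -> W) (g : V -> V) :
  fin_coord V -> smooth_near p f -> smooth_near p g ->
  smooth_near p (fun q => 'D_(g q) f q).
Proof.
move=> fV sf sg; have [n [c [e [cc ce]]]] := fV.
apply: (@smooth_near_eq _ _ _ (fun q => \sum_i c i (g q) *: 'D_(e i) f q)).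
  near=> q; have df : differentiable f q.
    by apply: smooth_near_differentiable; near: q; exact: smooth_nearW.
  rewrite [in RHS](ce (g q)) [RHS]deriveE// linear_sum; apply: eq_bigr => i _.
  by rewrite linearZ /= -deriveE.
suff [D [oD Dp Df]] : exists D, [/\ open D, D p &
    forall i, smooth_on D (fun q => c i (g q) *: 'D_(e i) f q)].
  by exists D; split=> // k; apply: Ck_on_sum => // i; exact: Df.
have [D [oD Dp Df Dg]] := smooth_nearI sf sg.
exists D; split=> // i k; apply: (Ck_on_bil (B := *:%R)) => //.
- exact: scale_continuous2.
- exact: (Ck_on_lin_comp oD (cc i) (Dg k)).
- by have [_] := Df k.+1; exact.
Unshelve. all: by end_near.
Qed.

End SmoothNear.

Local Opaque derive diff.

(** * Symmetry of second derivatives *)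

Section Schwarz.
Context {R : realType}.

Lemma derive_line (V W : normedModType R) (f : V -> W) (x v : V) (t : R) :
  differentiable f (x + t *: v) ->
  is_derive t 1 (fun t => f (x + t *: v)) ('D_v f (x + t *: v)).
Proof.
move=> df.
have dl : differentiable (fun t : R => x + t *: v) t.
  apply: differentiableD; first exact: differentiable_cst.
  by apply: differentiableZl; exact: ex_diff.
apply: DeriveDef.
  by apply/derivable1_diffP; 
    exact: (@differentiable_comp _ _ _ _ (fun t : R => x + t *: v) f).
rewrite (@derive_comp _ _ _ _ (fun t : R => x + t *: v) f)//.
congr (derive f _ _).
rewrite deriveE// diffD; [|exact: differentiable_cst|].
  rewrite diff_cst diffZl; last exact: ex_diff.
  by rewrite (@diff_val _ _ _ _ _ _ _ (is_diff_id t)) /= add0r scale1r.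
by apply: differentiableZl; exact: ex_diff.
Qed.

Lemma MVT_line (V : normedModType R) (f : V -> R) (x v : V) (d : R) : 0 < d ->
  (forall t, 0 <= t <= d -> differentiable f (x + t *: v)) ->
  exists2 t, 0 <= t <= d & f (x + d *: v) - f x = d * 'D_v f (x + t *: v).
Proof.
move=> d0 df.
have Hd t : 0 <= t <= d -> is_derive t 1 (fun t => f (x + t *: v)) ('D_v f (x + t *: v)).
  by move=> td; apply: derive_line; exact: df.
have [||t] := @MVT R (fun t => f (x + t *: v)) (fun t => 'D_v f (x + t *: v)) 0 d d0.
- by move=> t; rewrite in_itv /= => /andP[t0 td]; apply: Hd; rewrite !ltW.
- apply: derivable_within_continuous => t; rewrite in_itv /= => td.
  by have [] := Hd t td.
- rewrite in_itv /= => /andP[t0 td]; rewrite scale0r addr0 subr0 mulrC => E.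
  by exists t; rewrite ?ltW.
Qed.

(* If the two mixed derivatives differed, the mean value theorem applied to
   the second difference quotient would locate, arbitrarily close to p, a value
   of one equal to a value of the other. *)
Lemma derive_swap_R (V : normedModType R) (f : V -> R) (p u v : V) :
  smooth_near p f -> 'D_u ('D_v f) p = 'D_v ('D_u f) p.
Proof.
move=> sf.
have second_difference u' v' (d : R) : 0 < d ->
    (forall s t, 0 <= s <= d -> 0 <= t <= d ->
       smooth_near (p + s *: u' + t *: v') f) ->
    exists s t, [/\ 0 <= s <= d, 0 <= t <= d &
      f (p + d *: u' + d *: v') - f (p + d *: u') - (f (p + d *: v') - f p) =
        d * (d * 'D_v' ('D_u' f) (p + s *: u' + t *: v'))].
  move=> d0 fd; have dd : 0 <= d <= d by rewrite lexx ltW.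
  have zd : 0 <= (0 : R) <= d by rewrite lexx ltW.
  pose g x := f (x + d *: v') - f x.
  have df1 s : 0 <= s <= d -> differentiable f (p + s *: u').
    move=> sd; rewrite -[p + _]addr0 -(scale0r v').
    exact/smooth_near_differentiable/fd.
  have df2 s : 0 <= s <= d -> differentiable (fun x => f (x + d *: v')) (p + s *: u').
    move=> sd; apply: (@differentiable_comp _ _ _ _ (fun x => x + d *: v') f).
      by apply: differentiableD; [exact: ex_diff | exact: differentiable_cst].
    exact/smooth_near_differentiable/fd.
  have [s sd gs] : exists2 s, 0 <= s <= d &
      g (p + d *: u') - g p = d * 'D_u' g (p + s *: u').
    by apply: (MVT_line d0) => s sd; apply: differentiableB; [exact: df2 | exact: df1].
  have [t td ht] : exists2 t, 0 <= t <= d &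
      'D_u' f (p + s *: u' + d *: v') - 'D_u' f (p + s *: u') =
      d * 'D_v' ('D_u' f) (p + s *: u' + t *: v').
    apply: (MVT_line (f := 'D_u' f) d0) => t td.
    exact/smooth_near_differentiable/smooth_near_derive/fd.
  exists s, t; split=> //; rewrite -ht.
  rewrite -[LHS]/(g (p + d *: u') - g p) gs; congr (_ * _).
  rewrite deriveB; [|exact/diff_derivable/df2|exact/diff_derivable/df1].
  congr (_ - _); rewrite -[LHS]/('D_u' (f \o (fun x => x + d *: v')) (p + s *: u')).
  rewrite derive_comp; [| |exact/smooth_near_differentiable/fd]; last first.
    by apply: differentiableD; [exact: ex_diff | exact: differentiable_cst].
  congr (derive f _ _); rewrite deriveD; [|exact: derivable_id|exact: derivable_cst].
  by rewrite derive_id derive_cst addr0.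
apply/eqP; rewrite -subr_eq0 -normr_eq0; apply/eqP/le_anti; rewrite normr_ge0 andbT.
apply/ler_addgt0Pr => e e0; rewrite add0r.
have cont a b : {for p, continuous ('D_a ('D_b f))}.
  apply/differentiable_continuous/smooth_near_differentiable.
  by do 2 apply: smooth_near_derive.
have e20 : 0 < e / 2 by rewrite divr_gt0.
have := cont u v => /cvgrPdist_le/(_ _ e20) near1.
have := cont v u => /cvgrPdist_le/(_ _ e20) near2.
have near3 := smooth_nearW sf.
have /nbhs_ballP [r r0 rP] : \forall q \near p, [/\ smooth_near q f,
   `|'D_u ('D_v f) p - 'D_u ('D_v f) q| <= e / 2 &
   `|'D_v ('D_u f) p - 'D_v ('D_u f) q| <= e / 2].
  by apply: filterS3 near3 near1 near2 => q; exact: And3.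
(* The parallelogram with sides [d *: u] and [d *: v] has to stay in the ball of radius [r]; the
   summand 1 keeps the denominator positive when [u] and [v] vanish. *)
pose d := r / 2 / (`|u| + `|v| + 1).
have uv0 : 0 < `|u| + `|v| + 1 by rewrite ltr_wpDl// addr_ge0.
have d0 : 0 < d by rewrite !divr_gt0.
have near_d s t : 0 <= s <= d -> 0 <= t <= d -> ball p r (p + s *: u + t *: v).
  move=> /andP[s0 sd] /andP[t0 td]; rewrite -ball_normE /= -addrA opprD addNKr normrN.
  apply: (@le_lt_trans _ _ (d * (`|u| + `|v| + 1))); last first.
    by rewrite /d divfK ?gt_eqF// ltr_pdivrMr// ltr_pMr// ltr1n.
  apply: (le_trans (ler_normD _ _)); rewrite !normrZ !ger0_norm//.
  rewrite 2!mulrDr mulr1; apply: ler_wpDr; first exact: ltW.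
  by apply: lerD; exact: ler_wpM2r.
have [|s [t [sd td E1]]] := second_difference u v d d0.
  by move=> s t sd td; have [] := rP _ (near_d s t sd td).
have [|s' [t' [sd' td' E2]]] := second_difference v u d d0.
  by move=> s' t' sd' td'; have [] := rP _ (near_d t' s' td' sd'); rewrite addrAC.
have E : 'D_v ('D_u f) (p + s *: u + t *: v) = 'D_u ('D_v f) (p + s' *: v + t' *: u).
  have dn0 : d != 0 by rewrite gt_eqF.
  apply: (mulfI dn0); apply: (mulfI dn0).
  apply: (etrans (esym E1)); apply: etrans E2; rewrite [p + d *: v + _]addrAC.
  by move: (f _) (f _) (f _) (f _) => *; ring.
have [_ _ H1] := rP _ (near_d s t sd td).
have [_ + _] := rP _ (near_d t' s' td' sd'); rewrite addrAC => H2.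
rewrite -E in H2.
have aux (a b c : R) : `|a - c| <= e / 2 -> `|b - c| <= e / 2 -> `|a - b| <= e.
  move=> Ha Hb; rewrite -[a - b](subrKA c) -[c - b]opprB.
  by apply: (le_trans (ler_normB _ _)); rewrite [leRHS]splitr; exact: lerD.
exact: aux H2 H1.
Unshelve. all: by end_near.
Qed.

Lemma derive_swap (V W : normedModType R) (f : V -> W) (p u v : V) :
  fin_coord W -> smooth_near p f -> 'D_u ('D_v f) p = 'D_v ('D_u f) p.
Proof.
move=> [n [c [e [cc ce]]]] sf; have fW : fin_coord W by exists n, c, e.
have cD g w q : differentiable g q -> c^~ ('D_w g q) =1 fun i => 'D_w (c i \o g) q.
  move=> dg i; rewrite [RHS]derive_comp ?[RHS]derive_lin//; do ?[exact: dg | exact: cc].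
  by apply: linear_differentiable; exact: cc.
rewrite (ce ('D_u _ p)) (ce ('D_v _ p)); apply: eq_bigr => i _; congr (_ *: _).
rewrite !cD; try by apply: smooth_near_differentiable; exact: smooth_near_derive.
have E w : \forall q \near p, (c i \o 'D_w f) q = 'D_w (c i \o f) q.
  near=> q; rewrite /= cD//; apply: smooth_near_differentiable.
  by near: q; exact: smooth_nearW.
rewrite (near_eq_derive _ (E v)) (near_eq_derive _ (E u)); apply: derive_swap_R.
by apply: (smooth_near_comp fW sf); exact: smooth_near_lin.
Unshelve. all: by end_near.
Qed.

End Schwarz.

(** * Derivatives along a submanifold *)

Section SmoothOnSubset.
Context {R : realType}.
Implicit Types U V W E : normedModType R.

Lemma smooth_near_at V W (S : set V) (p : V) (f : V -> W) :
  smooth_near p f -> smooth_at S p f.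
Proof. by move=> sf; exists f; split=> //; apply: nearW. Qed.

Lemma smooth_at_near V W (S : set V) (p : V) (f : V -> W) :
  smooth_at S p f -> \forall q \near p, smooth_at S q f.
Proof.
move=> [f' [sf /near_join ff]].
by apply: filterS2 (smooth_nearW sf) ff => q sq fq; exists f'.
Qed.

Lemma smooth_ext_val V W (S : set V) (p : V) (f f' : V -> W) :
  S p -> smooth_ext S p f f' -> f p = f' p.
Proof. by move=> Sp [_ /nbhs_singleton]; exact. Qed.

Lemma smooth_at_eq V W (S : set V) (p : V) (f g : V -> W) :
  (\forall q \near p, S q -> f q = g q) -> smooth_at S p f -> smooth_at S p g.
Proof.
move=> fg [f' [sf ff]]; exists f'; split=> //.
by apply: filterS2 fg ff => q fgq ffq Sq; rewrite -fgq// ffq.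
Qed.

Lemma smooth_extD V W (S : set V) (p : V) (f f' g g' : V -> W) :
  smooth_ext S p f f' -> smooth_ext S p g g' ->
  smooth_ext S p (fun q => f q + g q) (fun q => f' q + g' q).
Proof.
move=> [sf ff] [sg gg]; split; first exact: smooth_nearD.
by apply: filterS2 ff gg => q ffq ggq Sq; rewrite ffq// ggq.
Qed.

Lemma smooth_ext_bil U V W E (B : {bilinear U -> V -> W}) (S : set E) (p : E)
    (f f' : E -> U) (g g' : E -> V) : continuous (fun z => B z.1 z.2) ->
  smooth_ext S p f f' -> smooth_ext S p g g' ->
  smooth_ext S p (fun q => B (f q) (g q)) (fun q => B (f' q) (g' q)).
Proof.
move=> cB [sf ff] [sg gg]; split; first exact: smooth_near_bil.
by apply: filterS2 ff gg => q ffq ggq Sq; rewrite ffq// ggq.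
Qed.

Lemma smooth_ext_comp U V W (S : set U) (T : set V) (p : U) (f f' : U -> V)
    (g g' : V -> W) : fin_coord V -> S p ->
  (\forall q \near p, S q -> T (f q)) ->
  smooth_ext S p f f' -> smooth_ext T (f p) g g' ->
  smooth_ext S p (g \o f) (g' \o f').
Proof.
move=> fV Sp fT sef [sg gg]; have [sf ff] := sef; have fp := smooth_ext_val Sp sef.
rewrite fp in sg gg; split; first exact: smooth_near_comp.
have cf : f' @ p --> f' p.
  exact/differentiable_continuous/smooth_near_differentiable.
apply: filterS3 fT ff (cf _ gg) => q Tq ffq ggq Sq /=.
by rewrite (ffq Sq); apply: ggq; rewrite -(ffq Sq); exact: Tq.
Qed.

Lemma smooth_atD V W (S : set V) (p : V) (f g : V -> W) :
  smooth_at S p f -> smooth_at S p g -> smooth_at S p (fun q => f q + g q).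
Proof.
by move=> [f' Hf] [g' Hg]; exists (fun q => f' q + g' q); exact: smooth_extD.
Qed.

Lemma smooth_at_bil U V W E (B : {bilinear U -> V -> W}) (S : set E) (p : E)
    (f : E -> U) (g : E -> V) : continuous (fun z => B z.1 z.2) ->
  smooth_at S p f -> smooth_at S p g -> smooth_at S p (fun q => B (f q) (g q)).
Proof.
by move=> cB [f' Hf] [g' Hg]; exists (fun q => B (f' q) (g' q)); exact: smooth_ext_bil.
Qed.

Lemma smooth_atZ V W (S : set V) (p : V) (f : V -> R) (g : V -> W) :
  smooth_at S p f -> smooth_at S p g -> smooth_at S p (fun q => f q *: g q).
Proof. by apply: (smooth_at_bil (B := *:%R)); exact: scale_continuous2. Qed.

Lemma smooth_at_cst V W (S : set V) (p : V) (a : W) : smooth_at S p (cst a).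
Proof. exact/smooth_near_at/smooth_near_cst. Qed.

Lemma smooth_atN V W (S : set V) (p : V) (f : V -> W) :
  smooth_at S p f -> smooth_at S p (fun q => - f q).
Proof.
move=> sf; apply: (@smooth_at_eq _ _ _ _ (fun q => cst (-1 : R) q *: f q)).
  by apply: nearW => q _; rewrite scaleN1r.
by apply: smooth_atZ => //; exact: smooth_at_cst.
Qed.

Lemma smooth_atB V W (S : set V) (p : V) (f g : V -> W) :
  smooth_at S p f -> smooth_at S p g -> smooth_at S p (fun q => f q - g q).
Proof. by move=> sf sg; apply: smooth_atD => //; exact: smooth_atN. Qed.

Lemma smooth_at_comp U V W (S : set U) (T : set V) (p : U) (f : U -> V)
    (g : V -> W) : fin_coord V -> S p ->
  (\forall q \near p, S q -> T (f q)) ->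
  smooth_at S p f -> smooth_at T (f p) g -> smooth_at S p (g \o f).
Proof.
by move=> fV Sp fT [f' Hf] [g' Hg]; exists (g' \o f'); exact: smooth_ext_comp fT Hf Hg.
Qed.

Lemma smooth_at_comp_near U V W (S : set U) (p : U) (f : U -> V) (g : V -> W) :
  fin_coord V -> S p -> smooth_at S p f -> smooth_near (f p) g ->
  smooth_at S p (g \o f).
Proof.
move=> fV Sp sf sg; apply: (smooth_at_comp fV Sp _ sf (smooth_near_at setT sg)).
exact: nearW.
Qed.

Lemma smooth_at_pair U V W (S : set U) (p : U) (f : U -> V) (g : U -> W) :
  smooth_at S p f -> smooth_at S p g -> smooth_at S p (fun q => (f q, g q)).
Proof.
move=> [f' [sf ff]] [g' [sg gg]]; exists (fun q => (f' q, g' q)); split.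
  exact: smooth_near_pair.
by apply: filterS2 ff gg => q ffq ggq Sq; rewrite ffq// ggq.
Qed.

Lemma smooth_at_xget V W (S : set V) (p : V) (f : V -> W) :
  smooth_at S p f -> smooth_ext S p f (xget f (smooth_ext S p f)).
Proof. by move=> [f' Hf]; exact: xgetI Hf. Qed.

Lemma smooth_at_setT V W (p : V) (f : V -> W) :
  smooth_at setT p f -> smooth_near p f.
Proof.
move=> [f' [sf ff]]; apply: smooth_near_eq sf.
by apply: filterS ff => q ->.
Qed.

End SmoothOnSubset.

Section DerivativeAlongS.
Context {R : realType} {V : normedVectType R} (S : set V).
Implicit Types (U W : normedModType R) (X Y Z : V -> V) (p q x : V).

(** The curves that witness [tangent S p x]. Through them derivatives along S become derivatives of
    functions of one real variable. *)
Definition curve_in p x (c : R -> V) :=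
  [/\ smooth_near 0 c, c 0 = p, \forall t \near 0, S (c t) & derive1 c 0 = x].

Lemma curve_inS p x c : curve_in p x c -> S p.
Proof. by move=> [_ <- /nbhs_singleton]. Qed.

Lemma tangentS p x : tangent S p x -> S p.
Proof. by move=> [c]; exact: curve_inS. Qed.

Lemma derive_curve W (f : V -> W) p x c : differentiable f p ->
  curve_in p x c -> is_derive (0 : R) 1 (f \o c) ('D_x f p).
Proof.
move=> df [sc c0 _ c1]; have dc := smooth_near_differentiable sc.
apply: DeriveDef.
  by apply/derivable1_diffP; apply: differentiable_comp; rewrite ?c0.
by rewrite derive_comp ?c0// -c1 derive1E.
Qed.

Lemma near_curve p x c (P : V -> Prop) : curve_in p x c ->
  (\forall q \near p, S q -> P q) -> \forall t \near (0 : R), P (c t).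
Proof.
move=> [sc c0 Sc _]; rewrite -c0 => nP.
have cc : c @ (0 : R) --> c 0.
  exact/differentiable_continuous/smooth_near_differentiable.
by apply: filterS2 Sc (cc _ nP) => t Sct; exact.
Qed.

(** On a curve inside S every extension of [f] agrees with [f], so the extension chosen by [dS]
    disappears from the right-hand composition. This is what makes [dS] independent of the
    choice. *)
Lemma dS_curve W (f : V -> W) p x c : smooth_at S p f -> curve_in p x c ->
  is_derive (0 : R) 1 (f \o c) (dS S f p x).
Proof.
move=> sf Hc; have [sf' ff'] := smooth_at_xget sf.
apply: near_eq_is_derive (derive_curve (smooth_near_differentiable sf') Hc).
apply: (near_curve (P := fun q => xget f (smooth_ext S p f) q = f q) Hc).
by apply: filterS ff' => q ffq /ffq ->.
Qed.

Lemma dS_ext W (f f' : V -> W) p x : smooth_ext S p f f' -> tangent S p x ->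
  dS S f p x = 'D_x f' p.
Proof.
move=> [sf' ff'] [c Hc]; have sf : smooth_at S p f by exists f'.
have [_ <-] := dS_curve sf Hc.
have [_ <-] := derive_curve (smooth_near_differentiable sf') Hc.
apply: near_eq_derive; exact: (near_curve Hc ff').
Qed.

Lemma dS_eq W (f g : V -> W) p x : smooth_at S p f -> tangent S p x ->
  (\forall q \near p, S q -> f q = g q) -> dS S f p x = dS S g p x.
Proof.
move=> sf [c Hc] fg; have [_ <-] := dS_curve sf Hc.
have [_ <-] := dS_curve (smooth_at_eq fg sf) Hc.
apply: near_eq_derive; exact: (near_curve Hc fg).
Qed.

Lemma dSD W (f g : V -> W) p x : smooth_at S p f -> smooth_at S p g ->
  tangent S p x -> dS S (fun q => f q + g q) p x = dS S f p x + dS S g p x.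
Proof.
move=> [f' Hf] [g' Hg] tx.
rewrite (dS_ext (smooth_extD Hf Hg) tx) (dS_ext Hf tx) (dS_ext Hg tx).
by apply: deriveD; apply/diff_derivable/smooth_near_differentiable;
  [case: Hf|case: Hg].
Qed.

Lemma dS_bil U W W' (B : {bilinear U -> W -> W'}) (f : V -> U) (g : V -> W) p x :
  continuous (fun z => B z.1 z.2) -> smooth_at S p f -> smooth_at S p g ->
  tangent S p x ->
  dS S (fun q => B (f q) (g q)) p x = B (f p) (dS S g p x) + B (dS S f p x) (g p).
Proof.
move=> cB [f' Hf] [g' Hg] tx; have Sp := tangentS tx.
rewrite (dS_ext (smooth_ext_bil cB Hf Hg) tx) (dS_ext Hf tx) (dS_ext Hg tx).
rewrite (smooth_ext_val Sp Hf) (smooth_ext_val Sp Hg).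
by apply: derive_bil => //; apply: smooth_near_differentiable;
  [case: Hf|case: Hg].
Qed.

Lemma dSZ W (f : V -> R) (g : V -> W) p x : smooth_at S p f ->
  smooth_at S p g -> tangent S p x ->
  dS S (fun q => f q *: g q) p x = f p *: dS S g p x + dS S f p x *: g p.
Proof. by apply: (dS_bil (B := *:%R)); exact: scale_continuous2. Qed.

Lemma dS_cst W (a : W) p x : tangent S p x -> dS S (cst a) p x = 0.
Proof.
move=> tx; rewrite (@dS_ext _ _ (cst a))//; first exact: derive_cst.
by split; [exact: smooth_near_cst | exact: nearW].
Qed.

Lemma dSN W (f : V -> W) p x : smooth_at S p f ->
  tangent S p x -> dS S (fun q => - f q) p x = - dS S f p x.
Proof.
move=> sf tx; have s1 : smooth_at S p (cst (-1 : R)) by exact: smooth_at_cst.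
rewrite -[RHS]scaleN1r -[LHS](@dS_eq _ (fun q => cst (-1 : R) q *: f q))//.
- by rewrite dSZ// dS_cst// scale0r addr0.
- exact: smooth_atZ.
- by apply: nearW => q _; rewrite scaleN1r.
Qed.

Lemma dSB W (f g : V -> W) p x : smooth_at S p f -> smooth_at S p g ->
  tangent S p x -> dS S (fun q => f q - g q) p x = dS S f p x - dS S g p x.
Proof. by move=> sf sg tx; rewrite dSD ?dSN//; exact: smooth_atN. Qed.

Lemma dS_lin W (f : V -> W) p (a : R) x y : smooth_at S p f ->
  dS S f p (a *: x + y) = a *: dS S f p x + dS S f p y.
Proof.
move=> /smooth_at_xget[/smooth_near_differentiable df _].
by rewrite /dS deriveDv// deriveZv.
Qed.

Lemma vfield_near p X : vfield S p X -> \forall q \near p, S q -> vfield S q X.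
Proof.
move=> [/smooth_at_near sX /near_join tX].
by apply: filterS2 sX tX => q sXq tXq.
Qed.

Lemma vfield_tangent p X : S p -> vfield S p X -> tangent S p (X p).
Proof. by move=> Sp [_ /nbhs_singleton]; exact. Qed.

Lemma vfield_smooth p X : vfield S p X -> smooth_at S p X.
Proof. by case. Qed.

Lemma dS_smooth_ext W (Z Z' : V -> W) (Y Y' : V -> V) p : vfield S p Y ->
  smooth_ext S p Z Z' -> smooth_ext S p Y Y' ->
  smooth_ext S p (fun q => dS S Z q (Y q)) (fun q => 'D_(Y' q) Z' q).
Proof.
move=> [_ tY] [sZ ZZ] [sY YY]; split.
  exact: smooth_near_deriveP (fin_coord_vect V) sZ sY.
move: ZZ => /near_join ZZ; have sZ' := smooth_nearW sZ.
apply: filterS (filterI (filterI tY ZZ) (filterI sZ' YY)).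
move=> q [[tYq ZZq] [sZq YYq]] Sq; rewrite (@dS_ext _ _ Z')//.
  by rewrite YYq.
exact: tYq.
Qed.

Lemma dS_smooth W (Z : V -> W) (Y : V -> V) p : vfield S p Y ->
  smooth_at S p Z -> smooth_at S p (fun q => dS S Z q (Y q)).
Proof.
move=> vY [Z' HZ]; have [Y' HY] := vfield_smooth vY.
by exists (fun q => 'D_(Y' q) Z' q); exact: dS_smooth_ext.
Qed.

(** In coordinates the product rule separates the change of the direction [g] from the change of the
    base point; symmetry of second derivatives then exchanges ['D_x] with the coordinate
    derivatives. *)
Lemma derive_deriveP W (f : V -> W) (g : V -> V) (x p : V) :
  fin_coord W -> smooth_near p f -> smooth_near p g ->
  'D_x (fun q => 'D_(g q) f q) p = 'D_('D_x g p) f p + 'D_(g p) ('D_x f) p.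
Proof.
move=> fW sf sg; have [n [c [e [cc ce]]]] := fin_coord_vect V.
have df : \forall q \near p, differentiable f q.
  by apply: filterS (smooth_nearW sf) => q; exact: smooth_near_differentiable.
have Dfw q w : differentiable f q -> 'D_w f q = \sum_i c i w *: 'D_(e i) f q.
  move=> dfq; rewrite {1}(ce w) deriveE// linear_sum.
  by apply: eq_bigr => i _; rewrite linearZ /= -deriveE.
have dfp := smooth_near_differentiable sf.
have dgp := smooth_near_differentiable sg.
have DE : \forall q \near p, 'D_(g q) f q = \sum_i c i (g q) *: 'D_(e i) f q.
  by apply: filterS df => q dfq; rewrite Dfw.
have dcg i : differentiable (c i \o g) p.
  apply: differentiable_comp; first exact: smooth_near_differentiable.
  by apply: linear_differentiable; exact: cc.
have dDf v : differentiable ('D_v f) p.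
  exact/smooth_near_differentiable/smooth_near_derive.
rewrite (near_eq_derive _ DE) (Dfw p _ dfp).
rewrite (_ : (fun q => _) = \sum_i (fun q => (c i \o g) q *: 'D_(e i) f q)); last first.
  by apply/funext => q; rewrite fct_sumE.
rewrite derive_sum => [|i]; last first.
  apply/diff_derivable; apply: (differentiable_bil (B := *:%R)) => //.
  exact: scale_continuous2.
under eq_bigr => i _.
  rewrite (derive_bil (B := *:%R)) //; last exact: scale_continuous2.
  rewrite derive_comp ?derive_lin; [|exact: cc
    |exact: smooth_near_differentiable
    |by apply: linear_differentiable; exact: cc].
  over.
rewrite big_split /= addrC; congr (_ + _).
have dDxf : differentiable ('D_x f) p := dDf x.
have -> : 'D_(g p) ('D_x f) p = \sum_i c i (g p) *: 'D_(e i) ('D_x f) p.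
  rewrite {1}(ce (g p)) deriveE// linear_sum.
  by apply: eq_bigr => i _; rewrite linearZ /= -deriveE.
by apply: eq_bigr => i _; congr (_ *: _); exact: derive_swap.
Qed.

(** Flatness of the connection of V: the second-order terms of the extensions cancel by symmetry of
    second derivatives, and the first-order terms assemble into the bracket. *)
Lemma dS_commutator (X Y Z : V -> V) p : S p ->
  vfield S p X -> vfield S p Y -> smooth_at S p Z -> tangent S p (lie S X Y p) ->
  dS S (fun q => dS S Z q (Y q)) p (X p) - dS S (fun q => dS S Z q (X q)) p (Y p)
  = dS S Z p (lie S X Y p).
Proof.
move=> Sp vX vY [Z' HZ] tl; have [X' HX] := vfield_smooth vX.
have [Y' HY] := vfield_smooth vY.
have tX := vfield_tangent Sp vX; have tY := vfield_tangent Sp vY.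
have [[sX _] [sY _] [sZ _]] := And3 HX HY HZ; have fV := fin_coord_vect V.
rewrite (dS_ext (dS_smooth_ext vY HZ HY) tX) (dS_ext (dS_smooth_ext vX HZ HX) tY).
rewrite (dS_ext HZ tl) (derive_deriveP _ fV sZ sY) (derive_deriveP _ fV sZ sX).
rewrite /lie (dS_ext HY tX) (dS_ext HX tY).
rewrite -(smooth_ext_val Sp HX) -(smooth_ext_val Sp HY).
rewrite (derive_swap _ _ fV sZ) opprD addrACA subrr addr0.
have dZ := smooth_near_differentiable sZ.
by rewrite deriveDv// deriveNv.
Qed.

End DerivativeAlongS.

(** * The scalar product and smooth orthogonal projections *)

Section DotProduct.
Context {R : realType} {V : normedVectType R} (h : {dot V for (idfun : R -> R)}).
Implicit Types x y z : V.

Lemma dotC x y : h x y = h y x.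
Proof. by rewrite [LHS]hermitian_subproof /= expr0 mul1r. Qed.

Lemma dotDl x y z : h (x + y) z = h x z + h y z.
Proof. exact: (linearDl h). Qed.

Lemma dotDr x y z : h z (x + y) = h z x + h z y.
Proof. by rewrite !(dotC z) dotDl. Qed.

Lemma dotZl a x z : h (a *: x) z = a * h x z.
Proof. exact: (linearZl_LR h). Qed.

Lemma dotZr a x z : h z (a *: x) = a * h z x.
Proof. by rewrite !(dotC z) dotZl. Qed.

Lemma dotNl x z : h (- x) z = - h x z.
Proof. by rewrite -scaleN1r dotZl mulN1r. Qed.

Lemma dotNr x z : h z (- x) = - h z x.
Proof. by rewrite !(dotC z) dotNl. Qed.

Lemma dot0l z : h 0 z = 0.
Proof. by rewrite -(scale0r 0) dotZl mul0r. Qed.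

Lemma dot0r z : h z 0 = 0.
Proof. by rewrite dotC dot0l. Qed.

Lemma dotBl x y z : h (x - y) z = h x z - h y z.
Proof. by rewrite dotDl dotNl. Qed.

Lemma dotBr x y z : h z (x - y) = h z x - h z y.
Proof. by rewrite dotDr dotNr. Qed.

Lemma dot_gt0 x : x != 0 -> 0 < h x x.
Proof. exact: neq0_dnorm_gt0. Qed.

Lemma dot_ge0 x : 0 <= h x x.
Proof.
have [->|/dot_gt0/ltW//] := eqVneq x 0; first by rewrite dot0l.
Qed.

Lemma dot_eq0 x : h x x = 0 -> x = 0.
Proof.
by move=> hx; apply/eqP/negPn/negP => /dot_gt0; rewrite hx ltxx.
Qed.

Lemma dot_continuous : continuous (fun z : V * V => h z.1 z.2).
Proof. by apply: (bilin_continuous (f := h)); exact: fin_coord_vect. Qed.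

Lemma smooth_near_dot (W : normedModType R) (p : W) (f g : W -> V) :
  smooth_near p f -> smooth_near p g -> smooth_near p (fun q => h (f q) (g q)).
Proof. exact: (smooth_near_bil (B := h) dot_continuous). Qed.

Lemma smooth_at_dot (W : normedModType R) (S : set W) (p : W) (f g : W -> V) :
  smooth_at S p f -> smooth_at S p g -> smooth_at S p (fun q => h (f q) (g q)).
Proof. exact: (smooth_at_bil (B := h) dot_continuous). Qed.

Lemma dS_dot (S : set V) (p x : V) (f g : V -> V) :
  smooth_at S p f -> smooth_at S p g -> tangent S p x ->
  dS S (fun q => h (f q) (g q)) p x = h (f p) (dS S g p x) + h (dS S f p x) (g p).
Proof. exact: (dS_bil (B := h) dot_continuous). Qed.

(** Two candidates differ by a vector of [T] that is orthogonal to [T], hence to itself. *)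
Lemma hproj_unique (T : set V) (w w' : V) :
  (forall x y, T x -> T y -> T (x - y)) ->
  T w' -> (forall t, T t -> h (w - w') t = 0) -> hproj h T w = w'.
Proof.
move=> TB Tw' ow'; rewrite /hproj; case: xgetP => [w'' _ [Tw'' ow'']|].
  apply/subr0_eq/dot_eq0; have Td := TB _ _ Tw'' Tw'.
  have E : w'' - w' = (w - w') - (w - w'') by rewrite opprB [RHS]addrC subrKA.
  by rewrite {1}E dotBl ow'// ow''// subrr.
by move=> /(_ w'); case.
Qed.

Lemma hnorm_sqr x : hnorm h x ^+ 2 = h x x.
Proof. by rewrite /hnorm sqr_sqrtr// dot_ge0. Qed.

(** [hproj] is a pointwise choice, so its smooth dependence on the point must come from a formula.
    Adding one frame vector at a time gives one, with denominator [d q]; independence at [p] yields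
    [d p != 0], and continuity extends this to nearby points. *)
Lemma gram_schmidt (p : V) (n : nat) (e : nat -> V -> V) :
  (forall i, smooth_near p (e i)) -> free (mkseq (e^~ p) n) ->
  exists Pi : V -> V -> V,
    (forall f, smooth_near p f -> smooth_near p (fun q => Pi q (f q))) /\
    \forall q \near p, forall x, Pi q x \in <<mkseq (e^~ q) n>>%VS /\
      forall t, t \in <<mkseq (e^~ q) n>>%VS -> h (x - Pi q x) t = 0.
Proof.
move=> se; elim: n => [|n IH] fe.
  exists (fun _ _ => 0); split=> [f _|]; first exact: smooth_near_cst.
  apply: nearW => q x; rewrite span_nil mem0v; split=> // t.
  by rewrite memv0 => /eqP ->; rewrite dot0r.
move: fe; rewrite mkseqS (perm_free (Y := e n p :: mkseq (e^~ p) n)) ?perm_rcons//.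
rewrite free_cons => /andP[enp /IH [Pi [sPi Pip]]].
pose e' q := e n q - Pi q (e n q).
have se' : smooth_near p e' by apply: smooth_nearB => //; exact: sPi.
pose d q := h (e' q) (e' q).
have sd : smooth_near p d by exact: smooth_near_dot.
have dp : d p != 0.
  rewrite gt_eqF// dot_gt0// subr_eq0; apply: contra enp => /eqP ->.
  by have [] := nbhs_singleton Pip (e n p).
have dn : \forall q \near p, d q != 0.
  have cd := differentiable_continuous (smooth_near_differentiable sd).
  have oN : open_nbhs (d p) [set x : R | x != 0] by split=> //; exact: open_neq.
  exact: (cd _ (open_nbhs_nbhs oN)).
exists (fun q x => Pi q x + (h x (e' q) / d q) *: e' q); split=> [f sf|].
  apply: smooth_nearD; first exact: sPi.
  apply: smooth_nearZ => //; apply: smooth_nearM; first exact: smooth_near_dot.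
  exact: smooth_nearV.
apply: filterS2 Pip dn => q Piq dq x.
rewrite mkseqS -cats1 span_cat span_seq1; set X := (<<_>>)%VS in Piq *.
have [Px ox] := Piq x; have [Pe oe] := Piq (e n q); rewrite -/(e' q) in oe.
split.
  rewrite scalerBr addrA [_ + _ *: e n q]addrC -addrA addrC.
  apply: memv_add; last by rewrite memvZ// memv_line.
  by rewrite memvB// memvZ.
move=> t /memv_addP [a Xa [b /vlineP [k ->] ->]].
have oe' : h (x - Pi q x) (e' q) = h x (e' q).
  by rewrite dotBl (dotC (Pi q x)) oe// subr0.
have -> : e n q = e' q + Pi q (e n q) by rewrite subrK.
rewrite opprD addrA; have dE : d q = h (e' q) (e' q) by [].
move: (x - Pi q x) (e' q) ox oe oe' dE => y f ox oe oe' dE.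
rewrite dotBl !dotDr !dotZr !dotDr !dotZl oe' (ox _ Xa) (ox _ Pe) (oe _ Xa).
by rewrite (oe _ Pe) !mulr0 !addr0 !add0r -dE divfK// subrr.
Qed.

End DotProduct.

(** * Tangent spaces of a submanifold *)

Section SubmanifoldFacts.
Context {R : realType} {V : normedVectType R} (h : {dot V for (idfun : R -> R)}).
Context (m : nat) (S : set V) (hS : submanifold m S).
Implicit Types p q x y w : V.

(** A slice chart carries curves of S to curves of the linear space [E], so the tangent space at [q]
    is the image of [E] under the differential of [psi] at [phi q]. The images of a basis of [E]
    form the frame. *)
Lemma tangent_frame p : S p -> exists (n : nat) (e : nat -> V -> V),
  [/\ forall i, smooth_near p (e i), free (mkseq (e^~ p) n) &
      \forall q \near p, S q ->
        forall x, tangent S q x <-> x \in <<mkseq (e^~ q) n>>%VS].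
Proof.
move=> Sp; 
have [U [U' [phi [psi [E [[oU oU' Up] [sphi spsi] UU' U'U [_ SE]]]]]]] := hS Sp.
pose b := vbasis E; pose n := \dim E.
have fV := fin_coord_vect V.
have snphi q : U q -> smooth_near q phi by move=> Uq; exists U.
have snpsi q : U q -> smooth_near (phi q) psi.
  by move=> Uq; exists U'; split=> //; have [] := UU' q Uq.
have dphi q (Uq : U q) := smooth_near_differentiable (snphi q Uq).
have dpsi q (Uq : U q) := smooth_near_differentiable (snpsi q Uq).
have nU q : U q -> \forall x \near q, U x by move=> Uq; exact: open_nbhs_nbhs.
have psiphi q x : U q -> 'D_('D_x phi q) psi (phi q) = x.
  move=> Uq; rewrite -derive_comp; [|exact: dphi|exact: dpsi].
  rewrite -[RHS](derive_id q x); apply: near_eq_derive.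
  by apply: filterS (nU q Uq) => y /UU' [].
have phipsi q x : U q -> 'D_('D_x psi (phi q)) phi q = x.
  move=> Uq; have [U'q pq] := UU' q Uq.
  have := derive_comp (f := psi) (g := phi) (x := phi q) x (dpsi q Uq).
  rewrite pq => <-; last exact: dphi.
  rewrite -[RHS](derive_id (phi q) x); apply: near_eq_derive.
  by apply: filterS (open_nbhs_nbhs (conj oU' U'q)) => y /U'U [].
have tE q x : U q -> S q -> tangent S q x <-> exists2 e, e \in E & x = 'D_e psi (phi q).
  move=> Uq Sq; split.
    move=> [c Hc]; exists ('D_x phi q); last by rewrite psiphi.
    (* A linear map with kernel [E]: it vanishes on [phi] along a curve of S, hence on the
       derivative, which therefore lies in [E]. *)
    pose L : {linear V -> V} := (\1 - projv E)%VF.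
    have L0 y : L y = 0 <-> y \in E.
      rewrite /= lfunE /= lfunE /= opp_lfunE; split=> [/subr0_eq ->|yE].
        exact: memv_proj.
      by rewrite projv_id// subrr.
    apply/L0; have cL : continuous L by exact: lin_continuous.
    have [dc Dc] := derive_curve (dphi q Uq) Hc.
    rewrite -Dc -(derive_lin (f := L) (phi (c 0)))//.
    rewrite -(@derive_comp _ _ _ _ (phi \o c) L); 
      [|exact/derivable1_diffP|exact: linear_differentiable].
    rewrite -(derive_cst (0 : V) (0 : R) 1); apply: near_eq_derive.
    apply: (near_curve (P := fun y => L (phi y) = 0) Hc).
    by apply: filterS (nU q Uq) => y Uy Sy; apply/L0/SE.
  move=> [e eE ->]; have [U'q pq] := UU' q Uq.
  pose c (t : R) := psi (phi q + t *: e).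
  have sl : smooth_near (0 : R) (fun t : R => phi q + t *: e).
    apply: smooth_nearD; first exact: smooth_near_cst.
    by apply: smooth_nearZ; [exact: smooth_near_id | exact: smooth_near_cst].
  have l0 : phi q + (0 : R) *: e = phi q by rewrite scale0r addr0.
  exists c; split.
  - apply: (smooth_near_comp (f := fun t : R => phi q + t *: e) fV sl).
    by rewrite l0; exact: snpsi.
  - by rewrite /c l0.
  - have cl : (fun t : R => phi q + t *: e) @ (0 : R) --> phi q.
      rewrite -[X in _ --> X]l0.
      exact: (differentiable_continuous (smooth_near_differentiable sl)).
    have nU' : \forall t \near (0 : R), U' (phi q + t *: e).
      exact: (cl _ (open_nbhs_nbhs (conj oU' U'q))).
    apply: filterS nU' => t /U'U [Uc pc]; apply/(SE _ Uc); rewrite pc.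
    by rewrite memvD// ?memvZ//; apply/(SE _ Uq).
  - rewrite derive1E; have := @derive_line _ _ _ psi (phi q) e 0.
    by rewrite l0 => /(_ (dpsi q Uq)) [].
exists n, (fun i q => 'D_(b`_i) psi (phi q)).
have TL q : U q -> linear (fun e => 'D_e psi (phi q)).
  by move=> Uq a x y; rewrite deriveDv ?deriveZv//; exact: dpsi.
have spanE q (Uq : U q) : <<mkseq (fun i => 'D_(b`_i) psi (phi q)) n>>%VS =
    (linfun (HB.pack_for {linear V -> V} (fun e => 'D_e psi (phi q))
      (GRing.isLinear.Build R V V *:%R _ (TL q Uq))) @: E)%VS.
  rewrite -{2}(span_basis (vbasisP E)) limg_span; congr (<<_>>)%VS.
  apply: (@eq_from_nth _ 0) => [|i]; rewrite size_mkseq ?size_map ?size_tuple// => ni.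
  by rewrite nth_mkseq// (nth_map 0) ?size_tuple// lfunE.
split.
- move=> i; apply: (smooth_near_comp (f := phi) (g := 'D_(b`_i) psi) fV).
    exact: snphi.
  exact/smooth_near_derive/snpsi.
- rewrite /free spanE size_mkseq limg_dim_eq//; apply/eqP.
  rewrite -subv0; apply/subvP => x /memv_capP [_]; rewrite memv_ker lfunE /= => /eqP Dx.
  by rewrite -(phipsi p x Up) Dx derive0 mem0v.
- apply: filterS (nU p Up) => q Uq Sq x; rewrite spanE (tE q x Uq Sq); split.
    by move=> [e eE ->]; apply/memv_imgP; exists e; rewrite ?lfunE.
  by move=> /memv_imgP [e eE ->]; exists e; rewrite ?lfunE.
Qed.

Lemma tangentP p : S p -> exists E : {vspace V}, forall x, tangent S p x <-> x \in E.
Proof.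
move=> Sp; have [n [e [_ _ /nbhs_singleton]]] := tangent_frame Sp.
by move=> /(_ Sp) H; exists <<mkseq (e^~ p) n>>%VS.
Qed.

Lemma tangent0 p : S p -> tangent S p 0.
Proof. by move=> /tangentP [E HE]; apply/HE; exact: mem0v. Qed.

Lemma tangentD p x y : tangent S p x -> tangent S p y -> tangent S p (x + y).
Proof.
move=> tx; have [E HE] := tangentP (tangentS tx).
by move: tx => /HE tx /HE ty; apply/HE; exact: memvD.
Qed.

Lemma tangentZ p a x : tangent S p x -> tangent S p (a *: x).
Proof.
move=> tx; have [E HE] := tangentP (tangentS tx).
by move: tx => /HE tx; apply/HE; exact: memvZ.
Qed.

Lemma tangentN p x : tangent S p x -> tangent S p (- x).
Proof. by rewrite -scaleN1r; exact: tangentZ. Qed.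

Lemma tangentB p x y : tangent S p x -> tangent S p y -> tangent S p (x - y).
Proof. by move=> tx ty; apply: tangentD => //; exact: tangentN. Qed.

Lemma tangent_projection p : S p -> exists Pi : V -> V -> V,
  (forall f, smooth_near p f -> smooth_near p (fun q => Pi q (f q))) /\
  \forall q \near p, S q -> forall x, tangent S q (Pi q x) /\
    forall t, tangent S q t -> h (x - Pi q x) t = 0.
Proof.
move=> Sp; have [n [e [se fe te]]] := tangent_frame Sp.
have [Pi [sPi HPi]] := gram_schmidt h se fe; exists Pi; split=> //.
apply: filterS2 te HPi => q teq HPiq Sq x; have [Px ox] := HPiq x.
by split=> [|t /(teq Sq)]; [exact/(teq Sq) | exact: ox].
Qed.

Lemma hprojP p x : S p -> tangent S p (hproj h (tangent S p) x) /\
  forall t, tangent S p t -> h (x - hproj h (tangent S p) x) t = 0.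
Proof.
move=> Sp; have [Pi [_ /nbhs_singleton /(_ Sp x) [Px ox]]] := tangent_projection Sp.
by rewrite (hproj_unique _ Px ox)//; exact: tangentB.
Qed.

Lemma hproj_tangent p x : S p -> tangent S p (hproj h (tangent S p) x).
Proof. by move=> Sp; have [] := hprojP x Sp. Qed.

Lemma hproj_orth p x t : tangent S p t -> h (hproj h (tangent S p) x) t = h x t.
Proof.
move=> tt; have [_ /(_ t tt)] := hprojP x (tangentS tt).
by rewrite dotBl => /subr0_eq.
Qed.

Lemma hproj_id p x : tangent S p x -> hproj h (tangent S p) x = x.
Proof.
move=> tx; apply: hproj_unique => // [y z|t _]; first exact: tangentB.
by rewrite subrr dot0l.
Qed.

Lemma vfield_hproj p (f : V -> V) : S p -> smooth_at S p f ->
  vfield S p (fun q => hproj h (tangent S q) (f q)).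
Proof.
move=> Sp [f' [sf ff]]; have [Pi [sPi HPi]] := tangent_projection Sp; split.
  exists (fun q => Pi q (f' q)); split; first exact: sPi.
  apply: filterS2 HPi ff => q HPiq ffq Sq; rewrite ffq//.
  have [Px ox] := HPiq Sq (f' q).
  by apply: hproj_unique => //; exact: tangentB.
by apply: nearW => q Sq; exact: hproj_tangent.
Qed.

(** The default [cst x] of [ext] is not tangent in general. Projecting this constant field onto the
    tangent spaces gives a smooth tangent field through [x], so the choice succeeds. *)
Lemma ext_spec p x : tangent S p x -> vfield S p (ext S p x) /\ ext S p x p = x.
Proof.
move=> tx; have Sp := tangentS tx.
pose X q := hproj h (tangent S q) (cst x q).
have H : [set X | vfield S p X /\ X p = x] X.
  split; last exact: hproj_id.
  by apply: vfield_hproj => //; exact: smooth_at_cst.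
exact: xgetI H.
Qed.

End SubmanifoldFacts.

Local Opaque ext dS hproj.

(** * The Riemannian Gauss equation *)

Section GaussFormula.
Context {R : realType} {V : normedVectType R} (h : {dot V for (idfun : R -> R)}).
Context (m : nat) (S : set V) (hS : submanifold m S).
Context (nb : V -> V -> (V -> V) -> V) (hnb : levi_civita h S nb).
Implicit Types (p q x y w : V) (X Y Z T : V -> V).

Local Notation II := (II h S).
Local Notation IIv := (IIv h S).
Local Notation proj p := (hproj h (tangent S p)).

Lemma subrACA (U : zmodType) (a b c d : U) : a - b - (c - d) = (a - c) - (b - d).
Proof. by rewrite !opprD addrACA. Qed.

Lemma dot_sub3 a b c d e f t (r s : R) : h a t = h d t + r -> h b t = h e t + s ->
  h c t = h f t -> d - e - f = 0 -> h (a - b - c) t = r - s.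
Proof.
move=> ha hb hc /(congr1 (h ^~ t)); rewrite !dotBl dot0l ha hb hc; lra.
Qed.

(** The linear algebra of [dS_II_wind]: [f] is the tangential projection of [d], so
    [h f W = h f w = h d w = - r]. *)
Lemma dot_normal_split n e d f a a1 a2 w W (r : R) :
  e = 0 -> a1 = a -> a2 = a -> h d w = - r -> h w f = h W f -> h f w = h d w ->
  h n e + h d W = h (d - f - a1 - a2) W + 2 * h a W - r.
Proof.
move=> -> -> ->; rewrite !dotBl dot0r (dotC h w f) (dotC h W f); lra.
Qed.

Lemma hproj_lin p (a : R) x y : S p ->
  proj p (a *: x + y) = a *: proj p x + proj p y.
Proof.
move=> Sp; have [tx ox] := hprojP h hS x Sp; have [ty oy] := hprojP h hS y Sp.
apply: hproj_unique => [z z'||t tt].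
- exact: (tangentB hS).
- by apply: (tangentD hS) => //; apply: (tangentZ hS).
- rewrite opprD addrACA -scalerBr dotDl dotZl ox// oy// mulr0 addr0//.
Qed.

Lemma hprojB p x y : S p -> proj p (x - y) = proj p x - proj p y.
Proof. by move=> Sp; rewrite addrC -scaleN1r hproj_lin// scaleN1r addrC. Qed.

Lemma lie_tangent p X Y : S p -> vfield S p X -> vfield S p Y ->
  tangent S p (lie S X Y p).
Proof.
move=> Sp vX vY; rewrite -(lc_torsion_free hnb Sp vX vY).
have tX := vfield_tangent Sp vX; have tY := vfield_tangent Sp vY.
by apply: (tangentB hS); apply: (lc_tangent hnb).
Qed.

(** Uniqueness of the Levi-Civita connection: the difference [B] is symmetric by vanishing torsion
    and skew in the other pair of slots by metric compatibility, and permuting the three arguments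
    shows that it equals its own negative. *)
Lemma levi_civitaE p x Y : tangent S p x -> vfield S p Y ->
  nb p x Y = proj p (dS S Y p x).
Proof.
move=> tx vY; have Sp := tangentS tx.
pose B X Y := proj p (dS S Y p (X p)) - nb p (X p) Y.
have Bs X Z : vfield S p X -> vfield S p Z -> B X Z = B Z X.
  move=> vX vZ; apply/subr0_eq; rewrite /B subrACA.
  rewrite -hprojB// -/(lie S X Z p).
  rewrite (hproj_id _ hS (lie_tangent Sp vX vZ)).
  by rewrite (lc_torsion_free hnb Sp vX vZ) subrr.
have Bsk X Z Z' : vfield S p X -> vfield S p Z -> vfield S p Z' ->
    h (B X Z) (Z' p) = - h (B X Z') (Z p).
  move=> vX vZ vZ'; have tX := vfield_tangent Sp vX.
  have tZ := vfield_tangent Sp vZ; have tZ' := vfield_tangent Sp vZ'.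
  have := lc_metric hnb Sp vX vZ vZ'.
  rewrite (dS_dot _ (vfield_smooth vZ) (vfield_smooth vZ') tX) /B !dotBl.
  have := hproj_orth h hS (dS S Z p (X p)) tZ'.
  have := hproj_orth h hS (dS S Z' p (X p)) tZ.
  rewrite !(dotC h (Z p)); lra.
have B0 X Z Z' : vfield S p X -> vfield S p Z -> vfield S p Z' -> h (B X Z) (Z' p) = 0.
  move=> vX vZ vZ'; have := Bsk X Z Z' vX vZ vZ'; rewrite (Bs X Z')// (Bsk Z' X Z)//.
  rewrite (Bs Z' Z)// (Bsk Z Z' X)// (Bs Z X)//; lra.
have [vX Xp] := ext_spec h hS tx.
have tb : tangent S p (B (ext S p x) Y).
  apply: (tangentB hS); first exact: (hproj_tangent _ hS).
  by apply: (lc_tangent hnb) => //; rewrite Xp.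
have [vZ Zp] := ext_spec h hS tb.
have := B0 _ _ _ vX vY vZ; rewrite Zp => /dot_eq0.
by rewrite /B Xp => /subr0_eq ->.
Qed.

Lemma IIE p X Y : S p -> vfield S p X -> vfield S p Y ->
  II X Y p = dS S Y p (X p) - nb p (X p) Y.
Proof.
move=> Sp vX vY; rewrite (levi_civitaE (vfield_tangent Sp vX) vY).
by [].
Qed.

Lemma IIC p X Y : S p -> vfield S p X -> vfield S p Y -> II X Y p = II Y X p.
Proof.
move=> Sp vX vY; apply/subr0_eq; rewrite !IIE// subrACA.
by rewrite -/(lie S X Y p) (lc_torsion_free hnb Sp vX vY) subrr.
Qed.

Lemma normal_partP p x t : tangent S p t -> h (normal_part h S p x) t = 0.
Proof. by move=> tt; have [_] := hprojP h hS x (tangentS tt); exact. Qed.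

Lemma II_normal p X Y t : tangent S p t -> h (II X Y p) t = 0.
Proof. exact: normal_partP. Qed.

(** Tensoriality: the first slot enters only through its value at [p], and symmetry transfers this
    to the second slot. *)
Lemma II_IIv p X Y : S p -> vfield S p X -> vfield S p Y ->
  II X Y p = IIv p (X p) (Y p).
Proof.
move=> Sp vX vY; rewrite /IIv.
have [vX' Xp'] := ext_spec h hS (vfield_tangent Sp vX).
have [vY' Yp'] := ext_spec h hS (vfield_tangent Sp vY).
have -> : II X Y p = II (ext S p (X p)) Y p by rewrite /Defs.II Xp'.
rewrite (IIC Sp vX' vY) [RHS](IIC Sp vX' vY').
by rewrite /Defs.II Yp'.
Qed.

Lemma IIvC p x y : tangent S p x -> tangent S p y -> IIv p x y = IIv p y x.
Proof.
move=> tx ty; have [vX _] := ext_spec h hS tx; have [vY _] := ext_spec h hS ty.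
by apply: IIC => //; exact: tangentS tx.
Qed.

Lemma IIv_lin p (a : R) x y z : tangent S p x -> tangent S p y -> tangent S p z ->
  IIv p (a *: x + y) z = a *: IIv p x z + IIv p y z.
Proof.
move=> tx ty tz; have Sp := tangentS tx.
have txy : tangent S p (a *: x + y) by apply: (tangentD hS) => //; apply: (tangentZ hS).
have [_ Xp] := ext_spec h hS tx; have [_ Yp] := ext_spec h hS ty.
have [vZ _] := ext_spec h hS tz; have [_ XYp] := ext_spec h hS txy.
rewrite /IIv /Defs.II /normal_part XYp Xp Yp dS_lin; last exact: vfield_smooth vZ.
by rewrite hproj_lin// opprD addrACA scalerBr.
Qed.

Lemma IIv_normal p x y t : tangent S p t -> h (IIv p x y) t = 0.
Proof. exact: II_normal. Qed.

Lemma vfield_nb p X Y : S p -> vfield S p X -> vfield S p Y ->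
  vfield S p (fun q => nb q (X q) Y).
Proof.
move=> Sp vX vY; split; first exact: (lc_smooth hnb).
apply: filterS2 (vfield_near vX) (vfield_near vY) => q vXq vYq Sq.
apply: (lc_tangent hnb) => //; last exact: vYq.
by apply: vfield_tangent => //; exact: vXq.
Qed.

Lemma near_IIE p X Y : vfield S p X -> vfield S p Y -> \forall q \near p,
  S q -> dS S Y q (X q) - nb q (X q) Y = II X Y q.
Proof.
move=> vX vY; apply: filterS2 (vfield_near vX) (vfield_near vY) => q vXq vYq Sq.
by rewrite IIE//; [exact: vXq | exact: vYq].
Qed.

Lemma II_smooth p X Y : S p -> vfield S p X -> vfield S p Y ->
  smooth_at S p (II X Y).
Proof.
move=> Sp vX vY; apply: smooth_at_eq (near_IIE vX vY) _.
apply: smooth_atB; first exact: dS_smooth (vfield_smooth vY).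
exact: vfield_smooth (vfield_nb Sp vX vY).
Qed.

Lemma dS_normal p x (N : V -> V) T : smooth_at S p N -> vfield S p T ->
  (\forall q \near p, S q -> h (N q) (T q) = 0) -> tangent S p x ->
  h (dS S N p x) (T p) = - h (N p) (dS S T p x).
Proof.
move=> sN vT NT tx; have sT := vfield_smooth vT.
have := dS_eq (smooth_at_dot h sN sT) tx (g := cst 0) NT.
by rewrite dS_dot// dS_cst// addrC => /eqP; rewrite addr_eq0 => /eqP.
Qed.

(** Weingarten's relation: differentiating h(II(X, Y), T) = 0 moves the derivative onto [T], whose
    derivative has h-normal part [IIv p x (T p)]. *)
Lemma dS_II p X Y T x : S p -> vfield S p X -> vfield S p Y -> vfield S p T ->
  tangent S p x -> h (dS S (II X Y) p x) (T p) = - h (II X Y p) (IIv p x (T p)).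
Proof.
move=> Sp vX vY vT tx; rewrite (dS_normal _ vT)//.
- have [vx xp] := ext_spec h hS tx.
  have := II_IIv Sp vx vT; rewrite xp => <-; rewrite (IIE Sp vx vT) xp dotBr.
  have tn : tangent S p (nb p x T) by apply: (lc_tangent hnb) => //; exact: tangentS tx.
  by rewrite (II_normal X Y tn) subr0.
- exact: II_smooth.
- apply: filterS (vfield_near vT) => q vTq Sq; apply: II_normal.
  by apply: vfield_tangent => //; exact: vTq.
Qed.

Lemma dS_lie_flat p X Y Z : S p -> vfield S p X -> vfield S p Y -> vfield S p Z ->
  dS S (fun q => dS S Z q (Y q)) p (X p) - dS S (fun q => dS S Z q (X q)) p (Y p)
  - dS S Z p (lie S X Y p) = 0.
Proof.
move=> Sp vX vY vZ; rewrite dS_commutator ?subrr//; first exact: vfield_smooth vZ.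
exact: lie_tangent.
Qed.

(** With the inner derivative nb_Y Z written as D_Y Z - II(Y, Z), the outer one yields a flat second
    derivative and a term evaluated by [dS_II]. The flat parts cancel by [dS_lie_flat]. *)
Lemma gauss_equation p X Y Z T : S p -> vfield S p X -> vfield S p Y ->
  vfield S p Z -> vfield S p T ->
  h (riem_curv S nb X Y Z p) (T p) =
  h (IIv p (Y p) (Z p)) (IIv p (X p) (T p)) - h (IIv p (X p) (Z p)) (IIv p (Y p) (T p)).
Proof.
move=> Sp vX vY vZ vT; have tT := vfield_tangent Sp vT.
have nbd X' Y' : vfield S p X' -> vfield S p Y' ->
    h (nb p (X' p) (fun q => nb q (Y' q) Z)) (T p) =
    h (dS S (fun q => dS S Z q (Y' q)) p (X' p)) (T p)
    + h (IIv p (Y' p) (Z p)) (IIv p (X' p) (T p)).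
  move=> vX' vY'; have tX' := vfield_tangent Sp vX'.
  have vA := vfield_nb Sp vY' vZ.
  have sII := II_smooth Sp vY' vZ.
  have sD := dS_smooth vY' (vfield_smooth vZ).
  rewrite (levi_civitaE tX' vA) (hproj_orth h hS _ tT).
  rewrite -(dS_eq (f := fun q => dS S Z q (Y' q) - II Y' Z q)) //.
  - by rewrite (dSB sD sII tX') dotBl (dS_II Sp vY' vZ vT tX') opprK (II_IIv Sp vY' vZ).
  - exact: smooth_atB.
  - by apply: filterS (near_IIE vY' vZ) => q Eq Sq; rewrite -(Eq Sq) subKr.
have E1 := nbd X Y vX vY; have E2 := nbd Y X vY vX.
have E3 : h (nb p (lie S X Y p) Z) (T p) = h (dS S Z p (lie S X Y p)) (T p).
  apply: (etrans (congr1 (h^~ (T p)) (levi_civitaE (lie_tangent Sp vX vY) vZ))).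
  exact: (hproj_orth h hS (dS S Z p (lie S X Y p)) tT).
exact: dot_sub3 E1 E2 E3 (dS_lie_flat Sp vX vY vZ).
Qed.

Section Wind.
Variable W : V.
Let w q := proj q W.

Lemma wind_field p : S p -> vfield S p w.
Proof. by move=> Sp; apply: (vfield_hproj h hS Sp (smooth_at_cst S p W)). Qed.

(** The function differentiated is the later [mu]. Since [W] is constant and [W - w] is normal, only
    the normal part II(x, w) of the derivative of [w] is seen. *)
Lemma dS_wind_norm p x : tangent S p x ->
  dS S (fun q => 1 - h (W - w q) (W - w q)) p x = 2 * h (IIv p x (w p)) W.
Proof.
move=> tx; have Sp := tangentS tx; have vw := wind_field Sp.
have sw := vfield_smooth vw; have tw := vfield_tangent Sp vw.
have sWw : smooth_at S p (fun q => W - w q).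
  by apply: smooth_atB => //; exact: smooth_at_cst.
have dWw : dS S (fun q => W - w q) p x = - dS S w p x.
  by rewrite (dSB (f := cst W)) ?dS_cst ?sub0r//; exact: smooth_at_cst.
rewrite (dSB (f := cst (1 : R))) ?dS_cst//; [|exact: smooth_at_cst|exact: smooth_at_dot].
rewrite dS_dot// dWw (dotC h _ (W - w p)) sub0r.
have [vx xp] := ext_spec h hS tx.
have := II_normal (ext S p x) w tw.
have := II_IIv Sp vx vw; rewrite xp (IIE Sp vx vw) xp => <-.
have tn : tangent S p (nb p x w) by apply: (lc_tangent hnb).
have [_ /(_ _ tn)] := hprojP h hS W Sp; rewrite -/(w p).
move: (dS S w p x) (nb p x w) (w p) => d n w0.
rewrite !(dotNl, dotNr, dotDl, dotDr) !(dotC h W) (dotC h w0 d) (dotC h w0 n); lra.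
Qed.

(** The origin of h((nabla II')(v, v), W) - h(II'(v, v), II'(v, W^top)): [nablaII] keeps only the
    normal part of the derivative of II, and its tangential part meets [W] through [w]. *)
Lemma dS_II_wind p X : S p -> vfield S p X ->
  dS S (fun q => h (II X X q) W) p (X p) =
  h (nablaII h S nb X X X p) W + 2 * h (IIv p (nb p (X p) X) (X p)) W
  - h (IIv p (X p) (X p)) (IIv p (X p) (w p)).
Proof.
move=> Sp vX; have tX := vfield_tangent Sp vX; have sII := II_smooth Sp vX vX.
have vA := vfield_nb Sp vX vX; have vw := wind_field Sp.
have sW : smooth_at S p (cst W) by exact: smooth_at_cst.
have E0 := dS_cst W tX; have E1 := II_IIv Sp vA vX; have E2 := IIC Sp vX vA.
have E3 := dS_II Sp vX vX vw tX; rewrite (II_IIv Sp vX vX) in E3.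
have tD := hproj_tangent h hS (dS S (II X X) p (X p)) Sp.
have E4 := hproj_orth h hS W tD; have tW := hproj_tangent h hS W Sp.
have E5 := hproj_orth h hS (dS S (II X X) p (X p)) tW.
apply: (etrans (dS_dot h sII sW tX)).
exact: (dot_normal_split (II X X p) E0 E1 (etrans E2 E1) E3 E4 E5).
Qed.

End Wind.

End GaussFormula.

(** * Derivatives along curves *)

Section CurveCalculus.
Context {R : realType}.
Implicit Types U V W : normedModType R.

Lemma is_derive_bil U V W (B : {bilinear U -> V -> W}) (f : R -> U) (g : R -> V)
    (df : U) (dg : V) (t : R) : continuous (fun z => B z.1 z.2) ->
  is_derive t 1 f df -> is_derive t 1 g dg ->
  is_derive t 1 (fun s => B (f s) (g s)) (B (f t) dg + B df (g t)).
Proof.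
move=> cB [/derivable1_diffP sf <-] [/derivable1_diffP sg <-]; apply: DeriveDef.
  exact/derivable1_diffP/differentiable_bil.
exact: derive_bil.
Qed.

Lemma is_derive_scale V (a : R -> R) (f : R -> V) (da : R) (df : V) (t : R) :
  is_derive t 1 a da -> is_derive t 1 f df ->
  is_derive t 1 (fun s => a s *: f s) (a t *: df + da *: f t).
Proof. by apply: (is_derive_bil (B := *:%R)); exact: scale_continuous2. Qed.

Lemma is_derive_mul (a b : R -> R) (da db t : R) :
  is_derive t 1 a da -> is_derive t 1 b db ->
  is_derive t 1 (fun s => a s * b s) (a t * db + da * b t).
Proof. by apply: (is_derive_bil (B := *%R)) => ?; exact: mul_continuous. Qed.

Lemma is_derive_comp V W (c : R -> V) (f : V -> W) (dc : V) (t : R) :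
  differentiable f (c t) -> is_derive t 1 c dc ->
  is_derive t 1 (fun s => f (c s)) ('D_dc f (c t)).
Proof.
move=> df [/derivable1_diffP sc <-]; apply: DeriveDef.
  exact/derivable1_diffP/differentiable_comp.
exact: derive_comp.
Qed.

Lemma is_derive_inv (a : R -> R) (da t : R) : a t != 0 -> is_derive t 1 a da ->
  is_derive t 1 (fun s => (a s)^-1) (- da / a t ^+ 2).
Proof.
move=> at0 Ha; apply: is_derive_eq (is_derive_comp (differentiable_Rinv at0) Ha) _.
rewrite deriveE ?diff_Rinv//; last exact: differentiable_Rinv.
by rewrite /GRing.scale /= mulrC mulrN mulNr.
Qed.

Lemma is_derive_add V (f g : R -> V) (df dg : V) (t : R) :
  is_derive t 1 f df -> is_derive t 1 g dg ->
  is_derive t 1 (fun s => f s + g s) (df + dg).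
Proof. by move=> Hf Hg; exact: is_deriveD. Qed.

Lemma is_derive_sub V (f g : R -> V) (df dg : V) (t : R) :
  is_derive t 1 f df -> is_derive t 1 g dg ->
  is_derive t 1 (fun s => f s - g s) (df - dg).
Proof. by move=> Hf Hg; exact: is_deriveB. Qed.

Lemma is_derive_line V (x v : V) (t : R) :
  is_derive t 1 (fun s : R => x + s *: v) v.
Proof.
apply: is_derive_eq (is_derive_add (is_derive_cst x t 1)
  (is_derive_scale (is_derive_id t 1) (is_derive_cst v t 1))) _.
by rewrite scaler0 !add0r scale1r.
Qed.

Lemma is_derive_near V (f g : R -> V) (df : V) (t : R) :
  (\forall s \near t, f s = g s) -> is_derive t 1 f df -> is_derive t 1 g df.
Proof. exact: near_eq_is_derive. Qed.

Lemma is_derive1 V (f : R -> V) (df : V) (t : R) :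
  is_derive t 1 f df -> derive1 f t = df.
Proof. by move=> Hf; rewrite derive1E; exact: derive_val. Qed.

Lemma is_derive_unique V (f : R -> V) (df df' : V) (t : R) :
  is_derive t 1 f df -> is_derive t 1 f df' -> df = df'.
Proof. by move=> /is_derive1 <- /is_derive1. Qed.

Lemma near_neq0 V (p : V) : p != 0 -> \forall q \near p, q != 0.
Proof.
move=> p0; have oN : open_nbhs `|p| [set x : R | x != 0].
  by split; [exact: open_neq | rewrite /= normr_eq0].
have nN : \forall q \near p, `|q| != 0.
  exact: (@norm_continuous _ _ p _ (open_nbhs_nbhs oN)).
by apply: filterS nN => q; rewrite normr_eq0.
Qed.

Lemma is_derive_near0 V (c : R -> V) (dc : V) (t : R) : c t != 0 ->
  is_derive t 1 c dc -> \forall s \near t, c s != 0.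
Proof.
move=> ct [/derivable1_diffP/differentiable_continuous cc _].
exact: (cc _ (near_neq0 ct)).
Qed.

End CurveCalculus.

(** * The Randers norm *)

Section Randers.
Context {R : realType} {V : normedVectType R} (h : {dot V for (idfun : R -> R)}).
Context (W : V) (F : V -> R) (hF : randers_norm h W F).
Implicit Types u v x y z : V.

(* rl v, rphi v and hat v u are v/F(v), phi(v) and u-tilde of the statement; they
   are locked so that the bilinearity rules do not expand them. *)
Definition rl v := locked ((F v)^-1 *: v).
Definition rphi v := locked (h (rl v - W) (rl v)).
Definition dF v x := locked ((rphi v)^-1 * h (rl v - W) x).
(* Along ker dF the fundamental tensor is conformal to h: hat v projects onto
   ker dF along v. *)
Definition hat v x := locked (x - dF v x *: rl v).
Definition fund v y z := dF v y * dF v z + h (hat v y) (hat v z) / rphi v.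
(** The Cartan tensor in closed form. When [fund] is differentiated in the direction [x], the terms
    with [dF] cancel; the first summand comes from the conformal factor 1/phi, the other two from
    the change of the projection [hat]. *)
Definition cartan v x y z :=
  - (h (hat v x) (rl v) * h (hat v y) (hat v z)
     + h (hat v y) (rl v) * h (hat v x) (hat v z)
     + h (hat v z) (rl v) * h (hat v x) (hat v y)) / (2 * F v * rphi v ^+ 2).
(* Half the differential of F^2. *)
Definition legendre v x := F v * dF v x.

Lemma rlE v : rl v = (F v)^-1 *: v.
Proof. by rewrite /rl -lock. Qed.

Lemma rphi_def v : rphi v = h (rl v - W) (rl v).
Proof. by rewrite /rphi -lock. Qed.

Lemma dF_def v x : dF v x = (rphi v)^-1 * h (rl v - W) x.
Proof. by rewrite /dF -lock. Qed.

Lemma hat_def v x : hat v x = x - dF v x *: rl v.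
Proof. by rewrite /hat -lock. Qed.

Lemma legendre0 v : legendre v 0 = 0.
Proof. by rewrite /legendre dF_def dot0r !mulr0. Qed.

Lemma F_gt0 v : v != 0 -> 0 < F v.
Proof. exact: randers_gt0 hF v. Qed.

Lemma F_neq0 v : v != 0 -> F v != 0.
Proof. by move=> v0; rewrite gt_eqF// F_gt0. Qed.

Lemma rl_unit v : v != 0 -> h (rl v - W) (rl v - W) = 1.
Proof. by rewrite rlE; exact: randersE hF v. Qed.

(** Expanding [rl_unit] gives 2 phi = 1 - h(W, W) + |v/F|_h^2. *)
Lemma rphi_gt0 v : v != 0 -> 0 < rphi v.
Proof.
move=> v0; have := rl_unit v0; have := dot_ge0 h (rl v); have := randers_wind hF.
rewrite rphi_def !(dotBl, dotBr) (dotC h W (rl v)); lra.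
Qed.

Lemma rphi_neq0 v : v != 0 -> rphi v != 0.
Proof. by move=> v0; rewrite gt_eqF// rphi_gt0. Qed.

Lemma F_quadratic v : v != 0 ->
  (1 - h W W) * F v ^+ 2 + 2 * F v * h v W = h v v.
Proof.
move=> v0; have := rl_unit v0; have Fv := F_neq0 v0.
rewrite rlE !(dotBl, dotBr) !dotZl !dotZr (dotC h W v) => E.
by rewrite -{1}E; field.
Qed.

(** F phi is half the derivative of the quadratic polynomial of [F_quadratic] with respect to F,
    hence the square root of its reduced discriminant. This ties phi both to the closed formula for
    F and to its differential. *)
Lemma rphiE v : v != 0 -> F v * rphi v = (1 - h W W) * F v + h v W.
Proof.
move=> v0; have Fv := F_neq0 v0; apply: (mulfI Fv).
rewrite mulrDr [F v * ((1 - _) * _)]mulrCA -expr2.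
have -> : (1 - h W W) * F v ^+ 2 = h v v - 2 * F v * h v W.
  by rewrite -(F_quadratic v0) addrK.
rewrite rphi_def rlE !(dotBl, dotZl, dotZr) (dotC h W v); by field.
Qed.

(** Positivity of F phi selects the root. The formula serves to prove that F is smooth off the
    origin. *)
Lemma F_sqrtE v : v != 0 -> F v =
  (Num.sqrt (h v W ^+ 2 + (1 - h W W) * h v v) - h v W) / (1 - h W W).
Proof.
move=> v0; have lam : 0 < 1 - h W W by rewrite subr_gt0 (randers_wind hF).
have E : h v W ^+ 2 + (1 - h W W) * h v v = (F v * rphi v) ^+ 2.
  by rewrite rphiE// -(F_quadratic v0); ring.
rewrite E sqrtr_sqr gtr0_norm ?mulr_gt0 ?F_gt0 ?rphi_gt0// rphiE//.
by field; rewrite gt_eqF.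
Qed.

Lemma F_smooth v : v != 0 -> smooth_near v F.
Proof.
move=> v0; have lam : 0 < 1 - h W W by rewrite subr_gt0 (randers_wind hF).
have sW (f : V -> V) : smooth_near v f -> smooth_near v (fun x => h (f x) W).
  by move=> sf; apply: smooth_near_dot => //; exact: smooth_near_cst.
have sid := smooth_near_id v.
apply: (@smooth_near_eq _ _ _ _ (fun v =>
  (Num.sqrt (h v W * h v W + (1 - h W W) * h v v) - h v W) * (1 - h W W)^-1)).
  by apply: filterS (near_neq0 v0) => x x0; rewrite F_sqrtE.
apply: smooth_nearM; last exact: smooth_near_cst.
apply: smooth_nearB; last exact: sW.
apply: smooth_near_sqrt.
  by rewrite ltr_wpDl ?mulr_gt0 ?dot_gt0// -expr2 sqr_ge0.
apply: smooth_nearD; first by apply: smooth_nearM; exact: sW.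
by apply: smooth_nearM; [exact: smooth_near_cst | exact: smooth_near_dot].
Qed.

Lemma is_derive_dot (f g : R -> V) (df dg : V) (t : R) :
  is_derive t 1 f df -> is_derive t 1 g dg ->
  is_derive t 1 (fun s => h (f s) (g s)) (h (f t) dg + h df (g t)).
Proof.
by move=> Hf Hg; apply: (is_derive_bil (B := h)) => //; exact: dot_continuous.
Qed.

(** Implicit differentiation of [F_quadratic]: by [rphiE] the unknown derivative has the nonzero
    coefficient 2 F phi. *)
Lemma is_derive_F (A : R -> V) (a : V) (t : R) : A t != 0 ->
  is_derive t 1 A a ->
  is_derive t 1 (fun s => F (A s)) (dF (A t) a).
Proof.
move=> At HA.
have dFA := is_derive_comp (smooth_near_differentiable (F_smooth At)) HA.
set f' := 'D_a F _ in dFA; suff <- : f' = dF (A t) a by [].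
have AW := is_derive_dot HA (is_derive_cst W t 1).
have AA := is_derive_dot HA HA.
have cq := is_derive_mul (is_derive_cst (1 - h W W) t 1) (is_derive_mul dFA dFA).
have cr := is_derive_mul (is_derive_cst (2 : R) t 1) (is_derive_mul dFA AW).
have nq : \forall s \near t, (1 - h W W) * (F (A s) * F (A s)) +
    2 * (F (A s) * h (A s) W) = h (A s) (A s).
  apply: filterS (is_derive_near0 At HA) => s As.
  by rewrite -(F_quadratic As) expr2 !mulrA.
have cs := is_derive_near nq (is_derive_add cq cr).
have := is_derive_unique AA cs; rewrite /= dot0r add0r => E.
have ph := rphi_neq0 At; have FA := F_neq0 At.
apply: (mulfI (mulf_neq0 FA ph)); rewrite {1}rphiE//.
rewrite dF_def mulrA mulfK// rlE dotBl dotZl mulrBr mulrA mulfV// mul1r.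
move: E; rewrite (dotC h a (A t)) (dotC h a W).
move=> E; have -> : h (A t) a = (h (A t) a + h (A t) a) / 2 by field.
by rewrite E; field.
Qed.

Lemma is_derive_rl (A : R -> V) (a : V) (t : R) : A t != 0 ->
  is_derive t 1 A a ->
  is_derive t 1 (fun s => rl (A s)) ((F (A t))^-1 *: hat (A t) a).
Proof.
move=> At HA.
have FA := F_neq0 At.
have -> : (fun s => rl (A s)) = fun s => (F (A s))^-1 *: A s.
  by apply/funext => s; rewrite rlE.
apply: is_derive_eq (is_derive_scale
  (is_derive_inv (a := fun s => F (A s)) FA (is_derive_F At HA)) HA) _.
rewrite hat_def scalerBr rlE !scalerA -scaleNr; congr (_ + _ *: _).
by field.
Qed.

Lemma hat_orth v x : v != 0 -> h (rl v - W) (hat v x) = 0.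
Proof.
move=> v0; rewrite hat_def dotBr dotZr -rphi_def dF_def mulrAC mulVf ?rphi_neq0//.
by rewrite mul1r subrr.
Qed.

Lemma dF0 v : dF v 0 = 0.
Proof. by rewrite dF_def dot0r mulr0. Qed.

Lemma hat0 v : hat v 0 = 0.
Proof. by rewrite hat_def dF0 scale0r subr0. Qed.

Lemma is_derive_rphi (A : R -> V) (a : V) (t : R) : A t != 0 ->
  is_derive t 1 A a ->
  is_derive t 1 (fun s => rphi (A s))
  (h (hat (A t) a) (rl (A t)) / F (A t)).
Proof.
move=> At HA.
have lW := is_derive_sub (is_derive_rl At HA) (is_derive_cst W t 1).
have -> : (fun s => rphi (A s)) = fun s => h (rl (A s) - W) (rl (A s)).
  by apply/funext => s; rewrite rphi_def.
apply: is_derive_eq (is_derive_dot lW (is_derive_rl At HA)) _.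
by rewrite dotZr hat_orth// mulr0 add0r subr0 dotZl mulrC.
Qed.

Lemma is_derive_dF (A Y : R -> V) (a y : V) (t : R) : A t != 0 ->
  is_derive t 1 A a -> is_derive t 1 Y y ->
  is_derive t 1 (fun s => dF (A s) (Y s))
  (h (hat (A t) a) (hat (A t) (Y t)) / (F (A t) * rphi (A t)) + dF (A t) y).
Proof.
move=> At HA HY.
have FA := F_neq0 At; have ph := rphi_neq0 At.
have lW := is_derive_sub (is_derive_rl At HA) (is_derive_cst W t 1).
have -> : (fun s => dF (A s) (Y s)) = fun s => (rphi (A s))^-1 * h (rl (A s) - W) (Y s).
  by apply/funext => s; rewrite dF_def.
apply: is_derive_eq (is_derive_mul
  (is_derive_inv (a := fun s => rphi (A s)) ph (is_derive_rphi At HA))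
  (is_derive_dot lW HY)) _.
rewrite subr0 dotZl (hat_def (A t) (Y t)) dotBr dotZr !dF_def.
by field; rewrite ?FA ?ph.
Qed.

Lemma is_derive_hat (A Y : R -> V) (a y : V) (t : R) : A t != 0 ->
  is_derive t 1 A a -> is_derive t 1 Y y ->
  is_derive t 1 (fun s => hat (A s) (Y s))
  (hat (A t) y
   - (h (hat (A t) a) (hat (A t) (Y t)) / (F (A t) * rphi (A t))) *: rl (A t)
   - (dF (A t) (Y t) / F (A t)) *: hat (A t) a).
Proof.
move=> At HA HY.
have -> : (fun s => hat (A s) (Y s)) = fun s => Y s - dF (A s) (Y s) *: rl (A s).
  by apply/funext => s; rewrite hat_def.
apply: is_derive_eq (is_derive_sub HY
  (is_derive_scale (is_derive_dF At HA HY) (is_derive_rl At HA))) _.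
rewrite scalerDl scalerA (hat_def (A t) y).
move: (_ *: rl _) (_ *: rl _) (_ *: hat _ _) => u1 u2 u3.
by rewrite -!addrA; congr (_ + _); rewrite !opprD [RHS]addrA addrC [- u2 - u1]addrC.
Qed.

(** This identifies [fund] as the second derivative of F^2/2. *)
Lemma is_derive_legendre (A Y : R -> V) (a y : V) (t : R) : A t != 0 ->
  is_derive t 1 A a -> is_derive t 1 Y y ->
  is_derive t 1 (fun s => legendre (A s) (Y s))
  (fund (A t) a (Y t) + legendre (A t) y).
Proof.
move=> At HA HY.
have FA := F_neq0 At; have ph := rphi_neq0 At.
apply: is_derive_eq (is_derive_mul (is_derive_F At HA) (is_derive_dF At HA HY)) _.
rewrite /fund /legendre; by field; rewrite ?FA ?ph.
Qed.

Lemma fund_C v y z : fund v y z = fund v z y.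
Proof. by rewrite /fund mulrC dotC. Qed.

Lemma cartan_rot v x y z : cartan v x y z = cartan v y z x.
Proof.
rewrite /cartan (dotC h (hat v z) (hat v x)) (dotC h (hat v y) (hat v x)).
congr (- _ / _); ring.
Qed.

Lemma cartan_swap v x y z : cartan v x y z = cartan v x z y.
Proof.
rewrite /cartan (dotC h (hat v z) (hat v y)); congr (- _ / _); ring.
Qed.

Lemma is_derive_fund (A Y Z : R -> V) (a y z : V) (t : R) : A t != 0 ->
  is_derive t 1 A a -> is_derive t 1 Y y -> is_derive t 1 Z z ->
  is_derive t 1 (fun s => fund (A s) (Y s) (Z s))
    (2 * cartan (A t) a (Y t) (Z t) + fund (A t) y (Z t) + fund (A t) (Y t) z).
Proof.
move=> At HA HY HZ; have FA := F_neq0 At; have ph := rphi_neq0 At.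
have dY := is_derive_dF At HA HY; have dZ := is_derive_dF At HA HZ.
have hY := is_derive_hat At HA HY; have hZ := is_derive_hat At HA HZ.
have dp := is_derive_inv (a := fun s => rphi (A s)) ph (is_derive_rphi At HA).
apply: is_derive_eq (is_derive_add (is_derive_mul dY dZ)
  (is_derive_mul (is_derive_dot hY hZ) dp)) _.
rewrite /cartan /fund !(dotBl, dotBr, dotZl, dotZr).
rewrite !(dotC h (rl _)) (dotC h (hat (A t) (Y t)) (hat (A t) a)).
by field; rewrite ?FA ?ph.
Qed.

Lemma LfunE_derive (x w : V) : x != 0 ->
  derive1 (fun t : R => Defs.Lfun F (x + t *: w)) 0 = 2 * legendre x w.
Proof.
move=> x0; have l0 : x + (0 : R) *: w = x by rewrite scale0r addr0.
have x0' : x + (0 : R) *: w != 0 by rewrite l0.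
have dx := is_derive_F x0' (is_derive_line x w 0).
apply: is_derive1; rewrite /Defs.Lfun.
rewrite (_ : (fun t => _) = fun t : R => F (x + t *: w) * F (x + t *: w)).
  2: by apply/funext => s; rewrite expr2.
by apply: is_derive_eq (is_derive_mul dx dx) _; rewrite l0 /legendre; ring.
Qed.

Lemma gtenE v u w : v != 0 -> gten F v u w = fund v u w.
Proof.
move=> v0; have l0 : v + (0 : R) *: u = v by rewrite scale0r addr0.
have v0' : v + (0 : R) *: u != 0 by rewrite l0.
have dl := is_derive_line v u 0.
transitivity (2^-1 * (2 * fund v u w)); last by field.
congr (_ * _); apply: is_derive1.
apply: (@is_derive_near _ _ (fun s : R => 2 * legendre (v + s *: u) w)).
  by apply: filterS (is_derive_near0 v0' dl) => s s0; rewrite LfunE_derive.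
have dt := is_derive_legendre v0' dl (is_derive_cst w (0 : R) 1).
apply: is_derive_eq (is_derive_mul (is_derive_cst (2 : R) (0 : R) 1) dt) _.
by rewrite /= l0 mul0r addr0 legendre0 addr0.
Qed.

Lemma CtenE v u w z : v != 0 -> Cten F v u w z = cartan v u w z.
Proof.
move=> v0; have l0 : v + (0 : R) *: z = v by rewrite scale0r addr0.
have v0' : v + (0 : R) *: z != 0 by rewrite l0.
have dl := is_derive_line v z 0.
rewrite -cartan_rot; transitivity (2^-1 * (2 * cartan v z u w)); last by field.
congr (_ * _); apply: is_derive1.
apply: (@is_derive_near _ _ (fun s : R => fund (v + s *: z) u w)).
  by apply: filterS (is_derive_near0 v0' dl) => s s0; rewrite gtenE.
have dt := is_derive_fund v0' dl (is_derive_cst u (0 : R) 1) (is_derive_cst w (0 : R) 1).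
apply: is_derive_eq dt _; rewrite l0 /cst /fund.
by rewrite !(dF0, hat0) !(dot0r, dot0l, mulr0, mul0r, addr0).
Qed.

End Randers.

(** * Linear algebra of g_v on a tangent space and its normal vectors *)

Section RandersAlgebra.
Context {R : realType} {V : normedVectType R} (h : {dot V for (idfun : R -> R)}).
Context (W : V) (F : V -> R) (hF : randers_norm h W F).
Implicit Types u v x y z t : V.

Local Notation rl := (rl F).
Local Notation rphi := (rphi h W F).
Local Notation dF := (dF h W F).
Local Notation hat := (hat h W F).
Local Notation fund := (fund h W F).
Local Notation cartan := (cartan h W F).
Local Notation legendre := (legendre h W F).

Lemma dF_lin v a x y : dF v (a *: x + y) = a * dF v x + dF v y.
Proof. by rewrite !dF_def dotDr dotZr; ring. Qed.

Lemma hat_lin v a x y : hat v (a *: x + y) = a *: hat v x + hat v y.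
Proof.
rewrite !hat_def dF_lin scalerDl -scalerA opprD addrACA.
by rewrite scalerBr.
Qed.

Lemma dF_rl v : v != 0 -> dF v (rl v) = 1.
Proof. by move=> v0; rewrite dF_def -rphi_def mulVf// (rphi_neq0 hF). Qed.

Lemma rlK v : v != 0 -> F v *: rl v = v.
Proof. by move=> v0; rewrite rlE scalerA mulfV ?scale1r// (F_neq0 hF). Qed.

Lemma dF_self v : v != 0 -> dF v v = F v.
Proof.
move=> v0; rewrite -{2}(rlK v0) -[_ *: _]addr0 dF_lin dF_rl// mulr1.
by rewrite dF0 addr0.
Qed.

Lemma hat_self v : v != 0 -> hat v v = 0.
Proof. by move=> v0; rewrite hat_def dF_self// rlK// subrr. Qed.

Lemma fund_lin v a x y z : fund v (a *: x + y) z = a * fund v x z + fund v y z.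
Proof. by rewrite /fund dF_lin hat_lin dotDl dotZl; ring. Qed.

Lemma fund_D v x y z : fund v (x + y) z = fund v x z + fund v y z.
Proof. by rewrite -[x]scale1r fund_lin mul1r !scale1r. Qed.

Lemma fund_B v x y z : fund v (x - y) z = fund v x z - fund v y z.
Proof. by rewrite addrC -scaleN1r fund_lin mulN1r addrC. Qed.

Lemma cartan_lin v a x y z t : cartan v (a *: x + y) z t = a * cartan v x z t + cartan v y z t.
Proof. by rewrite /cartan hat_lin !(dotDl, dotDr, dotZl, dotZr); ring. Qed.

Lemma cartan_B v x y z t : cartan v (x - y) z t = cartan v x z t - cartan v y z t.
Proof. by rewrite addrC -scaleN1r cartan_lin mulN1r addrC. Qed.

Lemma legendre_lin v a x y : legendre v (a *: x + y) = a * legendre v x + legendre v y.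
Proof. by rewrite /legendre dF_lin; ring. Qed.

Lemma legendre_D v x y : legendre v (x + y) = legendre v x + legendre v y.
Proof. by rewrite -[x]scale1r legendre_lin mul1r !scale1r. Qed.

Lemma legendre_B v x y : legendre v (x - y) = legendre v x - legendre v y.
Proof. by rewrite addrC -scaleN1r legendre_lin mulN1r addrC. Qed.

Lemma fund_flag v x : v != 0 -> fund v x v = legendre v x.
Proof.
by move=> v0; rewrite /fund dF_self// hat_self// dot0r mul0r addr0 mulrC.
Qed.

Lemma cartan_flag v x y : v != 0 -> cartan v x y v = 0.
Proof.
by move=> v0; rewrite /cartan hat_self// dot0l !dot0r !(mul0r, mulr0, addr0) oppr0 mul0r.
Qed.

Lemma fund_eq0 v x : v != 0 -> fund v x x = 0 -> x = 0.
Proof.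
move=> v0; have ph := rphi_gt0 hF v0; rewrite /fund => /eqP.
rewrite paddr_eq0 -?expr2 ?sqr_ge0 ?divr_ge0 ?dot_ge0 ?ltW//.
rewrite sqrf_eq0 mulf_eq0 invr_eq0 [rphi v == 0]gt_eqF// orbF.
by move=> /andP[/eqP dx /eqP /dot_eq0]; rewrite hat_def dx scale0r subr0.
Qed.

Section TangentSpace.
Variables (T : set V) (w : V).
Hypothesis TB : forall a x y, T x -> T y -> T (a *: x + y).
Hypotheses (Tw : T w) (ow : forall t, T t -> h (W - w) t = 0).
Let mu := 1 - h (W - w) (W - w).

(** By Pythagoras |W - w|_h^2 is at most |W|_h^2, which is below 1. *)
Lemma mu_gt0 : 0 < mu.
Proof.
have := randers_wind hF; have := dot_ge0 h w; have := ow Tw.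
rewrite /mu !(dotBl, dotBr) (dotC h w W); lra.
Qed.

Variable (v : V).
Hypotheses (v0 : v != 0) (Tv : T v).

Lemma T0 : T 0.
Proof. by rewrite -(subrr v) addrC -scaleN1r; exact: TB. Qed.

Lemma T_rl : T (rl v).
Proof. by rewrite rlE -[_ *: _]addr0; apply: TB => //; exact: T0. Qed.

Lemma T_hat t : T t -> T (hat v t).
Proof.
by move=> Tt; rewrite hat_def addrC -scaleNr; apply: TB => //; exact: T_rl.
Qed.

Lemma rl_wind t : T t -> h (rl v - w) t = h (rl v - W) t.
Proof. by move=> /ow; rewrite !dotBl; lra. Qed.

(** Pythagoras for [rl v - W] of norm 1, with tangential part [rl v - w] and normal part [w - W]. *)
Lemma rl_wind_norm : h (rl v - w) (rl v - w) = mu.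
Proof.
have := rl_unit hF v0; have := ow Tw; have := ow T_rl.
rewrite /mu !(dotBl, dotBr) (dotC h w (rl v)) (dotC h W (rl v)) (dotC h w W); lra.
Qed.

(* The g_v-normal vector whose h-normal part is x. *)
Definition gnormal x := x + (h x W / mu) *: (rl v - w).

Section Normal.
Variables (x : V).
Hypothesis ox : forall t, T t -> h x t = 0.

Lemma gnormal_hT t : T t -> h (gnormal x) t = h x W / mu * h (rl v - W) t.
Proof. by move=> Tt; rewrite /gnormal dotDl dotZl ox// add0r rl_wind. Qed.

(** This fixes the coefficient in [gnormal]: [rl v - W] has product [- h x W] with the normal vector
    [x], and product [mu] with [rl v - w]. *)
Lemma dF_gnormal : dF v (gnormal x) = 0.
Proof.
rewrite dF_def; have -> : h (rl v - W) (gnormal x) = 0; last by rewrite mulr0.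
have Tlw : T (rl v - w) by rewrite addrC -scaleN1r; apply: TB => //; exact: T_rl.
rewrite /gnormal dotDr dotZr -(rl_wind Tlw) rl_wind_norm divfK; last first.
  by rewrite gt_eqF// mu_gt0.
by rewrite dotBl (dotC h (rl v) x) (ox T_rl) (dotC h W x) sub0r addNr.
Qed.

Lemma hat_gnormal : hat v (gnormal x) = gnormal x.
Proof. by rewrite hat_def dF_gnormal scale0r subr0. Qed.

Lemma gnormal_hat t : T t -> h (gnormal x) (hat v t) = 0.
Proof.
move=> Tt; rewrite gnormal_hT; last exact: T_hat.
by rewrite (hat_orth hF)// mulr0.
Qed.

Lemma gnormal_rl : h (gnormal x) (rl v) = h x W / mu * rphi v.
Proof. by rewrite gnormal_hT ?rphi_def//; exact: T_rl. Qed.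

(** On [T] the product with [gnormal x] is proportional to the product with [rl v - W], which
    vanishes on every [hat v t]. *)
Lemma fund_gnormal t : T t -> fund v (gnormal x) t = 0.
Proof.
move=> Tt; rewrite /fund dF_gnormal mul0r add0r hat_gnormal gnormal_hat//.
by rewrite mul0r.
Qed.

(** Of the three summands of [cartan] only the one pairing [gnormal x] with [rl v] survives, by
    [gnormal_hat]. With x = II'(v, v) this is the closed form of g_v(Q(y, z), v). *)
Lemma cartan_gnormal y z : T y -> T z -> cartan v (gnormal x) y z =
  - (h x W / (2 * F v * rphi v * mu)) * h (hat v y) (hat v z).
Proof.
move=> Ty Tz; rewrite /cartan hat_gnormal gnormal_rl !gnormal_hat// !mulr0 !addr0.
have Fv := F_neq0 hF v0; have ph := rphi_neq0 hF v0.
have mu0 : mu != 0 by rewrite gt_eqF// mu_gt0.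
by field; rewrite ?mu0 ?ph ?Fv.
Qed.

End Normal.

Lemma gnormal_dot x y : (forall t, T t -> h x t = 0) -> (forall t, T t -> h y t = 0) ->
  h (gnormal x) (gnormal y) = h x y + h x W * h y W / mu.
Proof.
move=> ox oy; have mu0 : mu != 0 by rewrite gt_eqF// mu_gt0.
have Tlw : T (rl v - w) by rewrite addrC -scaleN1r; apply: TB => //; exact: T_rl.
have := ox _ Tlw; have := oy _ Tlw; have := rl_wind_norm; rewrite /gnormal.
move: (rl v - w) mu0 => d mu0 dd yd xd; rewrite !(dotDl, dotZl) !(dotDr, dotZr).
by rewrite dd (dotC h d y) xd yd; field.
Qed.

(** The difference lies in [T] and is g_v-orthogonal to [T], so positive definiteness kills it. *)
Lemma gnormal_unique n x : (forall t, T t -> h x t = 0) -> T (n - x) ->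
  (forall t, T t -> fund v n t = 0) -> n = gnormal x.
Proof.
move=> ox Tnx gn; apply/subr0_eq/(fund_eq0 v0).
have Td : T (n - gnormal x).
  rewrite /gnormal opprD addrA addrC -scaleNr; apply: TB => //.
  by rewrite addrC -scaleN1r; apply: TB => //; exact: T_rl.
by rewrite fund_B gn// fund_gnormal// subrr.
Qed.

End TangentSpace.

End RandersAlgebra.

Section RandersSmooth.
Context {R : realType} {V : normedVectType R} (h : {dot V for (idfun : R -> R)}).
Context (W : V) (F : V -> R) (hF : randers_norm h W F).
Context (S : set V).
Implicit Types A X Y Z : V -> V.

Lemma smooth_at_F p A : S p -> A p != 0 -> smooth_at S p A ->
  smooth_at S p (fun q => F (A q)).
Proof.
move=> Sp A0 sA.
exact: (smooth_at_comp_near (g := F) (fin_coord_vect V) Sp sA (F_smooth hF A0)).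
Qed.

Lemma smooth_atV p (f : V -> R) : S p -> f p != 0 -> smooth_at S p f ->
  smooth_at S p (fun q => (f q)^-1).
Proof.
move=> Sp f0 sf.
exact: (smooth_at_comp_near (f := f) (g := @GRing.inv R) fin_coord_R Sp sf
  (smooth_near_inv f0)).
Qed.

Lemma smooth_atM p (f g : V -> R) : smooth_at S p f -> smooth_at S p g ->
  smooth_at S p (fun q => f q * g q).
Proof. by apply: (smooth_at_bil (B := *%R)) => ?; exact: mul_continuous. Qed.

Lemma smooth_at_fund p A Y Z : S p -> A p != 0 -> smooth_at S p A ->
  smooth_at S p Y -> smooth_at S p Z ->
  smooth_at S p (fun q => fund h W F (A q) (Y q) (Z q)).
Proof.
move=> Sp A0 sA sY sZ; have ph := rphi_neq0 hF A0; have FA := F_neq0 hF A0.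
have sl : smooth_at S p (fun q => rl F (A q)).
  rewrite (_ : (fun q => _) = fun q => (F (A q))^-1 *: A q).
    by apply: smooth_atZ => //; apply: smooth_atV => //; exact: smooth_at_F.
  by apply/funext => q; rewrite rlE.
have slW : smooth_at S p (fun q => rl F (A q) - W).
  by apply: smooth_atB => //; exact: smooth_at_cst.
have sp : smooth_at S p (fun q => (rphi h W F (A q))^-1).
  apply: smooth_atV => //.
  rewrite (_ : (fun q => _) = fun q => h (rl F (A q) - W) (rl F (A q))).
    exact: smooth_at_dot.
  by apply/funext => q; rewrite rphi_def.
have sd X : smooth_at S p X -> smooth_at S p (fun q => dF h W F (A q) (X q)).
  move=> sX; rewrite (_ : (fun q => _) = fun q => (rphi h W F (A q))^-1 * h (rl F (A q) - W) (X q)).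
    by apply: smooth_atM => //; exact: smooth_at_dot.
  by apply/funext => q; rewrite dF_def.
have sh X : smooth_at S p X -> smooth_at S p (fun q => hat h W F (A q) (X q)).
  move=> sX; rewrite (_ : (fun q => _) = fun q => X q - dF h W F (A q) (X q) *: rl F (A q)).
    by apply: smooth_atB => //; apply: smooth_atZ => //; exact: sd.
  by apply/funext => q; rewrite hat_def.
apply: smooth_atD; first by apply: smooth_atM; exact: sd.
by apply: smooth_atM => //; apply: smooth_at_dot; exact: sh.
Qed.

Lemma near_vfield_neq0 p A : smooth_at S p A -> S p -> A p != 0 ->
  \forall q \near p, S q -> A q != 0.
Proof.
move=> [A' HA] Sp A0; have [sA AA] := HA.
rewrite (smooth_ext_val Sp HA) in A0.
have cA := differentiable_continuous (smooth_near_differentiable sA).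
have nA : \forall q \near p, A' q != 0 := cA _ (near_neq0 A0).
by apply: filterS2 nA AA => q A'q AAq Sq; rewrite AAq.
Qed.

Lemma dS_gten p x A Y Z : S p -> A p != 0 -> smooth_at S p A ->
  smooth_at S p Y -> smooth_at S p Z -> tangent S p x ->
  dS S (fun q => gten F (A q) (Y q) (Z q)) p x =
    2 * cartan h W F (A p) (dS S A p x) (Y p) (Z p)
    + fund h W F (A p) (dS S Y p x) (Z p) + fund h W F (A p) (Y p) (dS S Z p x).
Proof.
move=> Sp A0 sA sY sZ tx; have sg := smooth_at_fund Sp A0 sA sY sZ.
have gE : \forall q \near p, S q ->
    fund h W F (A q) (Y q) (Z q) = gten F (A q) (Y q) (Z q).
  by apply: filterS (near_vfield_neq0 sA Sp A0) => q Aq Sq; rewrite (gtenE hF)// Aq.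
apply: (etrans (esym (dS_eq sg tx gE))); have [c Hc] := tx.
have c0 : c 0 = p by case: Hc.
have Ac : A (c 0) != 0 by rewrite c0.
have := is_derive_fund hF Ac (dS_curve sA Hc) (dS_curve sY Hc) (dS_curve sZ Hc).
by move=> /(is_derive_unique (dS_curve sg Hc)); rewrite /= c0.
Qed.

End RandersSmooth.

(** * The Chern connection *)

Section ChernConnection.
Context {R : realType} {V : normedVectType R} (h : {dot V for (idfun : R -> R)}).
Context (W : V) (F : V -> R) (hF : randers_norm h W F).
Context (m : nat) (S : set V) (hS : submanifold m S).
Context (nabla : V -> V -> V -> (V -> V) -> V) (hnabla : chern_connection S F nabla).
Implicit Types (p q x y t v : V) (A X Y Z T : V -> V).

Local Notation rl := (rl F).
Local Notation rphi := (rphi h W F).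
Local Notation dF := (dF h W F).
Local Notation hat := (hat h W F).
Local Notation fund := (fund h W F).
Local Notation cartan := (cartan h W F).
Local Notation legendre := (legendre h W F).

Let hac := chern_ac hnabla.

(* The flat minus the Chern connection: a V-valued second fundamental form of
   S for F, symmetric but not normal. *)
Definition Qten A X Y q : V := dS S Y q (X q) - nabla q (A q) (X q) Y.

Section AtPoint.
Variables (q : V) (A : V -> V).
Hypotheses (Sq : S q) (A0 : A q != 0) (vA : vfield S q A).
Let v := A q.
Local Notation Q := (Qten A).

Lemma slit_vfield : slitTS S (q, A q).
Proof. by split => //; exact: vfield_tangent. Qed.

Lemma nabla_tangent X Y : vfield S q X -> vfield S q Y ->
  tangent S q (nabla q v (X q) Y).
Proof.
move=> vX vY; apply: (ac_tangent hac slit_vfield) => //.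
exact: vfield_tangent.
Qed.

Lemma Q_sym X Y : vfield S q X -> vfield S q Y -> Q X Y q = Q Y X q.
Proof.
move=> vX vY; apply/subr0_eq; rewrite /Qten subrACA.
by rewrite (chern_torsion_free hnabla Sq A0 vA vX vY) subrr.
Qed.

(** The flat derivative of g along the fields obeys the product rule [dS_gten], and the Chern
    connection obeys the same rule with [nabla] for D. Subtracting leaves an algebraic relation in
    Q. *)
Lemma Q_compat X Y Z : vfield S q X -> vfield S q Y -> vfield S q Z ->
  fund v (Q X Y q) (Z q) + fund v (Q X Z q) (Y q) + 2 * cartan v (Q X A q) (Y q) (Z q) = 0.
Proof.
move=> vX vY vZ; have tX := vfield_tangent Sq vX.
have E := chern_compat hnabla Sq A0 vA vX vY vZ.
have D := dS_gten hF Sq A0 (vfield_smooth vA) (vfield_smooth vY) (vfield_smooth vZ) tX.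
have {E D} := etrans (esym D) E.
rewrite !(gtenE hF) // (CtenE hF) // /Qten !fund_B cartan_B.
rewrite !(fund_C h W F (A q) (Y q)) -/v.
move: (fund v _ _) (fund v _ _) (fund v _ _) (fund v _ _) (cartan v _ _ _) (cartan v _ _ _).
by move=> *; lra.
Qed.

(** With Y = Z = A the Cartan term vanishes, and compatibility reduces to twice this value being
    zero. *)
Lemma Q_flag X : vfield S q X -> legendre v (Q X A q) = 0.
Proof.
move=> vX; have := Q_compat vX vA vA; rewrite cartan_flag// !fund_flag//.
by move: (legendre v _) => r; lra.
Qed.

Lemma fund_Q X T : vfield S q X -> vfield S q T ->
  fund v (Q X A q) (T q) = - legendre v (Q X T q).
Proof.
move=> vX vT; have := Q_compat vX vA vT; rewrite cartan_swap cartan_flag// fund_flag//.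
by move: (fund v _ _) (legendre v _) => r s; lra.
Qed.

Lemma fund_QAA T : vfield S q T -> fund v (Q A A q) (T q) = 0.
Proof. by move=> vT; rewrite fund_Q// Q_sym// Q_flag// oppr0. Qed.

(** Compatibility in the direction of the flagpole: by symmetry and [fund_Q] each metric term is
    [- legendre v (Q X T q)], which leaves the Cartan term. *)
Lemma legendre_Q X T : vfield S q X -> vfield S q T ->
  legendre v (Q X T q) = cartan v (Q A A q) (X q) (T q).
Proof.
move=> vX vT; have := Q_compat vA vX vT.
rewrite (Q_sym vA vX) (Q_sym vA vT) (fund_Q vX vT) (fund_Q vT vX) (Q_sym vT vX).
by move: (cartan v _ _ _) (legendre v _) => r s; lra.
Qed.

Lemma Q_tangent_part X Y : vfield S q X -> vfield S q Y ->
  tangent S q (Q X Y q - normal_part h S q (dS S Y q (X q))).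
Proof.
move=> vX vY; rewrite /Qten /normal_part opprB addrC addrA subrK.
by apply: (tangentB hS); [exact: (hproj_tangent h hS _ Sq) | exact: nabla_tangent].
Qed.

End AtPoint.

Lemma vfield_nabla p A X Y : S p -> A p != 0 -> vfield S p A -> vfield S p X ->
  vfield S p Y -> vfield S p (fun q => nabla q (A q) (X q) Y).
Proof.
move=> Sp A0 vA vX vY.
have near_slit : \forall q \near p, S q -> slitTS S (q, A q).
  apply: filterS2 (near_vfield_neq0 (vfield_smooth vA) Sp A0) (vfield_near vA).
  by move=> q Aq vAq Sq; apply: slit_vfield => //; [exact: Aq | exact: vAq].
split.
  have sqA : smooth_at S p (fun q => (q, A q)).
    apply: smooth_at_pair (vfield_smooth vA).
    exact/smooth_near_at/smooth_near_id.
  have fVV := fin_coord_prod (fin_coord_vect V) (fin_coord_vect V).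
  have sn := ac_smooth hac (slit_vfield Sp A0 vA) vX vY.
  exact: (smooth_at_comp fVV Sp near_slit sqA sn).
apply: filterS (filterI near_slit (filterI (vfield_near vX) (vfield_near vY))).
move=> q [slq [vXq vYq]] Sq; apply: (ac_tangent hac (slq Sq)); last exact: vYq.
by apply: vfield_tangent => //; exact: vXq.
Qed.

Lemma Q_smooth p A X Y : S p -> A p != 0 -> vfield S p A -> vfield S p X ->
  vfield S p Y -> smooth_at S p (Qten A X Y).
Proof.
move=> Sp A0 vA vX vY; apply: smooth_atB.
  exact: dS_smooth (vfield_smooth vY).
exact: vfield_smooth (vfield_nabla Sp A0 vA vX vY).
Qed.

(** The line v + s z stays in the slit tangent space for small s, so the smoothness axiom makes the
    [derive1] in [Pten] a genuine derivative. *)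
Lemma is_derive_Pten p v x z Y : S p -> v != 0 -> tangent S p v ->
  tangent S p x -> tangent S p z -> vfield S p Y ->
  is_derive (0 : R) 1 (fun s => nabla p (v + s *: z) x Y) (Pten nabla p v x Y z).
Proof.
move=> Sp v0 tv tx tz vY; have [vX Xp] := ext_spec h hS tx.
have sl : smooth_near (0 : R) (fun s : R => v + s *: z).
  apply: smooth_nearD; first exact: smooth_near_cst.
  by apply: smooth_nearZ; [exact: smooth_near_id | exact: smooth_near_cst].
have sl2 : smooth_at setT (0 : R) (fun s : R => (p, v + s *: z)).
  apply: smooth_near_at; apply: smooth_near_pair sl; exact: smooth_near_cst.
have l0 : v + (0 : R) *: z = v by rewrite scale0r addr0.
have l0' : v + (0 : R) *: z != 0 by rewrite l0.
have near_slit : \forall s \near (0 : R), setT s -> slitTS S (p, v + s *: z).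
  apply: filterS (is_derive_near0 l0' (is_derive_line v z 0)) => s s0 _; split=> //.
  by apply: (tangentD hS) => //; exact: (tangentZ hS).
have fVV := fin_coord_prod (fin_coord_vect V) (fin_coord_vect V).
have slp : slitTS S (p, v) by split.
have sn := ac_smooth hac slp vX vY.
have sn0 : smooth_at (slitTS S) (p, v + (0 : R) *: z)
    (fun z : V * V => nabla z.1 z.2 (ext S p x z.1) Y) by rewrite l0.
have := smooth_at_comp fVV (I : setT (0 : R)) near_slit sl2 sn0.
rewrite /comp /= Xp => /smooth_at_setT/smooth_near_differentiable/derivable1_diffP ds.
by rewrite /Pten derive1E; exact: derivableP.
Qed.

Lemma legendre_curvature_terms v a b c d n1 n2 n3 : legendre v (n1 - n2 - n3) =
  legendre v (c - b) - legendre v (d - a) - legendre v (a - n1) + legendre v (b - n2) + legendre v (d - c - n3).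
Proof. by rewrite !legendre_B; ring. Qed.

(** Writing each [nabla] as D - Q and using [dS_commutator] for the flat part leaves derivatives of
    Q, Q applied to covariant derivatives, and one term for the bracket. *)
Lemma legendre_affine_curv p A X Y Z : S p -> A p != 0 -> vfield S p A -> vfield S p X ->
  vfield S p Y -> vfield S p Z -> tangent S p (lie S X Y p) ->
  legendre (A p) (affine_curv S nabla A X Y Z p) =
    legendre (A p) (dS S (Qten A X Z) p (Y p)) - legendre (A p) (dS S (Qten A Y Z) p (X p))
    - legendre (A p) (Qten A X (fun q => nabla q (A q) (Y q) Z) p)
    + legendre (A p) (Qten A Y (fun q => nabla q (A q) (X q) Z) p)
    + legendre (A p) (dS S Z p (lie S X Y p) - nabla p (A p) (lie S X Y p) Z).
Proof.
move=> Sp A0 vA vX vY vZ tl.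
have tX := vfield_tangent Sp vX; have tY := vfield_tangent Sp vY.
have sZ := vfield_smooth vZ.
have E1 : dS S (Qten A X Z) p (Y p) = dS S (fun q => dS S Z q (X q)) p (Y p)
    - dS S (fun q => nabla q (A q) (X q) Z) p (Y p).
  by apply: dSB => //; [exact: dS_smooth | exact/vfield_smooth/vfield_nabla].
have E2 : dS S (Qten A Y Z) p (X p) = dS S (fun q => dS S Z q (Y q)) p (X p)
    - dS S (fun q => nabla q (A q) (Y q) Z) p (X p).
  by apply: dSB => //; [exact: dS_smooth | exact/vfield_smooth/vfield_nabla].
have E3 := dS_commutator Sp vX vY sZ tl.
rewrite -E3 E1 E2; exact: legendre_curvature_terms.
Qed.

End ChernConnection.

(** * Closed forms for Q *)

Section ExplicitChern.
Context {R : realType} {V : normedVectType R} (h : {dot V for (idfun : R -> R)}).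
Context (W : V) (F : V -> R) (hF : randers_norm h W F).
Context (m : nat) (S : set V) (hS : submanifold m S).
Context (nabla : V -> V -> V -> (V -> V) -> V) (hnabla : chern_connection S F nabla).
Context (nb : V -> V -> (V -> V) -> V) (hnb : levi_civita h S nb).
Implicit Types (p q x y z t v : V) (A X Y Z T : V -> V).

Local Notation rl := (rl F).
Local Notation rphi := (rphi h W F).
Local Notation dF := (dF h W F).
Local Notation hat := (hat h W F).
Local Notation fund := (fund h W F).
Local Notation cartan := (cartan h W F).
Local Notation legendre := (legendre h W F).
Local Notation II := (II h S).
Local Notation IIv := (IIv h S).
Local Notation Q := (Qten S nabla).

Definition wind q := hproj h (tangent S q) W.
Definition mu q := 1 - h (W - wind q) (W - wind q).
Local Notation gn q := (gnormal h W F (wind q)).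

Lemma tangent_lin q (a : R) x y : tangent S q x -> tangent S q y ->
  tangent S q (a *: x + y).
Proof. by move=> tx ty; apply: (tangentD hS) => //; exact: (tangentZ hS). Qed.

Lemma wind_tangent q : S q -> tangent S q (wind q).
Proof. exact: (hproj_tangent h hS W). Qed.

Lemma wind_orth q : S q -> forall t, tangent S q t -> h (W - wind q) t = 0.
Proof. by move=> Sq; have [] := hprojP h hS W Sq. Qed.

Lemma mu_neq0 q : S q -> mu q != 0.
Proof.
by move=> Sq; rewrite gt_eqF// (mu_gt0 hF (wind_tangent Sq) (wind_orth Sq)).
Qed.

Lemma dF_hat v x : v != 0 -> dF v (hat v x) = 0.
Proof. by move=> v0; rewrite dF_def (hat_orth hF)// mulr0. Qed.

Lemma hat_hat v x : v != 0 -> hat v (hat v x) = hat v x.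
Proof. by move=> v0; rewrite [LHS]hat_def dF_hat// scale0r subr0. Qed.

Section AtPoint.
Variables (q : V) (A : V -> V).
Hypotheses (Sq : S q) (A0 : A q != 0) (vA : vfield S q A).

Lemma Q_flag_flag : Q A A A q = gn q (A q) (II A A q).
Proof.
have tA := vfield_tangent Sq vA.
apply: (gnormal_unique hF (@tangent_lin q) (wind_tangent Sq) (wind_orth Sq) A0 tA).
- by move=> t tt; exact: (II_normal h hS).
- exact: (Q_tangent_part h hS hnabla Sq A0 vA vA vA).
- move=> t tt; have [vT <-] := ext_spec h hS tt.
  exact: (fund_QAA hF hnabla).
Qed.

Lemma legendre_QE X Y : vfield S q X -> vfield S q Y -> legendre (A q) (Q A X Y q) =
  - (h (II A A q) W / (2 * F (A q) * rphi (A q) * mu q))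
  * h (hat (A q) (X q)) (hat (A q) (Y q)).
Proof.
move=> vX vY; have tA := vfield_tangent Sq vA.
rewrite (legendre_Q hF hnabla Sq A0 vA vX vY) Q_flag_flag.
apply: (cartan_gnormal hF (@tangent_lin q) (wind_tangent Sq) (wind_orth Sq) A0 tA).
- by move=> t tt; exact: (II_normal h hS).
- exact: vfield_tangent.
- exact: vfield_tangent.
Qed.

(** Both sides have the same h-normal part, so their difference [D] is tangent, and it suffices to
    compare products with tangent vectors. There [fund_Q] and [legendre_QE] give the left side; the
    coefficient of [hat] is chosen to match, a factor phi being absorbed by [fund] on ker dF. *)
Lemma Q_flagE X : vfield S q X -> Q A X A q = gn q (A q) (II X A q)
  + (h (II A A q) W / (2 * F (A q) * mu q)) *: hat (A q) (X q).
Proof.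
move=> vX; have tA := vfield_tangent Sq vA; have tX := vfield_tangent Sq vX.
have tl : tangent S q (rl (A q) - wind q).
  apply: (tangentB hS); last exact: wind_tangent.
  by rewrite rlE; exact: (tangentZ hS).
have tH : tangent S q (hat (A q) (X q)) by exact: (T_hat h W F (@tangent_lin q)).
set c := h (II A A q) W / _.
have oII t : tangent S q t -> h (II X A q) t = 0 by exact: (II_normal h hS).
have td : tangent S q (Q A X A q - (gn q (A q) (II X A q) + c *: hat (A q) (X q))).
  rewrite opprD addrA; apply: (tangentB hS); last exact: (tangentZ hS).
  rewrite /gnormal opprD addrA; apply: (tangentB hS); last exact: (tangentZ hS).
  exact: (Q_tangent_part h hS hnabla Sq A0 vA vX vA).
apply/subr0_eq/(fund_eq0 hF A0); move: td; set D := _ - (_ + _) => td.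
have [vD Dq] := ext_spec h hS td; rewrite -{2}Dq.
have gG := fund_gnormal hF (@tangent_lin q) (wind_tangent Sq) (wind_orth Sq) A0 tA oII.
have {}gG : fund (A q) (gn q (A q) (II X A q)) (ext S q D q) = 0 by apply: gG; rewrite Dq.
move: (ext S q D) vD gG {Dq} => D' vD gG.
rewrite /D (fund_B h W F (A q) (Q A X A q)) (fund_D h W F (A q) (gn q (A q) (II X A q))).
rewrite gG add0r -[_ *: hat _ _]addr0 fund_lin.
rewrite (fund_Q hF hnabla Sq A0 vA vX vD) (legendre_QE vX vD) /fund.
rewrite dF_hat// hat_hat// dF0 hat0 dot0l !mul0r add0r !addr0 /c.
move: (h (hat _ _) _) (h (II A A q) W) (F_neq0 hF A0) (rphi_neq0 hF A0) (mu_neq0 Sq).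
move: (F (A q)) (rphi (A q)) (mu q) => f ph mu0 k o f0 ph0 m0.
by field; rewrite ?f0 ?ph0 ?m0.
Qed.

End AtPoint.

(** Only the number [legendre (Q X Y)] is known in closed form. Its derivative [dl] along the curve
    consists of the derivative of the vector Q and, by [is_derive_legendre], a [fund] term for the
    change of the flagpole. *)
Lemma legendre_dS_Q p A X Y x (c : R -> V) (dl : R) : S p -> A p != 0 -> vfield S p A ->
  vfield S p X -> vfield S p Y -> curve_in S p x c ->
  is_derive (0 : R) 1 (fun s => - (h (II A A (c s)) W
      / (2 * F (A (c s)) * rphi (A (c s)) * mu (c s)))
    * h (hat (A (c s)) (X (c s))) (hat (A (c s)) (Y (c s)))) dl ->
  legendre (A p) (dS S (Q A X Y) p x) = dl - fund (A p) (dS S A p x) (Q A X Y p).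
Proof.
move=> Sp A0 vA vX vY Hc Hl; have c0 : c 0 = p by case: Hc.
have sQ := Q_smooth hnabla Sp A0 vA vX vY.
have Ac : A (c 0) != 0 by rewrite c0.
have Hth := is_derive_legendre hF Ac (dS_curve (vfield_smooth vA) Hc) (dS_curve sQ Hc).
have nQ : \forall q \near p, S q ->
    [/\ S q, A q != 0, vfield S q A, vfield S q X & vfield S q Y].
  apply: filterS (filterI (near_vfield_neq0 (vfield_smooth vA) Sp A0)
    (filterI (vfield_near vA) (filterI (vfield_near vX) (vfield_near vY)))).
  by move=> q [Aq [vAq [vXq vYq]]] Sq; split; [|exact: Aq|exact: vAq|exact: vXq|exact: vYq].
have nE : \forall s \near (0 : R), - (h (II A A (c s)) W
      / (2 * F (A (c s)) * rphi (A (c s)) * mu (c s)))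
    * h (hat (A (c s)) (X (c s))) (hat (A (c s)) (Y (c s))) =
    legendre (A (c s)) (Q A X Y (c s)).
  apply: filterS (near_curve Hc nQ) => s [Scs Acs vAs vXs vYs].
  by rewrite (legendre_QE Scs Acs vAs vXs vYs).
have := is_derive_unique Hth (is_derive_near nE Hl); rewrite /= c0 => <-.
by rewrite addrC addKr.
Qed.

(** The vertical counterpart of [legendre_dS_Q]: D does not depend on the flagpole, so on the line v
    + s z the connection D - Q varies through Q alone. *)
Lemma legendre_Pten p v x z Y (dl : R) : S p -> v != 0 -> tangent S p v ->
  tangent S p x -> tangent S p z -> vfield S p Y ->
  is_derive (0 : R) 1 (fun s => - (h (IIv p (v + s *: z) (v + s *: z)) W
      / (2 * F (v + s *: z) * rphi (v + s *: z) * mu p))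
    * h (hat (v + s *: z) x) (hat (v + s *: z) (Y p))) dl ->
  legendre v (Pten nabla p v x Y z) = fund v z (dS S Y p x - nabla p v x Y) - dl.
Proof.
move=> Sp v0 tv tx tz vY Hl; have l0 : v + (0 : R) *: z = v by rewrite scale0r addr0.
have v0' : v + (0 : R) *: z != 0 by rewrite l0.
have dl0 := is_derive_line v z 0.
have H1 := is_derive_legendre hF v0' dl0 (is_derive_Pten h hS hnabla Sp v0 tv tx tz vY).
have H2 := is_derive_legendre hF v0' dl0 (is_derive_cst (dS S Y p x) (0 : R) 1).
have H3 := is_derive_sub H2 Hl.
have [vX Xp] := ext_spec h hS tx.
have nE : \forall s \near (0 : R),
    legendre (v + s *: z) (cst (dS S Y p x) s) - - (h (IIv p (v + s *: z) (v + s *: z)) W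
      / (2 * F (v + s *: z) * rphi (v + s *: z) * mu p))
    * h (hat (v + s *: z) x) (hat (v + s *: z) (Y p)) =
    legendre (v + s *: z) (nabla p (v + s *: z) x Y).
  apply: filterS (is_derive_near0 v0' dl0) => s s0.
  have tvs : tangent S p (v + s *: z) by rewrite addrC; exact: tangent_lin.
  have [vA Ap] := ext_spec h hS tvs.
  have A0 : ext S p (v + s *: z) p != 0 by rewrite Ap.
  have := legendre_QE Sp A0 vA vX vY.
  rewrite (II_IIv hS hnb Sp vA vA) /Qten Ap Xp legendre_B => <-.
  by rewrite opprB addrC subrK.
have E : fund v z (nabla p v x Y) + legendre v (Pten nabla p v x Y z) =
    fund v z (dS S Y p x) - dl.
  by have := is_derive_unique H1 (is_derive_near nE H3); rewrite /= l0 legendre0 addr0.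
rewrite (fund_C h W F v z (_ - _)) fund_B (fund_C h W F v (dS S Y p x) z).
by rewrite (fund_C h W F v (nabla p v x Y) z) addrAC -E addrC addKr.
Qed.

End ExplicitChern.

(** * The numerator of the flag curvature *)

Section Numerator.
Context {R : realType} {V : normedVectType R} (h : {dot V for (idfun : R -> R)}).
Context (W : V) (F : V -> R) (hF : randers_norm h W F).
Context (m : nat) (S : set V) (hS : submanifold m S).
Context (nabla : V -> V -> V -> (V -> V) -> V) (hnabla : chern_connection S F nabla).
Context (nb : V -> V -> (V -> V) -> V) (hnb : levi_civita h S nb).
Implicit Types (p q x y z t v : V) (A X Y Z T : V -> V).

Local Notation rl := (rl F).
Local Notation rphi := (rphi h W F).
Local Notation dF := (dF h W F).
Local Notation hat := (hat h W F).
Local Notation fund := (fund h W F).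
Local Notation legendre := (legendre h W F).
Local Notation II := (II h S).
Local Notation IIv := (IIv h S).
Local Notation Q := (Qten S nabla).
Local Notation wind := (wind h W S).
Local Notation mu := (mu h W S).

Lemma is_derive_coef (om f ph mu : R -> R) (om' f' ph' mu' : R) :
  f 0 != 0 -> ph 0 != 0 -> mu 0 != 0 ->
  is_derive (0 : R) 1 om om' -> is_derive (0 : R) 1 f f' ->
  is_derive (0 : R) 1 ph ph' -> is_derive (0 : R) 1 mu mu' ->
  is_derive (0 : R) 1 (fun s => - (om s / (2 * f s * ph s * mu s)))
    (om 0 / (2 * f 0 * ph 0 * mu 0) * (f' / f 0 + ph' / ph 0 + mu' / mu 0)
     - om' / (2 * f 0 * ph 0 * mu 0)).
Proof.
move=> f0 p0 m0 Ho Hf Hp Hm.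
have Hd := is_derive_mul (is_derive_mul
  (is_derive_mul (is_derive_cst (2 : R) (0 : R) 1) Hf) Hp) Hm.
have d0 : cst (2 : R) (0 : R) * f 0 * ph 0 * mu 0 != 0.
  by rewrite !mulf_neq0//= pnatr_eq0.
have Hi := is_derive_inv (a := fun s => cst 2 s * f s * ph s * mu s) d0 Hd.
apply: is_derive_eq (is_deriveN (is_derive_mul Ho Hi)) _.
by rewrite /=; field; rewrite ?f0 ?p0 ?m0.
Qed.

Lemma is_derive_hat_norm (A Y : R -> V) (a y : V) (t : R) : A t != 0 ->
  is_derive t 1 A a -> is_derive t 1 Y y ->
  is_derive t 1 (fun s => h (hat (A s) (Y s)) (hat (A s) (Y s)))
    (2 * (h (hat (A t) y) (hat (A t) (Y t))
       - h (hat (A t) a) (hat (A t) (Y t))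
         * (h (rl (A t)) (hat (A t) (Y t)) / (F (A t) * rphi (A t))
            + dF (A t) (Y t) / F (A t)))).
Proof.
move=> At HA HY; have Hh := is_derive_hat hF At HA HY.
apply: is_derive_eq (is_derive_dot h Hh Hh) _.
rewrite dotC; move: (hat (A t) (Y t)) (hat (A t) y) (hat (A t) a) (rl (A t)).
by move=> u1 u2 u3 u4; rewrite !(dotBl, dotZl); ring.
Qed.

Lemma IIv0 p z : tangent S p z -> IIv p 0 z = 0.
Proof.
move=> tz; have t0 := tangent0 hS (tangentS tz).
by have := IIv_lin h hS (-1) t0 t0 tz; rewrite scaler0 addr0 scaleN1r addNr.
Qed.

Lemma is_derive_quadratic (a b c : R) :
  is_derive (0 : R) 1 (fun s => a + (s * (2 * b) + s * (s * c))) (2 * b).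
Proof.
have Hid := is_derive_id (0 : R) 1.
apply: is_derive_eq (is_derive_add (is_derive_cst a (0 : R) 1) (is_derive_add
  (is_derive_mul Hid (is_derive_cst (2 * b) (0 : R) 1))
  (is_derive_mul Hid (is_derive_mul Hid (is_derive_cst c (0 : R) 1))))) _.
by rewrite /=; ring.
Qed.

(** On the line the quadratic form omega is a polynomial of degree two in s. *)
Lemma is_derive_II_line p v z : tangent S p v -> tangent S p z ->
  is_derive (0 : R) 1 (fun s => h (IIv p (v + s *: z) (v + s *: z)) W)
    (2 * h (IIv p z v) W).
Proof.
move=> tv tz; rewrite (_ : (fun s => _) = fun s => h (IIv p v v) W
    + (s * (2 * h (IIv p z v) W) + s * (s * h (IIv p z z) W))).
  exact: is_derive_quadratic.
apply/funext => s; have tvs : tangent S p (v + s *: z).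
  by rewrite addrC; exact: (tangent_lin hS).
rewrite [v + _]addrC in tvs *; rewrite (IIv_lin h hS s tz tv tvs).
rewrite (IIvC hS hnb tz tvs) (IIvC hS hnb tv tvs).
rewrite (IIv_lin h hS s tz tv tz) (IIv_lin h hS s tz tv tv) (IIvC hS hnb tv tz).
by move: (IIv p z z) (IIv p z v) (IIv p v v) => *; rewrite !(dotDl, dotZl); ring.
Qed.

(** The factor [hat (v + s *: z) v] vanishes at s = 0 with derivative [- hat v z], so this
    derivative gives the whole result. *)
Lemma is_derive_flag_product (cf : R -> R) (cf' : R) v z y : v != 0 ->
  is_derive (0 : R) 1 cf cf' ->
  is_derive (0 : R) 1
    (fun s => cf s * h (hat (v + s *: z) v) (hat (v + s *: z) y))
    (- cf 0 * h (hat v z) (hat v y)).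
Proof.
move=> v0 Hc; have l0 : v + (0 : R) *: z = v by rewrite scale0r addr0.
have v0' : v + (0 : R) *: z != 0 by rewrite l0.
have hl x := is_derive_hat hF v0' (is_derive_line v z 0) (is_derive_cst x (0 : R) 1).
have Hd := is_derive_mul Hc (is_derive_dot h (hl v) (hl y)).
apply: is_derive_eq Hd _; rewrite /cst l0 (hat_self hF v0) (dF_self hF v0) hat0.
rewrite !dot0l !dot0r mul0r scale0r subr0 divff ?(F_neq0 hF)// scale1r sub0r dotNl.
by rewrite add0r mulr0 addr0 mulrN mulNr.
Qed.

Lemma hat_D v x y : hat v (x + y) = hat v x + hat v y.
Proof. by rewrite -[x]scale1r hat_lin !scale1r. Qed.

Lemma hat_B v x y : hat v (x - y) = hat v x - hat v y.
Proof. by rewrite addrC -scaleN1r hat_lin scaleN1r addrC. Qed.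

Lemma dF_D v x y : dF v (x + y) = dF v x + dF v y.
Proof. by rewrite -[x]scale1r dF_lin mul1r !scale1r. Qed.

(** Here [a], [b], [c] stand for nabla_A A, nabla_U A, nabla_A U, and [n], [e], [Qu] for Q(A, A),
    Q(U, A), Q(U, U). The vertical terms [q1], [q2] remove all explicit products with [a] and
    [b]. *)
Lemma numerator_terms v a b c n e DA Qu (kap kap' Num taff t1 t2 t3 t4 t5 q1 q2
    dlc dla : R) u x1 x2 L :
  Num = taff - q1 + q2 -> taff = t1 - t2 - t3 + t4 + t5 ->
  t1 = - fund v (b + e) e -> t2 = dlc - fund v DA Qu -> t3 = 0 ->
  t4 = - kap * h (hat v u) (hat v c) -> t5 = - kap * h (hat v L) (hat v u) ->
  q1 = fund v a x1 - dla -> q2 = fund v b x2 - - - kap' * h (hat v b) (hat v u) ->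
  DA = a + n -> L = c - b -> x1 = Qu -> x2 = e -> kap' = kap ->
  Num = fund v n Qu - fund v e e - (dlc - dla) - 2 * kap * h (hat v c) (hat v u).
Proof.
move=> -> -> -> -> -> -> -> -> -> -> -> -> -> ->.
rewrite (fund_D h W F v b e) (fund_D h W F v a n) hat_B dotBl (dotC h (hat v u)).
ring.
Qed.

(* o = h(II(v,v),W), d = h(II(v,w),W), k = |hat u|_h^2; the suffixes c and a mark
   derivatives along S and along the fibre of TS. *)
Lemma numerator_algebra (f ph M o k d G E oav fc fa pa kau kcu r B gnQ gee
    oc mc oa kc ka pc dlc dla Num : R) :
  f != 0 -> ph != 0 -> M != 0 ->
  fc = fa -> pc = pa + o / M * ph / f ->
  kc = 2 * ((kcu + o / (2 * f * M) * k) - kau * (r / (f * ph) + B / f)) ->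
  ka = 2 * (0 - kau * (r / (f * ph) + B / f)) ->
  oc = E + 2 * (oav + o / M * (o / f - d)) - G -> mc = 2 * d -> oa = 2 * oav ->
  dlc = - (o / (2 * f * ph * M)) * kc
    + (o / (2 * f * ph * M) * (fc / f + pc / ph + mc / M) - oc / (2 * f * ph * M)) * k ->
  dla = - (o / (2 * f * ph * M)) * ka
    + (o / (2 * f * ph * M) * (fa / f + pa / ph + 0 / M) - oa / (2 * f * ph * M)) * k ->
  Num = gnQ - gee - (dlc - dla) - 2 * (o / (2 * f * ph * M)) * kcu ->
  Num = gnQ - gee + k / (2 * f * ph * M)
    * (E - G + 2 * o ^+ 2 / (M * f) - 4 * o / M * d).
Proof.
move=> f0 p0 m0 -> -> -> -> -> -> -> -> -> ->; field.
by rewrite ?f0 ?p0 ?m0.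
Qed.

(* A Gauss equation. All terms in nabla^A A cancel between the affine curvature
   and the vertical derivatives P, except that the derivative along S of
   legendre (Q U U) (dlc below) gets corrected by its derivative along the fibre
   (dla), i.e. becomes a derivative along a geodesic. *)
Lemma legendre_chern_curv p A U : S p -> A p != 0 -> vfield S p A -> vfield S p U ->
  legendre (A p) (chern_curv S nabla A A U U p) =
    fund (A p) (Q A A A p) (Q A U U p) - fund (A p) (Q A U A p) (Q A U A p)
    + h (hat (A p) (U p)) (hat (A p) (U p)) / (2 * F (A p) * rphi (A p) * mu p)
      * (h (nablaII h S nb A A A p) W
         - h (IIv p (A p) (A p)) (IIv p (A p) (wind p))
         + 2 * h (IIv p (A p) (A p)) W ^+ 2 / (mu p * F (A p))
         - 4 * h (IIv p (A p) (A p)) W / mu p * h (IIv p (A p) (wind p)) W).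
Proof.
move=> Sp A0 vA vU; have tA := vfield_tangent Sp vA; have tU := vfield_tangent Sp vU.
have tl := lie_tangent hS hnb Sp vA vU.
have f0 := F_neq0 hF A0; have p0 := rphi_neq0 hF A0; have m0 := mu_neq0 hF hS Sp.
have vAA := vfield_nabla hnabla Sp A0 vA vA vA.
have vUA := vfield_nabla hnabla Sp A0 vA vU vA.
have vAU := vfield_nabla hnabla Sp A0 vA vA vU.
have vUU := vfield_nabla hnabla Sp A0 vA vU vU.
have ta := vfield_tangent Sp vAA; have tb := vfield_tangent Sp vUA.
set a := nabla p (A p) (A p) A in ta; set b := nabla p (A p) (U p) A in tb.
pose c := nabla p (A p) (A p) U.
have IIAA := II_IIv hS hnb Sp vA vA; pose o := h (IIv p (A p) (A p)) W.
pose k := h (hat (A p) (U p)) (hat (A p) (U p)).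
pose kap := o / (2 * F (A p) * rphi (A p) * mu p).
have tw := wind_tangent h W hS Sp; have ow := wind_orth h W hS Sp.
have TL := @tangent_lin _ _ _ _ hS p.
have oII X t : tangent S p t -> h (II X A p) t = 0 by exact: (II_normal h hS).
have nE := Q_flag_flag hF hS hnabla Sp A0 vA.
have eE := Q_flagE hF hS hnabla Sp A0 vA vU.
set n := Q A A A p in nE; set e := Q A U A p in eE.
have hatn : hat (A p) n = n by rewrite nE (hat_gnormal hF TL tw ow A0 tA (oII A)).
have dFn : dF (A p) n = 0 by rewrite nE (dF_gnormal hF TL tw ow A0 tA (oII A)).
have nrl : h n (rl (A p)) = o / mu p * rphi (A p).
  by rewrite nE (gnormal_rl F TL ow tA (oII A)) IIAA.
have nhat t : tangent S p t -> h n (hat (A p) t) = 0.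
  by move=> tt; rewrite nE (gnormal_hat hF TL ow A0 tA (oII A)).
have hate : h (hat (A p) e) (hat (A p) (U p)) = o / (2 * F (A p) * mu p) * k.
  rewrite eE IIAA addrC hat_lin (hat_hat hF _ A0).
  rewrite (hat_gnormal hF TL tw ow A0 tA (oII U)) dotDl dotZl.
  by rewrite (gnormal_hat hF TL ow A0 tA (oII U) tU) addr0.
have DAv : dS S A p (A p) = a + n by rewrite /n /Qten addrC subrK.
have DAu : dS S A p (U p) = b + e by rewrite /e /Qten addrC subrK.
have eS : Q A A U p = e by exact: (Q_sym hnabla Sp A0 vA vA vU).
have DUv : dS S U p (A p) = c + e by rewrite -eS /Qten addrC subrK.
have torsion : lie S A U p = c - b.
  by rewrite -(chern_torsion_free hnabla Sp A0 vA vA vU).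
(* [legendre (Q A A U)] vanishes along the whole curve because [hat v v = 0]; only the change of the
   flagpole contributes. *)
have T1 : legendre (A p) (dS S (Q A A U) p (U p)) = - fund (A p) (b + e) e.
  have [cu Hcu] := tU.
  have Hl : is_derive (0 : R) 1 (fun s => - (h (II A A (cu s)) W
        / (2 * F (A (cu s)) * rphi (A (cu s)) * mu (cu s)))
      * h (hat (A (cu s)) (A (cu s))) (hat (A (cu s)) (U (cu s)))) 0.
    apply: is_derive_near (is_derive_cst (0 : R) (0 : R) 1).
    apply: filterS (near_curve Hcu (near_vfield_neq0 (vfield_smooth vA) Sp A0)) => s As.
    by rewrite (hat_self hF As) dot0l mulr0.
  apply: (etrans (legendre_dS_Q hF hS hnabla Sp A0 vA vA vU Hcu Hl)).
  by rewrite DAu eS sub0r.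
have [cv Hcv] := tA; have cv0 : cv 0 = p by case: Hcv.
have sA := vfield_smooth vA; have sU := vfield_smooth vU.
have dAc := dS_curve sA Hcv; have dUc := dS_curve sU Hcv.
have Ac : (A \o cv) 0 != 0 by rewrite /= cv0.
have sII := II_smooth hS hnb Sp vA vA.
have som : smooth_at S p (fun q => h (II A A q) W).
  exact: (smooth_at_dot h sII (smooth_at_cst S p W)).
have Hom := dS_curve som Hcv.
have vw := wind_field h hS W Sp.
have smu : smooth_at S p mu.
  apply: smooth_atB; first exact: smooth_at_cst.
  have sw : smooth_at S p (fun q => W - wind q).
    by apply: smooth_atB; [exact: smooth_at_cst | exact: vfield_smooth vw].
  exact: smooth_at_dot.
have Hmu := dS_curve smu Hcv.
have HF := is_derive_F hF Ac dAc; have Hph := is_derive_rphi hF Ac dAc.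
have Hk := is_derive_hat_norm Ac dAc dUc.
have f0' : F ((A \o cv) 0) != 0 by rewrite /= cv0; exact: f0.
have p0' : rphi ((A \o cv) 0) != 0 by rewrite /= cv0; exact: p0.
have m0' : (mu \o cv) 0 != 0 by rewrite /= cv0; exact: m0.
have Hlc := is_derive_mul (is_derive_coef f0' p0' m0' Hom HF Hph Hmu) Hk.
have T2 := legendre_dS_Q hF hS hnabla Sp A0 vA vU vU Hcv Hlc.
have T3 : legendre (A p) (Q A A (fun q => nabla q (A q) (U q) U) p) = 0.
  by rewrite (legendre_QE hF hS hnabla Sp A0 vA vA vUU) (hat_self hF A0) dot0l mulr0.
have T4 : legendre (A p) (Q A U (fun q => nabla q (A q) (A q) U) p) =
    - kap * h (hat (A p) (U p)) (hat (A p) c).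
  rewrite /kap /o -IIAA; exact: (legendre_QE hF hS hnabla Sp A0 vA vU vAU).
have T5 : legendre (A p) (dS S U p (lie S A U p) - nabla p (A p) (lie S A U p) U) =
    - kap * h (hat (A p) (c - b)) (hat (A p) (U p)).
  have [vL Lp] := ext_spec h hS tl.
  by have := legendre_QE hF hS hnabla Sp A0 vA vL vU; rewrite /Qten Lp IIAA torsion.
have l0 z : A p + (0 : R) *: z = A p by rewrite scale0r addr0.
have l0' z : A p + (0 : R) *: z != 0 by rewrite l0.
(* Along the fibre the base point is fixed, so [mu] is constant there. *)
have coefl z (tz : tangent S p z) := is_derive_coef
  (f := fun s => F (A p + s *: z)) (ph := fun s => rphi (A p + s *: z))
  (mu := cst (mu p)) (F_neq0 hF (l0' z)) (rphi_neq0 hF (l0' z)) m0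
  (is_derive_II_line tA tz) (is_derive_F hF (l0' z) (is_derive_line (A p) z 0))
  (is_derive_rphi hF (l0' z) (is_derive_line (A p) z 0)) (is_derive_cst (mu p) (0 : R) 1).
have Hla := is_derive_mul (coefl a ta) (is_derive_hat_norm (l0' a)
  (is_derive_line (A p) a 0) (is_derive_cst (U p) (0 : R) 1)).
have P1 := legendre_Pten hF hS hnabla hnb Sp A0 tA tU ta vU Hla.
have P2 := legendre_Pten hF hS hnabla hnb Sp A0 tA tA tb vU
  (is_derive_flag_product b (U p) A0 (coefl b tb)).
rewrite /= cv0 IIAA in T2; rewrite /= l0 in P1; rewrite /= l0 in P2.
have K1 : h (hat (A p) (dS S A p (A p))) (hat (A p) (U p)) =
    h (hat (A p) a) (hat (A p) (U p)).
  by rewrite DAv hat_D hatn dotDl (nhat _ tU) addr0.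
have K2 : 2 * (h (hat (A p) (dS S U p (A p))) (hat (A p) (U p))
    - h (hat (A p) (dS S A p (A p))) (hat (A p) (U p))
      * (h (rl (A p)) (hat (A p) (U p)) / (F (A p) * rphi (A p))
         + dF (A p) (U p) / F (A p))) =
  2 * ((h (hat (A p) c) (hat (A p) (U p)) + o / (2 * F (A p) * mu p) * k)
    - h (hat (A p) a) (hat (A p) (U p))
      * (h (rl (A p)) (hat (A p) (U p)) / (F (A p) * rphi (A p))
         + dF (A p) (U p) / F (A p))).
  by rewrite K1 DUv hat_D dotDl hate.
have K3 : h (hat (A p) (dS S A p (A p))) (rl (A p)) / F (A p) =
    h (hat (A p) a) (rl (A p)) / F (A p) + o / mu p * rphi (A p) / F (A p).
  by rewrite DAv hat_D hatn dotDl nrl mulrDl.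
have K4 : dF (A p) (dS S A p (A p)) = dF (A p) a by rewrite DAv dF_D dFn addr0.
have K5 : dS S mu p (A p) = 2 * h (IIv p (A p) (wind p)) W.
  exact: (dS_wind_norm hS hnb W tA).
(* Both connections subtract from D_A A a vector with normal part II'(A, A); they differ by the
   tangential part of [gnormal]. This discrepancy is the source of the term 2 omega^2/(mu F). *)
have nbE : nb p (A p) A = (o / mu p) *: (rl (A p) - wind p) + a.
  have := IIE hS hnb Sp vA vA; rewrite DAv nE /gnormal IIAA => E.
  have {}E : nb p (A p) A = a + (IIv p (A p) (A p) + (o / mu p) *: (rl (A p) - wind p))
      - IIv p (A p) (A p) by rewrite [X in _ = _ - X]E subKr.
  by rewrite E [a + (_ + _)]addrCA [_ - _]addrC addKr addrC.
have trl : tangent S p (rl (A p)) by rewrite rlE; exact: (tangentZ hS).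
have K6 : h (IIv p (nb p (A p) A) (A p)) W = h (IIv p a (A p)) W
    + o / mu p * (o / F (A p) - h (IIv p (A p) (wind p)) W).
  have tlw : tangent S p (rl (A p) - wind p) by exact: (tangentB hS).
  rewrite nbE (IIv_lin h hS _ tlw ta tA) dotDl dotZl addrC; congr (_ + _ * _).
  have -> : rl (A p) - wind p = (F (A p))^-1 *: A p + (- 1) *: wind p.
    by rewrite rlE scaleN1r.
  have twn : tangent S p (- 1 *: wind p) by exact: (tangentZ hS).
  rewrite (IIv_lin h hS _ tA twn tA) -[-1 *: wind p]addr0.
  rewrite (IIv_lin h hS _ tw (tangent0 hS Sp) tA).
  rewrite (IIv0 tA) (IIvC hS hnb tw tA) /o.
  move: (IIv p (A p) (A p)) (IIv p (A p) (wind p)) => i1 i2.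
  by rewrite !(dotDl, dotZl) dot0l; ring.
have K7 := etrans (dS_II_wind hS hnb W Sp vA) (congr1 (fun r => _ + 2 * r - _) K6).
have K8 : 2 * (h (hat (A p) 0) (hat (A p) (U p)) - h (hat (A p) a) (hat (A p) (U p))
      * (h (rl (A p)) (hat (A p) (U p)) / (F (A p) * rphi (A p))
         + dF (A p) (U p) / F (A p))) =
  2 * (0 - h (hat (A p) a) (hat (A p) (U p))
      * (h (rl (A p)) (hat (A p) (U p)) / (F (A p) * rphi (A p))
         + dF (A p) (U p) / F (A p))).
  by rewrite hat0 dot0l.
have E0 : legendre (A p) (chern_curv S nabla A A U U p) =
    legendre (A p) (affine_curv S nabla A A U U p)
    - legendre (A p) (Pten nabla p (A p) (U p) U a) + legendre (A p) (Pten nabla p (A p) (A p) U b).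
  by apply: (etrans (legendre_D h W F (A p) _ _)); rewrite legendre_B.
have AF := legendre_affine_curv h W hnabla Sp A0 vA vA vU vU tl.
rewrite torsion in AF T5.
have NumE := numerator_terms E0 AF T1 T2 T3 T4 T5 P1 P2 DAv (erefl _) (erefl _) eS (erefl _).
exact: (numerator_algebra f0 p0 m0 K4 K3 K2 K8 K7 K5
  (erefl _) (erefl _) (erefl _) NumE).
Qed.

End Numerator.

(** * The flag curvature *)

Section Indicatrix.
Context {R : realType} {V : normedVectType R} (h : {dot V for (idfun : R -> R)}).
Context (W : V) (F : V -> R) (hF : randers_norm h W F).
Implicit Types x t v : V.

Lemma fund_def v x y :
  fund h W F v x y = 
  dF h W F v x * dF h W F v y + h (hat h W F v x) (hat h W F v y) / rphi h W F v.
Proof. by []. Qed.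

(** F is known only through its equation, so uniqueness of the positive solution is needed: the
    quadratic factors as (f - 1)((1 - c) f + a), and the second factor is positive. *)
Lemma F_eq1 x : h (x - W) (x - W) = 1 -> F x = 1.
Proof.
move=> Ex; have lam := randers_wind hF.
have x0 : x != 0.
  apply/eqP => x0; move: Ex lam; rewrite x0 sub0r !(dotNl, dotNr) opprK => ->.
  by rewrite ltxx.
have := F_quadratic hF x0; have := F_gt0 hF x0; have := dot_gt0 h x0; move: Ex.
rewrite !(dotBl, dotBr) (dotC h W x).
move: (F x) (h x x) (h x W) (h W W) lam => f a b c lam Ex a0 f0 Eq.
have E : (f - 1) * ((1 - c) * f + a) = 0.
  have -> : a = 1 - c + 2 * b by lra.
  have -> : 1 - c + 2 * b = a by lra.
  have : (1 - c) * f ^+ 2 + 2 * f * b - a = 0 by rewrite Eq subrr.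
  have -> : b = (a - 1 + c) / 2 by lra.
  move=> <-; by field.
have D : (1 - c) * f + a != 0 by rewrite gt_eqF// addr_gt0// mulr_gt0// subr_gt0.
by move/eqP: E; rewrite mulf_eq0 (negPf D) orbF subr_eq0 => /eqP.
Qed.

Lemma F_rl v : v != 0 -> F (rl F v) = 1.
Proof. by move=> v0; apply: F_eq1; exact: rl_unit. Qed.

Lemma rl_neq0 v : v != 0 -> rl F v != 0.
Proof.
by move=> v0; rewrite rlE scaler_eq0 negb_or v0 invr_eq0 (F_neq0 hF v0).
Qed.

(** Forwards, dF annihilates the velocities of curves on which F = 1. Backwards, tangency demands an
    actual curve, and by [F_eq1] one on the h-unit sphere about [W] will do. *)
Lemma indicatrix_tangent v t : v != 0 ->
  tangent (indicatrix F) (rl F v) t <-> h (rl F v - W) t = 0.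
Proof.
move=> v0; have l0 := rl_neq0 v0; have lu := rl_unit hF v0; split.
  move=> [c Hc]; have [sc c0 Sc _] := Hc.
  have Hc' : is_derive (0 : R) 1 c t.
    have := smooth_near_differentiable sc => /derivable1_diffP dc.
    by case: Hc => _ _ _ <-; rewrite derive1E; exact: derivableP.
  have c00 : c 0 != 0 by rewrite c0.
  have HF := is_derive_F hF c00 Hc'.
  have H1 : is_derive (0 : R) 1 (fun s => F (c s)) 0.
    apply: is_derive_near (is_derive_cst (1 : R) (0 : R) 1).
    by apply: filterS Sc => s /= ->.
  have := is_derive_unique HF H1; rewrite c0 dF_def => /eqP.
  rewrite mulf_eq0 invr_eq0 (negPf (rphi_neq0 hF l0)) /= => /eqP.
  by rewrite {1}/rl -lock F_rl// invr1 scale1r.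
(* Stereographic parametrisation of a great circle of the sphere centred at W *)
move=> et; set e := rl F v - W in et lu; pose b := h t t / 4.
have b0 : 0 <= b by rewrite divr_ge0// dot_ge0.
pose d (s : R) := 1 + b * (s * s).
have d0 s : d s != 0 by rewrite gt_eqF// ltr_wpDr// mulr_ge0// -expr2 sqr_ge0.
pose c (s : R) := W + (d s)^-1 *: ((1 - b * (s * s)) *: e + s *: t).
have sid : smooth_near (0 : R) (fun s : R => s) by exact: smooth_near_id.
have sb : smooth_near (0 : R) (fun s : R => b * (s * s)).
  by apply: smooth_nearM; [exact: smooth_near_cst | exact: smooth_nearM].
exists c; split.
- apply: smooth_nearD; first exact: smooth_near_cst.
  apply: smooth_nearZ.
    apply: smooth_nearV; first exact: d0.
    by apply: smooth_nearD => //; exact: smooth_near_cst.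
  apply: smooth_nearD; apply: smooth_nearZ => //.
  + by apply: smooth_nearB => //; exact: smooth_near_cst.
  + exact: smooth_near_cst.
  + exact: smooth_near_cst.
- rewrite /c /d mul0r mulr0 addr0 subr0 invr1 !scale1r scale0r addr0 /e.
  by rewrite addrC subrK.
- apply: filterS (@filterT _ (nbhs (0 : R)) _) => s _; apply: F_eq1.
  rewrite /c addrC addKr.
  rewrite !(dotZl, dotZr) dotDl !dotDr !(dotZl, dotZr) lu (dotC h t e) et.
  (* The quarter in [b] is forced by (1 - b s^2)^2 + 4 b s^2 = (1 + b s^2)^2. *)
  have -> : h t t = 4 * b by rewrite /b; field.
  have := d0 s; rewrite /d; move: (b) => b' d0'; field.
  by rewrite d0'.
- apply: is_derive1.
  have Hid := is_derive_id (0 : R) 1.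
  have Hb := is_derive_mul (is_derive_cst b (0 : R) 1) (is_derive_mul Hid Hid).
  have Hd := is_derive_add (is_derive_cst (1 : R) (0 : R) 1) Hb.
  have Hd' := is_derive_sub (is_derive_cst (1 : R) (0 : R) 1) Hb.
  have Hi := is_derive_inv (a := d) (d0 0) Hd.
  have He := is_derive_scale Hd' (is_derive_cst e (0 : R) 1).
  have Ht := is_derive_scale Hid (is_derive_cst t (0 : R) 1).
  apply: is_derive_eq (is_derive_add (is_derive_cst W (0 : R) 1)
    (is_derive_scale Hi (is_derive_add He Ht))) _.
  rewrite /= /d /cst !(mul0r, mulr0, addr0, add0r, subr0, scaler0, scale0r, oppr0) invr1.
  by rewrite !scale1r.
Qed.

End Indicatrix.

Section FinalAlgebra.
Context {R : realType}.

(** Here [a], [b], [c], [d] are omega on (v, v), (u, u), (u, v), (v, w), [k] is |hat u|_h^2, and [y]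
    is omega of v and W^top_{S cap Sigma}. On the right the term with [4 * ph] cancels against the
    last summand [a / f] of [y]. *)
Lemma flag_curvature_algebra
    (f ph M a b c d g1 g2 e k hl hul num den Kh hn n2 y : R) :
  f != 0 -> ph != 0 -> M != 0 -> k != 0 -> hl * k - hul ^+ 2 != 0 ->
  num = (g1 + a * b / M) / ph
    - (g2 + c ^+ 2 / M + (a / M) ^+ 2 * k / (4 * f ^+ 2)) / ph
    + k / (2 * f * ph * M) * (e + 2 * a ^+ 2 / (M * f) - 4 * a / M * d) ->
  den = f ^+ 2 * k / ph -> Kh = (g1 - g2) / (f ^+ 2 * (hl * k - hul ^+ 2)) ->
  hn ^+ 2 = hul ^+ 2 / k -> n2 = ph ^+ 2 / M ->
  y = - (ph / M) * (a / f - d) + a / f ->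
  num / den = (hl - hn ^+ 2) * Kh
    + n2 / (ph ^+ 2 * f ^+ 2 * k) * (b * a - c ^+ 2)
    + 1 / (2 * f ^+ 3 * ph ^+ 2) * n2
      * (e + 1 / (ph ^+ 2 * f) * a ^+ 2 * (4 * ph - 5 / 2 * n2)
         - 4 / ph * a * y).
Proof.
move=> f0 p0 m0 k0 D0 -> -> -> -> -> ->; field.
by rewrite ?f0 ?p0 ?m0 ?k0 ?D0.
Qed.

End FinalAlgebra.

Section FlagCurvature.
Context {R : realType} {V : normedVectType R} (h : {dot V for (idfun : R -> R)}).
Context (W : V) (F : V -> R) (hF : randers_norm h W F).
Context (m : nat) (S : set V) (hS : submanifold m S).
Context (nabla : V -> V -> V -> (V -> V) -> V) (hnabla : chern_connection S F nabla).
Context (nb : V -> V -> (V -> V) -> V) (hnb : levi_civita h S nb).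

Local Notation rl := (rl F).
Local Notation rphi := (rphi h W F).
Local Notation dF := (dF h W F).
Local Notation hat := (hat h W F).
Local Notation fund := (fund h W F).
Local Notation legendre := (legendre h W F).
Local Notation IIv := (IIv h S).
Local Notation Q := (Qten S nabla).
Local Notation wind := (wind h W S).
Local Notation mu := (mu h W S).

Section Normal.
Variables (p : V) (A U : V -> V).
Hypotheses (Sp : S p) (A0 : A p != 0) (vA : vfield S p A) (vU : vfield S p U).
Let TL := @tangent_lin _ _ _ _ hS p.
Let tA := vfield_tangent Sp vA.
Let tU := vfield_tangent Sp vU.
Let tw := wind_tangent h W hS Sp.
Let ow := wind_orth h W hS Sp.
Let oII x y t (tt : tangent S p t) : h (IIv p x y) t = 0.
Proof. exact: (IIv_normal h hS). Qed.
Let f0 := F_neq0 hF A0.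
Let p0 := rphi_neq0 hF A0.
Let m0 := mu_neq0 hF hS Sp.

Lemma fund_gnormals x y : (forall t, tangent S p t -> h x t = 0) ->
  (forall t, tangent S p t -> h y t = 0) ->
  fund (A p) (gnormal h W F (wind p) (A p) x) (gnormal h W F (wind p) (A p) y) =
  (h x y + h x W * h y W / mu p) / rphi (A p).
Proof.
move=> ox oy; rewrite -(gnormal_dot hF TL tw ow A0 tA ox oy) fund_def.
rewrite (dF_gnormal hF TL tw ow A0 tA ox) mul0r add0r.
by rewrite (hat_gnormal hF TL tw ow A0 tA ox) (hat_gnormal hF TL tw ow A0 tA oy).
Qed.

Lemma fund_cancel v n x y : fund v n (x - y) = 0 -> fund v n x = fund v n y.
Proof.
by rewrite fund_C (fund_B h W F v x y) (fund_C h W F v x n) (fund_C h W F v y n) => /subr0_eq.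
Qed.

(** Q(U, U) differs by a tangent vector from the [gnormal] of II'(u, u), and Q(A, A) is
    g_v-orthogonal to tangent vectors, so the replacement does not change the product. *)
Lemma fund_flag_normal_flag :
  fund (A p) (Q A A A p) (Q A U U p) =
  (h (IIv p (A p) (A p)) (IIv p (U p) (U p))
   + h (IIv p (A p) (A p)) W * h (IIv p (U p) (U p)) W / mu p) / rphi (A p).
Proof.
have nE := Q_flag_flag hF hS hnabla Sp A0 vA.
rewrite (II_IIv hS hnb Sp vA vA) in nE.
have tQ := Q_tangent_part h hS hnabla Sp A0 vA vU vU.
have E : normal_part h S p (dS S U p (U p)) = IIv p (U p) (U p).
  exact: (II_IIv hS hnb Sp vU vU).
rewrite E in tQ.
pose n' := gnormal h W F (wind p) (A p) (IIv p (U p) (U p)).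
have tl : tangent S p (rl (A p) - wind p).
  exact: (tangentB hS (T_rl F TL tA) tw).
have tQ' : tangent S p (Q A U U p - n').
  rewrite /n' /gnormal opprD addrA.
  exact: (tangentB hS tQ (tangentZ hS _ tl)).
have gn0 := fund_gnormal hF TL tw ow A0 tA (@oII (A p) (A p)) tQ'.
apply: (etrans (congr1 (fun z => fund (A p) z _) nE)); apply: (etrans (fund_cancel gn0)).
exact: (fund_gnormals (@oII (A p) (A p)) (@oII (U p) (U p))).
Qed.

Lemma fund_shift v n x (c : R) : dF v n = 0 -> hat v n = n -> dF v x = 0 ->
  hat v x = x -> h n x = 0 ->
  fund v (n + c *: x) (n + c *: x) = (h n n + c ^+ 2 * h x x) / rphi v.
Proof.
move=> dn hn dx hx nx; rewrite [n + _]addrC fund_def dF_lin hat_lin dn hn dx hx.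
rewrite mulr0 addr0 mul0r add0r; congr (_ / _).
rewrite !(dotDl, dotZl) !(dotDr, dotZr) (dotC h x n) nx; ring.
Qed.

Lemma fund_flag_normal_algebra (a r o o' f ph M k : R) : f != 0 -> M != 0 ->
  a = r + o' * o' / M ->
  (a + (o / (2 * f * M)) ^+ 2 * k) / ph =
  (r + o' ^+ 2 / M + (o / M) ^+ 2 * k / (4 * f ^+ 2)) / ph.
Proof.
by move=> f0' M0 ->; congr (_ / _); field; rewrite ?f0' ?M0.
Qed.

(** The two components of Q(U, A) in [Q_flagE] lie in ker dF and are h-orthogonal, so their squares
    add. *)
Lemma fund_flag_normal :
  fund (A p) (Q A U A p) (Q A U A p) =
  (h (IIv p (U p) (A p)) (IIv p (U p) (A p))
   + h (IIv p (U p) (A p)) W ^+ 2 / mu p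
   + (h (IIv p (A p) (A p)) W / mu p) ^+ 2
     * h (hat (A p) (U p)) (hat (A p) (U p)) / (4 * F (A p) ^+ 2)) / rphi (A p).
Proof.
have eE := Q_flagE hF hS hnabla Sp A0 vA vU.
rewrite (II_IIv hS hnb Sp vA vA) (II_IIv hS hnb Sp vU vA) in eE.
have oUA := @oII (U p) (A p).
have dn := dF_gnormal hF TL tw ow A0 tA oUA.
have hn := hat_gnormal hF TL tw ow A0 tA oUA.
have nh := gnormal_hat hF TL ow A0 tA oUA tU.
have nn := gnormal_dot hF TL tw ow A0 tA oUA oUA.
apply: (etrans (congr1 (fun z => fund (A p) z z) eE)).
apply: (etrans (fund_shift _ dn hn (dF_hat hF _ A0) (hat_hat hF _ A0) nh)).
exact: (fund_flag_normal_algebra _ _ _ f0 m0 nn).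
Qed.

End Normal.

(** On T_pS the vectors v/F - W and v/F - w define the same functional, so the intersection is the
    hyperplane of T_pS orthogonal to v/F - w. Projecting [W] onto it amounts to projecting v/F, with
    coefficient h(v/F, v/F - w)/mu = phi/mu. *)
Lemma hproj_indicatrix p v : S p -> v != 0 -> tangent S p v ->
  hproj h (tangent S p `&` tangent (indicatrix F) (rl v)) W =
  - (rphi v / mu p) *: (rl v - wind p) + rl v.
Proof.
move=> Sp v0 tv; have TL := @tangent_lin _ _ _ _ hS p.
have tw := wind_tangent h W hS Sp; have ow := wind_orth h W hS Sp.
have trl : tangent S p (rl v) by exact: (T_rl F TL).
have tl : tangent S p (rl v - wind p) by exact: (tangentB hS).
have m0 := mu_neq0 hF hS Sp.
have iT t := indicatrix_tangent hF t v0.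
apply: hproj_unique.
- move=> x y [tx /iT ix] [ty /iT iy]; split; first exact: (tangentB hS).
  by apply/iT; rewrite dotBr ix iy subrr.
- split; first exact: TL.
  apply/iT; rewrite dotDr dotZr -(rl_wind F ow v tl).
  rewrite (rl_wind_norm hF TL tw ow v0 tv) -/(mu p) -rphi_def.
  by rewrite mulNr divfK// addNr.
- move=> t [tt /iT it]; have := rl_wind F ow v tt; rewrite it => lw.
  have -> : W - (- (rphi v / mu p) *: (rl v - wind p) + rl v) =
      (rphi v / mu p) *: (rl v - wind p) - (rl v - W).
    by rewrite scaleNr opprD opprK addrCA opprB.
  by rewrite dotBl dotZl lw it mulr0 subr0.
Qed.

(** Equality in Cauchy-Schwarz would make [hat v u], and with it [u], a multiple of v. *)
Lemma flag_nondegenerate p v u : S p -> v != 0 -> free [:: v; u] ->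
  h (rl v) (rl v) * h (hat v u) (hat v u) - h (hat v u) (rl v) ^+ 2 != 0.
Proof.
move=> Sp v0 fvu; apply/eqP => D0; have l0 := rl_neq0 hF v0.
have hl0 : h (rl v) (rl v) != 0 by rewrite gt_eqF// dot_gt0.
have : h (h (rl v) (rl v) *: hat v u - h (hat v u) (rl v) *: rl v)
    (h (rl v) (rl v) *: hat v u - h (hat v u) (rl v) *: rl v) = 0.
  apply: etrans (mulr0 (h (rl v) (rl v))); rewrite -D0.
  move: (rl v) (hat v u) => x y; rewrite !(dotBl, dotBr, dotZl, dotZr) (dotC h x y).
  by ring.
move=> /dot_eq0/subr0_eq E; move: fvu.
rewrite (perm_free (Y := [:: u; v])); last by rewrite (perm_catC [:: v] [:: u]).
rewrite free_cons span_seq1 => /andP[/negP uv _]; apply: uv.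
have -> : u = (dF v u + h (hat v u) (rl v) / h (rl v) (rl v)) *: rl v.
  rewrite scalerDl [_ / _]mulrC -scalerA -E scalerA mulVf// scale1r.
  by rewrite hat_def addrC subrK.
by rewrite rlE scalerA memvZ// memv_line.
Qed.

(** [u] and [hat v u] differ by a multiple of v, which leaves the Gram determinant unchanged;
    rescaling v gives the factor F^2. *)
Lemma gram_flag v u : v != 0 ->
  h v v * h u u - h v u ^+ 2 =
  F v ^+ 2 * (h (rl v) (rl v) * h (hat v u) (hat v u) - h (hat v u) (rl v) ^+ 2).
Proof.
move=> v0; have uE : u = hat v u + dF v u *: rl v by rewrite hat_def subrK.
rewrite -{1 2 3}(rlK hF v0) {1 2 3}uE.
move: (hat v u) (rl v) (dF v u) (F v) => x y b f.
rewrite !(dotDl, dotDr, dotZl, dotZr) (dotC h y x); ring.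
Qed.

Lemma flag_denominator v u : v != 0 ->
  Defs.Lfun F v * gten F v u u - gten F v u v ^+ 2 =
  F v ^+ 2 * h (hat v u) (hat v u) / rphi v.
Proof.
move=> v0; rewrite !(gtenE hF _ _ v0) (fund_flag hF _ v0) fund_def /Defs.Lfun.
have p0 := rphi_neq0 hF v0; have -> : legendre v u = F v * dF v u by [].
by field; rewrite ?p0.
Qed.

Lemma II_wind_flag p v (c : R) : S p -> v != 0 -> tangent S p v ->
  h (IIv p v (c *: (rl v - wind p) + rl v)) W =
  c * (h (IIv p v v) W / F v - h (IIv p v (wind p)) W) + h (IIv p v v) W / F v.
Proof.
move=> Sp v0 tv; have TL := @tangent_lin _ _ _ _ hS p.
have tw := wind_tangent h W hS Sp; have trl := T_rl F TL tv.
have tl : tangent S p (rl v - wind p) by exact: (tangentB hS trl tw).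
have tc : tangent S p (c *: (rl v - wind p) + rl v) by exact: TL.
have E : IIv p (rl v) v = (F v)^-1 *: IIv p v v.
  rewrite rlE -[_ *: v]addr0 (IIv_lin h hS _ tv (tangent0 hS Sp) tv).
  by rewrite (IIv0 h hS tv) addr0.
have E' : IIv p (rl v - wind p) v = (F v)^-1 *: IIv p v v - IIv p v (wind p).
  rewrite addrC -scaleN1r (IIv_lin h hS _ tw trl tv) E scaleN1r addrC.
  by rewrite (IIvC hS hnb tw tv).
rewrite (IIvC hS hnb tv tc) (IIv_lin h hS _ tl trl tv) E E'.
have f0 := F_neq0 hF v0; move: (IIv p v v) (IIv p v (wind p)) => x y.
by rewrite !(dotDl, dotNl, dotZl); field; rewrite ?f0.
Qed.

End FlagCurvature.

Theorem theorem14 (R : realType) (V : normedVectType R)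
    (h : {dot V for (idfun : R -> R)}) (W : V) (F : V -> R)
    (hF : randers_norm h W F)
    (m : nat) (S : set V) (hS : submanifold m S)
    (nabla : V -> V -> V -> (V -> V) -> V) (hnabla : chern_connection S F nabla)
    (nb : V -> V -> (V -> V) -> V) (hnb : levi_civita h S nb)
    (p v u : V) (hv : slitTS S (p, v)) (hu : tangent S p u)
    (huv : free [:: v; u]) :
  let l := (F v)^-1 *: v in
  let phi := h (l - W) l in
  let u' := u - (phi^-1 * h (l - W) u) *: l in
  let Wp := hproj h (tangent S p) W in
  let Wv := hproj h (tangent S p `&` tangent (indicatrix F) l) W in
  let N := hnorm h (l - Wv) in
  let II' := IIv h S p in
  flag_curvature S F nabla p v u =
    (h l l - h ((hnorm h u')^-1 *: u') l ^+ 2)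
      * sectional_curvature h S nb p v u
    + N ^+ 2 / (phi ^+ 2 * F v ^+ 2 * h u' u')
      * (h (II' u u) W * h (II' v v) W - h (II' u v) W ^+ 2)
    + 1 / (2 * F v ^+ 3 * phi ^+ 2) * N ^+ 2
      * (h (nablaIIv h S nb p v v v) W - h (II' v v) (II' v Wp)
         + 1 / (phi ^+ 2 * F v) * h (II' v v) W ^+ 2
           * (4 * phi - 5 / 2 * N ^+ 2)
         - 4 / phi * h (II' v v) W * h (II' v Wv) W).
Proof.
move=> l phi u' Wp Wv N II'; have [/= Sp tv v0] := hv.
have [vA Ap] := ext_spec h hS tv; have [vU Up] := ext_spec h hS hu.
have A0 : ext S p v p != 0 by rewrite Ap.
have f0 := F_neq0 hF v0; have p0 := rphi_neq0 hF v0; have m0 := mu_neq0 hF hS Sp.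
have TL := @tangent_lin _ _ _ _ hS p.
have tw := wind_tangent h W hS Sp; have ow := wind_orth h W hS Sp.
have lE : l = rl F v by rewrite rlE.
have phiE : phi = rphi h W F v by rewrite rphi_def -lE.
have u'E : u' = hat h W F v u by rewrite hat_def dF_def -phiE -lE.
have D0 := flag_nondegenerate hF Sp v0 huv.
have k0 : h (hat h W F v u) (hat h W F v u) != 0.
  apply: contraNneq D0 => /dot_eq0 ->.
  by rewrite !dot0l mulr0 expr0n subrr.
have num := legendre_chern_curv hF hS hnabla hnb Sp A0 vA vU.
rewrite (fund_flag_normal_flag hF hS hnabla hnb Sp A0 vA vU) in num.
rewrite (fund_flag_normal hF hS hnabla hnb Sp A0 vA vU) Ap Up in num.
(* The curvature vector is paired with the flagpole itself, so [gten] reduces to [legendre]. *)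
have numE := etrans (gtenE hF (chern_curv S nabla (ext S p v) (ext S p v)
  (ext S p u) (ext S p u) p) v v0) (etrans (fund_flag hF _ v0) num).
have gauss := gauss_equation hS hnb Sp vA vU vU vA; rewrite Ap Up in gauss.
have WvE : Wv = - (rphi h W F v / mu h W S p) *: (rl F v - wind h W S p) + rl F v.
  by rewrite /Wv lE; exact: (hproj_indicatrix hF hS Sp v0 tv).
have N2 : N ^+ 2 = phi ^+ 2 / mu h W S p.
  rewrite /N hnorm_sqr WvE lE opprD addrCA subrr addr0 -scaleNr opprK.
  rewrite dotZl dotZr (rl_wind_norm hF TL tw ow v0 tv) -/(mu h W S p) phiE.
  by field.
have IIWv := II_wind_flag hF hS hnb (- (rphi h W F v / mu h W S p)) Sp v0 tv.
rewrite -WvE -phiE in IIWv.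
have hn : h ((hnorm h u')^-1 *: u') l ^+ 2 = h u' l ^+ 2 / h u' u'.
  by rewrite dotZl exprMn exprVn hnorm_sqr mulrC.
have KhE : sectional_curvature h S nb p v u =
    (h (IIv h S p v v) (IIv h S p u u) - h (IIv h S p u v) (IIv h S p u v))
    / (F v ^+ 2 * (h l l * h u' u' - h u' l ^+ 2)).
  rewrite /sectional_curvature (gram_flag hF u v0) -lE -u'E; congr (_ / _).
  exact: (etrans gauss (congr2 (fun a b => a - b) (dotC h _ _)
    (congr1 (fun z => h z _) (IIvC hS hnb tv hu)))).
have den := flag_denominator hF u v0.
rewrite -phiE -u'E in numE den; rewrite -lE -u'E in D0; rewrite -u'E in k0.
rewrite -phiE in p0.
exact: (flag_curvature_algebra f0 p0 m0 k0 D0 numE den KhE hn N2 IIWv).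
Qed.
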